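(* Let $a>0$, $\gamma\in\mathbb{R}$, $\alpha>0$, $\mu>\max\left\{\frac{\gamma+1}{\alpha},0\right\}$, and for $x>0$ let $g(x,a,\gamma,\alpha,\mu)=\sum_{k=0}^{\infty}\frac{(k+a)^{\gamma}}{(x(k+a)^{\alpha}+1)^{\mu}}$. Then the following asymptotic expansions hold as $x\to+0$. (i) If $-\frac{\gamma+1}{\alpha}\notin\mathbb{Z}_+$, then $$g(x,a,\gamma,\alpha,\mu)\underset{x\to+0}{\sim}\frac{\Gamma\left(\frac{\gamma+1}{\alpha}\right)\Gamma\left(\mu-\frac{\gamma+1}{\alpha}\right)}{\alpha\,\Gamma(\mu)}\,x^{-\frac{\gamma+1}{\alpha}}+\sum_{k=0}^{\infty}\frac{(-1)^k}{k!}\,\frac{\Gamma(\mu+k)}{\Gamma(\mu)}\,\zeta(-\alpha k-\gamma,a)\,x^k .$$ (ii) If $-\frac{\gamma+1}{\alpha}=r\in\mathbb{Z}_+$, then $$g(x,a,\gamma,\alpha,\mu)\underset{x\to+0}{\sim}\frac{\Gamma(\mu+r)(-1)^rx^r}{\Gamma(\mu)\Gamma(r+1)}\left(-\frac{\ln x}{\alpha}+\frac{\Gamma'(r+1)}{\alpha\,\Gamma(r+1)}-\frac{\Gamma'(a)}{\Gamma(a)}-\frac{\Gamma'(\mu+r)}{\alpha\,\Gamma(\mu+r)}\right)+\sum_{k=0,\,k\neq r}^{\infty}\frac{(-1)^k}{k!}\,\frac{\Gamma(\mu+k)}{\Gamma(\mu)}\,\zeta(-\alpha k-\gamma,a)\,x^k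 .$$
   Context: $\mathbb{Z}_+=\{0,1,2,\dots\}$. $\Gamma$ is the Euler gamma function, meromorphically continued to $\mathbb{C}$ (with simple poles exactly at $0,-1,-2,\dots$). For fixed $a>0$, $\zeta(s,a)$ is the Hurwitz zeta function: $\zeta(s,a)=\sum_{k=0}^{\infty}(k+a)^{-s}$ for $\operatorname{Re}s>1$, continued analytically to $\mathbb{C}\setminus\{1\}$ (with a simple pole at $s=1$). Meaning of the asymptotic expansions: for a function $F$ on $(0,+\infty)$, a function $T$ and coefficients $c_k$, the relation $F(x)\underset{x\to+0}{\sim}T(x)+\sum_{k}c_kx^k$ (sum over $k\in\mathbb{Z}_+$, or over $k\in\mathbb{Z}_+$ with $k\neq r$) means that for every $N\in\mathbb{Z}_+$ one has $F(x)-T(x)-\sum_{k\le N}c_kx^k=o(x^N)$ as $x\to+0$ (the finite sum being over the admissible indices $k\le N$). Here $T$ is the first displayed term (the term with $x^{-(\gamma+1)/\alpha}$ in (i), the term with $\ln x$ in (ii)). *)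

(* Defs.v *)
From Stdlib Require Export Reals.
From Stdlib Require Import Factorial ClassicalEpsilon.
From Coquelicot Require Export Coquelicot.

Open Scope R_scope.

(* Little-o relative to x^N for every N. [T] is the leading term; the power
   c k * x^k occurs in the expansion only for the indices with [adm k = true]. *)
Definition asymptotic_expansion_at_0
    (F T : R -> R) (adm : nat -> bool) (c : nat -> R) : Prop :=
  forall N : nat,
    is_domin (at_right 0)
      (fun x : R => x ^ N)
      (fun x : R =>
         F x - T x - sum_n (fun k => if adm k then c k * x ^ k else 0) N).

(* The integral converges for x > 0 only. *)
Definition Euler_integral (x : R) : R :=
  RInt_gen (fun t => Rpower t (x - 1) * exp (- t))
    (at_right 0) (Rbar_locally p_infty).

Fixpoint Gamma_aux (n : nat) (x : R) : R :=
  match n with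
  | O => Euler_integral x
  | S m => Gamma_aux m (x + 1) / x
  end.

(* Restriction to the real line of the meromorphic Gamma function: the
   functional equation Gamma x = Gamma (x + 1) / x is applied until the argument
   is positive. [Z.to_nat (up (- x))] is 0 for x > 0, and otherwise the least n
   with x + n > 0. The values at the poles 0, -1, -2, ... are meaningless. *)
Definition Gamma (x : R) : R := Gamma_aux (Z.to_nat (up (- x))) x.

Definition Cexp (z : C) : C := (exp (Re z) * cos (Im z), exp (Re z) * sin (Im z)).

Definition analytic_at (f : C -> C) (z0 : C) : Prop :=
  exists (c : nat -> C) (rho : R),
    0 < rho /\
    forall z : C, Cmod (z - z0)%C < rho ->
      is_pseries (K := C_AbsRing) (V := C_NormedModule) c (z - z0)%C (f z).

(* As C minus {1} is connected, at most one function satisfies this,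
   up to its value at s = 1. *)
Definition is_hurwitz_zeta (a : R) (f : C -> C) : Prop :=
  (forall s : C, s <> RtoC 1 -> analytic_at f s) /\
  (forall s : C, 1 < Re s ->
     is_series (K := C_AbsRing) (V := C_NormedModule)
       (fun k : nat => Cexp (- s * RtoC (ln (INR k + a)))%C) (f s)).

Definition hurwitz_zeta (s : C) (a : R) : C :=
  epsilon (inhabits (fun _ : C => RtoC 0)) (is_hurwitz_zeta a) s.

(* The zeta values at real s <> 1 are real, so [Re] loses nothing. *)
Definition hurwitz_zeta_R (s a : R) : R := Re (hurwitz_zeta (RtoC s) a).

Definition g (x a gamma alpha mu : R) : R :=
  Series (fun k : nat =>
    Rpower (INR k + a) gamma
    / Rpower (x * Rpower (INR k + a) alpha + 1) mu).

Definition g_coeff (a gamma alpha mu : R) (k : nat) : R :=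
  (-1) ^ k / INR (fact k) * (Gamma (mu + INR k) / Gamma mu)
  * hurwitz_zeta_R (- alpha * INR k - gamma) a.

(* Main.v *)
From Stdlib Require Import ZArith Lra Lia ClassicalEpsilon FunctionalExtensionality.
Require Import Defs.

(** For [f] differentiable, integration by parts gives
    [f t = int_t^(t+1) f - int_0^1 (1 - u) f' (t + u) du]; write [K] for the second
    operator. Summed over the shifts of [t^-s] this reads
    [zeta (s, t) = t^(1-s) / (s-1) + s K[zeta (s+1, .)] (t)], a recursion that continues
    [w zeta (1+w, t)] to an entire function of [w]. Summed over the terms of [g] it reads
    [g (gam, mu) = int_a^oo - K[(gam - alpha mu) g (gam-1, mu) + alpha mu g (gam-1, mu+1)]],
    where the integral is an incomplete beta integral. By induction on [gam], starting
    from the absolutely convergent range [gam < -1], this yields the leading term and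
    the constant term of [g], locally uniformly in [a]: both recursions are the same.
    Higher orders follow from [dg/dx = - mu g (gam + alpha, mu + 1)] by integration.
    Euler's integral, the beta integral and the logarithmic case are evaluated by the
    Bohr-Mollerup argument: a convex (or monotone) solution of the difference equation
    is unique. *)

(** * Series and dominated convergence *)

(** Since [K] averages over [[t, t + 1]], a limit known at the single shift [a] cannot be fed back
    into the recursion; this forces the locally uniform statements. The leading term of [g] does not
    depend on the shift, so it cancels in the [t]-derivative: under [K] only a regular limit
    remains, and the whole singular part comes from the beta integral. The zeta function is picked
    by [epsilon] from an analytic specification, so existence and uniqueness of the continuation
    must be proved over [C], although only real arguments are evaluated. The product
    [w zeta (1 + w, t)] has no pole: its real Taylor series at [w = 0] has infinite radius and hence
    defines the complex function, and uniqueness is an identity theorem along segments. The change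
    of [(gam, mu)] into [(gam + alpha, mu + 1)] preserves [gam + 1 < alpha mu], lowers [r] by one
    and sends the coefficient of index [k + 1] to that of index [k]. Thus all analysis takes place
    at order zero. *)

Lemma filterlim_R {T : Type} (F : (T -> Prop) -> Prop) {FF : Filter F} (f : T -> R) (l : R) :
  filterlim f F (locally l) <-> forall eps, 0 < eps -> F (fun x => Rabs (f x - l) < eps).
Proof.
  rewrite (@filterlim_locally T R_UniformSpace F FF f l). split.
  - intros H eps Heps. exact (H (mkposreal eps Heps)).
  - intros H eps. exact (H eps (cond_pos eps)).
Qed.

Lemma is_series_sum_n_lim (a : nat -> R) (l : R) : is_series a l <-> is_lim_seq (sum_n a) l.
Proof. reflexivity. Qed.

Lemma Series_remainder_le (a b : nat -> R) :
  (forall n, Rabs (a n) <= b n) -> ex_series b ->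
  forall N, Rabs (Series a - sum_n a N) <= Series b - sum_n b N.
Proof.
  intros Hab Hb N.
  assert (Hea : ex_series (fun n => Rabs (a n))).
  { apply (ex_series_le (fun n => Rabs (a n)) b); [|exact Hb].
    intro n. change (Rabs (Rabs (a n)) <= b n). rewrite Rabs_Rabsolu. apply Hab. }
  assert (Hea' := ex_series_Rabs _ Hea).
  rewrite (Series_incr_n a (S N)), (Series_incr_n b (S N)) by (auto with arith).
  simpl pred. rewrite <- !sum_n_Reals.
  replace (_ + _ - sum_n a N) with (Series (fun k => a (S N + k)%nat)) by ring.
  replace (_ + _ - sum_n b N) with (Series (fun k => b (S N + k)%nat)) by ring.
  apply Rle_trans with (Series (fun k => Rabs (a (S N + k)%nat))).
  - apply Series_Rabs. apply (ex_series_incr_n (fun n => Rabs (a n))). exact Hea.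
  - apply Series_le.
    + intro n. split; [apply Rabs_pos|apply Hab].
    + apply (ex_series_incr_n b). exact Hb.
Qed.

Lemma Series_remainder_lim (b : nat -> R) :
  ex_series b -> forall eps, 0 < eps -> exists N, Series b - sum_n b N < eps.
Proof.
  intros Hb eps Heps.
  assert (H : is_lim_seq (sum_n b) (Series b)) by (apply Series_correct; exact Hb).
  apply is_lim_seq_spec in H. destruct (H (mkposreal eps Heps)) as [N HN].
  exists N. specialize (HN N (Nat.le_refl _)). simpl in HN.
  apply Rabs_lt_between in HN. lra.
Qed.

Lemma filterlim_sum_n {T : Type} (F : (T -> Prop) -> Prop) {FF : Filter F}
    (u : T -> nat -> R) (l : nat -> R) (N : nat) :
  (forall m, filterlim (fun x => u x m) F (locally (l m))) ->
  filterlim (fun x => sum_n (u x) N) F (locally (sum_n l N)).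
Proof.
  intro H. induction N as [|N IH].
  - rewrite sum_O. apply filterlim_ext with (2 := H O). intro x. now rewrite sum_O.
  - rewrite sum_Sn.
    apply filterlim_ext with (f := fun x => plus (sum_n (u x) N) (u x (S N))).
    + intro x. now rewrite sum_Sn.
    + apply filterlim_comp_2 with (1 := IH) (2 := H (S N)).
      apply (filterlim_plus (V := R_NormedModule)).
Qed.

(** Tannery's theorem along an arbitrary proper filter: the tail is small uniformly in the
    parameter, and finitely many terms converge. With [locally u] it gives continuity of a sum, with
    [eventually] the exchange of two summations. *)
Lemma Series_dominated {T : Type} (F : (T -> Prop) -> Prop) {FF : ProperFilter F}
    (u : T -> nat -> R) (l b : nat -> R) :
  (forall m, filterlim (fun x => u x m) F (locally (l m))) ->
  F (fun x => forall m, Rabs (u x m) <= b m) -> ex_series b ->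
  filterlim (fun x => Series (u x)) F (locally (Series l)).
Proof.
  intros Hl Hb Eb.
  assert (Hlb : forall m, Rabs (l m) <= b m).
  { intro m.
    apply (filterlim_le (F := F) (fun x => Rabs (u x m)) (fun _ => b m) (Rabs (l m)) (b m)).
    - revert Hb. apply filter_imp. auto.
    - apply filterlim_comp with (1 := Hl m).
      apply (filterlim_norm (V := R_NormedModule)).
    - apply filterlim_const. }
  apply (filterlim_R F). intros eps Heps.
  destruct (Series_remainder_lim b Eb (eps / 4)) as [N HN]; [lra|].
  assert (HS := filterlim_sum_n F u l N Hl).
  rewrite (filterlim_R F) in HS. specialize (HS (eps / 4)).
  assert (Heps4 : 0 < eps / 4) by lra. specialize (HS Heps4).
  generalize (filter_and _ _ Hb HS). apply filter_imp. intros x [Hx1 Hx2].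
  assert (H1 := Series_remainder_le (u x) b Hx1 Eb N).
  assert (H2 := Series_remainder_le l b Hlb Eb N).
  apply Rabs_le_between in H1. apply Rabs_le_between in H2. apply Rabs_lt_between in Hx2.
  apply Rabs_lt_between. lra.
Qed.

Lemma ex_series_dom (a b : nat -> R) :
  (forall n, Rabs (a n) <= b n) -> ex_series b -> ex_series a.
Proof. exact (ex_series_le a b). Qed.

Lemma continuous_Series (f : nat -> R -> R) (M : nat -> R) (A B : R) :
  (forall k u, A < u < B -> continuous (f k) u) ->
  (forall k u, A < u < B -> Rabs (f k u) <= M k) -> ex_series M ->
  forall u, A < u < B -> continuous (fun u => Series (fun k => f k u)) u.
Proof.
  intros Hc Hb EM u Hu.
  apply (Series_dominated (locally u) (fun u k => f k u) (fun k => f k u) M).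
  - intro m. apply Hc, Hu.
  - assert (Hlu : locally u (fun y => A < y < B)).
    { apply (open_and (fun y => A < y) (fun y => y < B) (open_gt A) (open_lt B)). exact Hu. }
    revert Hlu. apply filter_imp. intros y Hy m. apply Hb, Hy.
  - exact EM.
Qed.

Lemma is_RInt_sum_n (f : nat -> R -> R) (a b : R) (N : nat) :
  (forall k, ex_RInt (f k) a b) ->
  is_RInt (fun u => sum_n (fun k => f k u) N) a b (sum_n (fun k => RInt (f k) a b) N).
Proof.
  intro H. induction N as [|N IH].
  - rewrite sum_O. apply is_RInt_ext with (f 0%nat).
    + intros x _. now rewrite sum_O.
    + apply (RInt_correct (V := R_CompleteNormedModule)), H.
  - rewrite sum_Sn. apply is_RInt_ext with (fun u => plus (sum_n (fun k => f k u) N) (f (S N) u)).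
    + intros x _. now rewrite sum_Sn.
    + apply (is_RInt_plus (V := R_NormedModule)); [exact IH|].
      apply (RInt_correct (V := R_CompleteNormedModule)), H.
Qed.

Lemma ex_RInt_cont (f : R -> R) (a b : R) :
  a <= b -> (forall z, a <= z <= b -> continuous f z) -> ex_RInt f a b.
Proof.
  intros Hab H. apply (ex_RInt_continuous (V := R_CompleteNormedModule)).
  intros z Hz. rewrite Rmin_left, Rmax_right in Hz by lra. auto.
Qed.

Lemma is_series_RInt (f : nat -> R -> R) (M : nat -> R) (A B a b : R) :
  A < a -> a <= b -> b < B ->
  (forall k u, A < u < B -> continuous (f k) u) ->
  (forall k u, A < u < B -> Rabs (f k u) <= M k) -> ex_series M ->
  is_series (fun k => RInt (f k) a b) (RInt (fun u => Series (fun k => f k u)) a b).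
Proof.
  intros HA Hab HB Hc Hb EM.
  assert (HcS := continuous_Series f M A B Hc Hb EM).
  assert (Hk : forall k, ex_RInt (f k) a b).
  { intro k. apply ex_RInt_cont; [lra|]. intros z Hz. apply Hc. lra. }
  apply is_series_sum_n_lim, is_lim_seq_spec. intro eps.
  (* The [+ 1] keeps the divisor positive when [a = b] and makes the final inequality strict. *)
  destruct (Series_remainder_lim M EM (eps / (b - a + 1))) as [N HN].
  { apply Rdiv_lt_0_compat; [apply cond_pos|lra]. }
  exists N. intros n Hn.
  assert (Hn' : Series M - sum_n M n < eps / (b - a + 1)).
  { apply Rle_lt_trans with (2 := HN).
    assert (sum_n M N <= sum_n M n); [|lra].
    clear - Hn Hb HA Hab HB. induction Hn as [|n Hn IH]; [lra|].
    rewrite sum_Sn. change (plus (sum_n M n) (M (S n))) with (sum_n M n + M (S n)).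
    assert (H0 := Hb (S n) a ltac:(lra)). assert (H1 := Rabs_pos (f (S n) a)). lra. }
  assert (HI := is_RInt_sum_n f a b n Hk).
  change (Rabs (sum_n (fun k => RInt (f k) a b) n - RInt (fun u => Series (fun k => f k u)) a b) < eps).
  replace (sum_n (fun k => RInt (f k) a b) n) with (RInt (fun u => sum_n (fun k => f k u) n) a b)
    by exact (is_RInt_unique _ _ _ _ HI).
  assert (HS : ex_RInt (fun u => Series (fun k => f k u)) a b).
  { apply ex_RInt_cont; [lra|]. intros z Hz. apply HcS. lra. }
  change (Rabs (minus (RInt (fun u => sum_n (fun k => f k u) n) a b)
    (RInt (fun u => Series (fun k => f k u)) a b)) < eps).
  rewrite <- RInt_minus by
    (exact HS || (eexists; exact HI)).
  apply Rle_lt_trans with ((b - a) * (eps / (b - a + 1))).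
  - apply abs_RInt_le_const; [lra| |].
    + apply ex_RInt_minus; [eexists; exact HI|exact HS].
    + intros t Ht. change (Rabs (sum_n (fun k => f k t) n - Series (fun k => f k t)) <= eps / (b - a + 1)).
      rewrite Rabs_minus_sym.
      apply Rle_trans with (Series M - sum_n M n); [|lra].
      apply (Series_remainder_le (fun k => f k t)); [|exact EM]. intro k. apply Hb. lra.
  - assert (0 < eps) by apply cond_pos.
    apply Rlt_le_trans with ((b - a + 1) * (eps / (b - a + 1))).
    + apply Rmult_lt_compat_r; [apply Rdiv_lt_0_compat|]; lra.
    + right. field. lra.
Qed.

Lemma sum_n_nonneg_le (b : nat -> R) :
  (forall n, 0 <= b n) -> ex_series b -> forall N, sum_n b N <= Series b.
Proof.
  intros Hb Eb N.
  assert (H := Series_remainder_le b b (fun n => Req_le _ _ (Rabs_pos_eq _ (Hb n))) Eb N).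
  assert (H1 := Rabs_pos (Series b - sum_n b N)). lra.
Qed.

Lemma ex_series_bounded (b : nat -> R) (M : R) :
  (forall n, 0 <= b n) -> (forall N, sum_n b N <= M) -> ex_series b.
Proof.
  intros Hb HM.
  destruct (ex_finite_lim_seq_incr (sum_n b) M) as [l Hl].
  - intro n. rewrite sum_Sn. change (sum_n b n <= sum_n b n + b (S n)). specialize (Hb (S n)). lra.
  - exact HM.
  - exists l. exact Hl.
Qed.

Lemma term_le_sum_n (b : nat -> R) (n : nat) : (forall n, 0 <= b n) -> b n <= sum_n b n.
Proof.
  intro Hb. destruct n as [|n]; [rewrite sum_O; lra|].
  rewrite sum_Sn. change (b (S n) <= sum_n b n + b (S n)).
  assert (0 <= sum_n b n); [|lra].
  clear - Hb. induction n; [rewrite sum_O; auto|].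
  rewrite sum_Sn. change (0 <= sum_n b n + b (S n)). specialize (Hb (S n)). lra.
Qed.

Lemma Rabs_sum_n_le (a : nat -> R) (N : nat) :
  Rabs (sum_n a N) <= sum_n (fun n => Rabs (a n)) N.
Proof. exact (norm_sum_n_m a 0 N). Qed.

Lemma Series_sum_n (a : nat -> nat -> R) (N : nat) :
  (forall n, ex_series (fun m => a m n)) ->
  is_series (fun m => sum_n (a m) N) (sum_n (fun n => Series (fun m => a m n)) N).
Proof.
  intro H. induction N as [|N IH].
  - rewrite sum_O. apply is_series_ext with (fun m => a m 0%nat).
    + intro m. now rewrite sum_O.
    + apply Series_correct, H.
  - rewrite sum_Sn. apply is_series_ext with (fun m => plus (sum_n (a m) N) (a m (S N))).
    + intro m. now rewrite sum_Sn.
    + apply (is_series_plus (V := R_NormedModule)); [exact IH|]. apply Series_correct, H.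
Qed.

Lemma double_series_term (a : nat -> nat -> R) (b : nat -> R) :
  (forall m N, sum_n (fun n => Rabs (a m n)) N <= b m) -> forall m n, Rabs (a m n) <= b m.
Proof.
  intros Hab m n.
  apply Rle_trans with (2 := Hab m n).
  apply (term_le_sum_n (fun n => Rabs (a m n))). intro; apply Rabs_pos.
Qed.

Lemma double_series_col (a : nat -> nat -> R) (b : nat -> R) :
  (forall m N, sum_n (fun n => Rabs (a m n)) N <= b m) -> ex_series b ->
  forall n, ex_series (fun m => a m n).
Proof.
  intros Hab Eb n. apply ex_series_dom with b; [|exact Eb].
  intro m. now apply double_series_term.
Qed.

Lemma double_series_row (a : nat -> nat -> R) (b : nat -> R) :
  (forall m N, sum_n (fun n => Rabs (a m n)) N <= b m) -> forall m, ex_series (fun n => a m n).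
Proof.
  intros Hab m.
  apply ex_series_Rabs. apply ex_series_bounded with (b m); [|apply Hab].
  intro; apply Rabs_pos.
Qed.

(** Dominated convergence along [eventually] for the rows truncated at [N]; summing truncated rows
    gives a finite sum of columns. *)
Lemma double_series_swap (a : nat -> nat -> R) (b : nat -> R) :
  (forall m N, sum_n (fun n => Rabs (a m n)) N <= b m) -> ex_series b ->
  is_series (fun n => Series (fun m => a m n)) (Series (fun m => Series (fun n => a m n))).
Proof.
  intros Hab Eb. apply is_series_sum_n_lim.
  apply is_lim_seq_ext with (fun N => Series (fun m => sum_n (a m) N)).
  - intro N. apply is_series_unique, Series_sum_n, (double_series_col a b Hab Eb).
  - apply (Series_dominated eventually (fun N m => sum_n (a m) N)
      (fun m => Series (fun n => a m n)) b).
    + intro m. exact (Series_correct _ (double_series_row a b Hab m)).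
    + apply filter_forall. intros N m.
      apply Rle_trans with (2 := Hab m N). apply Rabs_sum_n_le.
    + exact Eb.
Qed.

(** * Integration by parts on a unit interval *)

Definition cont_pos (f : R -> R) : Prop := forall t, 0 < t -> continuous f t.

Definition K (f : R -> R) (t : R) : R := RInt (fun u => (1 - u) * f (t + u)) 0 1.

Lemma is_derive_continuous (f : R -> R) (x l : R) : is_derive f x l -> continuous f x.
Proof. intro H. apply (ex_derive_continuous (V := R_NormedModule)). now exists l. Qed.

Lemma continuous_mult_R (f g : R -> R) (x : R) :
  continuous f x -> continuous g x -> continuous (fun y => f y * g y) x.
Proof. exact (continuous_mult f g x). Qed.

Lemma continuous_shift (f : R -> R) (t u : R) :
  continuous f (t + u) -> continuous (fun u => f (t + u)) u.
Proof.
  intro H. apply continuous_comp with (f := fun u => t + u); [|exact H].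
  apply (continuous_plus (V := R_NormedModule)); [apply continuous_const|apply continuous_id].
Qed.

Lemma continuous_one_minus (u : R) : continuous (fun u => 1 - u) u.
Proof.
  apply (continuous_minus (V := R_NormedModule)); [apply continuous_const|apply continuous_id].
Qed.

Lemma K_integrand_continuous (f : R -> R) (t u : R) :
  cont_pos f -> 0 < t + u -> continuous (fun u => (1 - u) * f (t + u)) u.
Proof.
  intros Hf H. apply continuous_mult_R; [apply continuous_one_minus|].
  apply continuous_shift, Hf, H.
Qed.

Lemma K_correct (f : R -> R) (t : R) :
  cont_pos f -> 0 < t -> is_RInt (fun u => (1 - u) * f (t + u)) 0 1 (K f t).
Proof.
  intros Hf Ht. apply (RInt_correct (V := R_CompleteNormedModule)).
  apply ex_RInt_cont; [lra|]. intros z Hz. apply K_integrand_continuous; [exact Hf|lra].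
Qed.

Lemma K_ext (f g : R -> R) (t : R) :
  (forall v, t < v < t + 1 -> f v = g v) -> K f t = K g t.
Proof.
  intro H. apply RInt_ext. intros x Hx. rewrite Rmin_left, Rmax_right in Hx by lra.
  rewrite H; [reflexivity|lra].
Qed.

Lemma K_lin (a b : R) (f g : R -> R) (t : R) :
  cont_pos f -> cont_pos g -> 0 < t ->
  K (fun v => a * f v + b * g v) t = a * K f t + b * K g t.
Proof.
  intros Hf Hg Ht. apply is_RInt_unique.
  apply is_RInt_ext with (fun u => plus (scal a ((1 - u) * f (t + u))) (scal b ((1 - u) * g (t + u)))).
  - intros u _. change (a * ((1 - u) * f (t + u)) + b * ((1 - u) * g (t + u)) = (1 - u) * (a * f (t + u) + b * g (t + u))). ring.
  - apply (is_RInt_plus (V := R_NormedModule)); apply (is_RInt_scal (V := R_NormedModule));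
      now apply K_correct.
Qed.

Lemma K_bound (f : R -> R) (t M : R) :
  cont_pos f -> 0 < t -> (forall v, t <= v <= t + 1 -> Rabs (f v) <= M) -> Rabs (K f t) <= M.
Proof.
  intros Hf Ht HM. replace M with ((1 - 0) * M) by ring. unfold K.
  apply abs_RInt_le_const; [lra|eexists; now apply K_correct|].
  intros u Hu. rewrite Rabs_mult, (Rabs_pos_eq (1 - u)) by lra.
  assert (H1 := Rabs_pos (f (t + u))). assert (H2 := HM (t + u) ltac:(lra)). nra.
Qed.

Lemma cont_pos_ex_RInt (f : R -> R) (a b : R) : cont_pos f -> 0 < a -> 0 < b -> ex_RInt f a b.
Proof.
  intros Hf Ha Hb. apply (ex_RInt_continuous (V := R_CompleteNormedModule)).
  intros z Hz. apply Hf. apply Rlt_le_trans with (2 := proj1 Hz). now apply Rmin_glb_lt.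
Qed.

Lemma is_derive_RInt_pos (f : R -> R) (c t : R) :
  cont_pos f -> 0 < c -> 0 < t -> is_derive (RInt f c) t (f t).
Proof.
  intros Hf Hc Ht. apply is_derive_RInt with c; [|now apply Hf].
  generalize (open_gt 0 t Ht). apply filter_imp. intros b Hb.
  apply RInt_correct. now apply cont_pos_ex_RInt.
Qed.

Lemma RInt_Chasles_pos (f : R -> R) (c a b : R) :
  cont_pos f -> 0 < c -> 0 < a -> 0 < b -> RInt f a b = RInt f c b - RInt f c a.
Proof.
  intros Hf Hc Ha Hb.
  assert (E := RInt_Chasles f c a b (cont_pos_ex_RInt f c a Hf Hc Ha) (cont_pos_ex_RInt f a b Hf Ha Hb)).
  change (RInt f c a + RInt f a b = RInt f c b) in E. lra.
Qed.

Lemma is_derive_RInt_window (f : R -> R) (t : R) :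
  cont_pos f -> 0 < t -> is_derive (fun t => RInt f t (t + 1)) t (f (t + 1) - f t).
Proof.
  intros Hf Ht.
  apply is_derive_ext_loc with (fun t => RInt f 1 (t + 1) - RInt f 1 t).
  - generalize (open_gt 0 t Ht). apply filter_imp. intros b Hb. symmetry.
    apply RInt_Chasles_pos; lra || exact Hf.
  - apply (is_derive_minus (V := R_NormedModule)).
    + replace (f (t + 1)) with (1 * f (t + 1)) by ring.
      apply (is_derive_comp (RInt f 1) (fun t => t + 1)).
      * apply is_derive_RInt_pos; lra || exact Hf.
      * auto_derive; [exact I|ring].
    + apply is_derive_RInt_pos; lra || exact Hf.
Qed.

(** After [v = t + u] the weight is [t + 1 - v]: now [t] occurs only in the limits of integration
    and in a factor, and [K f] can be differentiated without differentiating under the integral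
    sign. *)
Lemma K_alt (f : R -> R) (t : R) :
  cont_pos f -> 0 < t ->
  K f t = (t + 1) * RInt f t (t + 1) - RInt (fun v => v * f v) t (t + 1).
Proof.
  intros Hf Ht.
  assert (Hf' : cont_pos (fun v => v * f v)).
  { intros v Hv. apply continuous_mult_R; [apply continuous_id|now apply Hf]. }
  apply is_RInt_unique.
  apply is_RInt_ext with (fun u => scal 1 ((fun v => minus (scal (t + 1) (f v)) (v * f v)) (1 * u + t))).
  - intros u _. replace (1 * u + t) with (t + u) by ring.
    change (1 * ((t + 1) * f (t + u) - (t + u) * f (t + u)) = (1 - u) * f (t + u)). ring.
  - apply (is_RInt_comp_lin (fun v => minus (scal (t + 1) (f v)) (v * f v)) 1 t 0 1).
    replace (1 * 0 + t) with t by ring. replace (1 * 1 + t) with (t + 1) by ring.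
    apply (is_RInt_minus (V := R_NormedModule)); [apply (is_RInt_scal (V := R_NormedModule))|];
    apply (RInt_correct (V := R_CompleteNormedModule)), cont_pos_ex_RInt; lra || assumption.
Qed.

(** [K] gains a derivative over a merely continuous [f]. This yields the continuity of iterated [K]
    and the derivative of [psi]. *)
Lemma is_derive_K (f : R -> R) (t : R) :
  cont_pos f -> 0 < t -> is_derive (K f) t (RInt f t (t + 1) - f t).
Proof.
  intros Hf Ht.
  assert (Hf' : cont_pos (fun v => v * f v)).
  { intros v Hv. apply continuous_mult_R; [apply continuous_id|now apply Hf]. }
  apply is_derive_ext_loc with
    (fun t => (t + 1) * RInt f t (t + 1) - RInt (fun v => v * f v) t (t + 1)).
  - generalize (open_gt 0 t Ht). apply filter_imp. intros b Hb. symmetry. now apply K_alt.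
  - replace (RInt f t (t + 1) - f t) with
      ((1 * RInt f t (t + 1) + (t + 1) * (f (t + 1) - f t)) - ((t + 1) * f (t + 1) - t * f t)) by ring.
    apply (is_derive_minus (V := R_NormedModule)).
    + apply (is_derive_mult (fun t => t + 1) (fun t => RInt f t (t + 1))).
      * auto_derive; [exact I|ring].
      * now apply is_derive_RInt_window.
      * intros; apply Rmult_comm.
    + now apply (is_derive_RInt_window (fun v => v * f v)).
Qed.

Lemma K_cont_pos (f : R -> R) : cont_pos f -> cont_pos (K f).
Proof. intros Hf t Ht. eapply is_derive_continuous. now apply is_derive_K. Qed.

(* Integration by parts against [1 - u]. *)
Lemma one_step (f f' : R -> R) (t : R) :
  (forall v, 0 < v -> is_derive f v (f' v)) -> cont_pos f' -> 0 < t ->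
  f t = RInt f t (t + 1) - K f' t.
Proof.
  intros Hd Hc Ht.
  assert (Hf : cont_pos f) by (intros v Hv; eapply is_derive_continuous; now apply Hd).
  assert (H : is_RInt (fun u => plus (opp (f (1 * u + t))) ((1 - u) * f' (t + u))) 0 1
     (plus (opp (RInt f t (t + 1))) (K f' t))).
  { apply (is_RInt_plus (V := R_NormedModule)); [|now apply K_correct].
    apply (is_RInt_opp (V := R_NormedModule)).
    apply is_RInt_ext with (fun u => scal 1 (f (1 * u + t))).
    { intros u _. apply Rmult_1_l. }
    apply (is_RInt_comp_lin (V := R_NormedModule)).
    replace (1 * 0 + t) with t by ring. replace (1 * 1 + t) with (t + 1) by ring.
    apply (RInt_correct (V := R_CompleteNormedModule)), cont_pos_ex_RInt; lra || assumption. }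
  assert (H' : is_RInt (fun u => plus (opp (f (1 * u + t))) ((1 - u) * f' (t + u))) 0 1
     (minus ((1 - 1) * f (t + 1)) ((1 - 0) * f (t + 0)))).
  { apply (is_RInt_derive (fun u => (1 - u) * f (t + u))).
    - intros u Hu. rewrite Rmin_left, Rmax_right in Hu by lra.
      replace (plus (opp (f (1 * u + t))) ((1 - u) * f' (t + u)))
        with (-1 * f (t + u) + (1 - u) * (1 * f' (t + u))).
      2: { replace (1 * u + t) with (t + u) by ring.
           change (-1 * f (t + u) + (1 - u) * (1 * f' (t + u)) = - f (t + u) + (1 - u) * f' (t + u)). ring. }
      apply (is_derive_mult (fun u => 1 - u) (fun u => f (t + u))).
      + auto_derive; [exact I|ring].
      + apply (is_derive_comp f (fun u => t + u)).
        * apply Hd. lra.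
        * auto_derive; [exact I|ring].
      + intros; apply Rmult_comm.
    - intros u Hu. rewrite Rmin_left, Rmax_right in Hu by lra.
      apply (continuous_plus (V := R_NormedModule)).
      + apply (continuous_opp (V := R_NormedModule)).
        apply continuous_ext with (fun u => f (t + u)).
        * intro x. f_equal. ring.
        * apply continuous_shift, Hf. lra.
      + apply K_integrand_continuous; [exact Hc|lra]. }
  assert (E := eq_trans (eq_sym (is_RInt_unique _ _ _ _ H)) (is_RInt_unique _ _ _ _ H')).
  change (- RInt f t (t + 1) + K f' t = (1 - 1) * f (t + 1) - (1 - 0) * f (t + 0)) in E.
  rewrite Rplus_0_r in E. lra.
Qed.

Lemma K_Series (f : nat -> R -> R) (M : nat -> R) (A B t : R) :
  0 <= A < t -> t + 1 < B -> (forall k, cont_pos (f k)) ->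
  (forall k v, A < v < B -> Rabs (f k v) <= M k) -> ex_series M ->
  is_series (fun k => K (f k) t) (K (fun v => Series (fun k => f k v)) t).
Proof.
  intros HA HB Hc HM EM.
  assert (E : K (fun v => Series (fun k => f k v)) t =
     RInt (fun u => Series (fun k => (1 - u) * f k (t + u))) 0 1).
  { apply RInt_ext. intros u _. symmetry.
    apply (Series_scal_l (1 - u) (fun k => f k (t + u))). }
  rewrite E.
  (* For [A - t < u < B - t] the weight satisfies [|1 - u| <= 1 + B - A]. *)
  apply (is_series_RInt (fun k u => (1 - u) * f k (t + u))
    (fun k => (1 + B - A) * M k) (A - t) (B - t)); try lra.
  - intros k u Hu. apply K_integrand_continuous; [apply Hc|lra].
  - intros k u Hu. rewrite Rabs_mult.
    assert (H1 := HM k (t + u) ltac:(lra)). assert (H2 := Rabs_pos (f k (t + u))).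
    apply Rmult_le_compat; [apply Rabs_pos|exact H2| |exact H1].
    apply Rabs_le_between. lra.
  - apply ex_series_scal_l with (1 := EM).
Qed.

(** * Analytic continuation of the Hurwitz zeta function in [s] *)

Lemma Rpower_pos (x y : R) : 0 < Rpower x y.
Proof. apply exp_pos. Qed.

Lemma is_derive_mult_const (f : R -> R) (x l c : R) :
  is_derive f x l -> is_derive (fun y => f y * c) x (l * c).
Proof.
  intro H. rewrite Rmult_comm. apply is_derive_ext with (fun y => c * f y).
  - intro y. apply Rmult_comm.
  - now apply is_derive_scal.
Qed.

Lemma is_derive_Rpower (x c : R) :
  0 < x -> is_derive (fun x => Rpower x c) x (c * Rpower x (c - 1)).
Proof. intro Hx. apply is_derive_Reals. now apply derivable_pt_lim_power. Qed.

Lemma is_derive_Rpower_shift (k t c : R) :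
  0 < k + t -> is_derive (fun t => Rpower (k + t) c) t (c * Rpower (k + t) (c - 1)).
Proof.
  intro H. replace (c * Rpower (k + t) (c - 1)) with (1 * (c * Rpower (k + t) (c - 1))) by ring.
  apply (is_derive_comp (fun x => Rpower x c) (fun t => k + t)).
  - now apply is_derive_Rpower.
  - auto_derive; [exact I|ring].
Qed.

Lemma Rpower_shift_cont (k : nat) (c : R) : cont_pos (fun t => Rpower (INR k + t) c).
Proof.
  intros t Ht. eapply is_derive_continuous. apply is_derive_Rpower_shift.
  assert (H := pos_INR k). lra.
Qed.

Lemma Rpower_le_neg (a b c : R) : c <= 0 -> 0 < a <= b -> Rpower b c <= Rpower a c.
Proof.
  intros Hc Hab. replace c with (- - c) by ring. rewrite !(Rpower_Ropp _ (- c)).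
  apply Rinv_le_contravar; [apply Rpower_pos|]. apply Rle_Rpower_l; lra.
Qed.

Lemma Rpower_lim_0 (t c : R) :
  0 < t -> c < 0 -> is_lim_seq (fun k => Rpower (INR k + t) c) 0.
Proof.
  intros Ht Hc. apply is_lim_seq_spec. intro eps.
  destruct (INR_unbounded (Rpower eps (/ c))) as [N HN].
  exists N. intros n Hn. simpl.
  assert (H1 : INR N <= INR n) by now apply le_INR.
  rewrite Rminus_0_r, Rabs_pos_eq by (left; apply Rpower_pos).
  assert (H2 := Rpower_pos eps (/ c)).
  replace (pos eps) with (Rpower (Rpower eps (/ c)) c).
  2: { rewrite Rpower_mult. replace (/ c * c) with 1 by (field; lra). apply Rpower_1, cond_pos. }
  replace c with (- - c) by ring. rewrite !(Rpower_Ropp _ (- c)).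
  apply Rinv_lt_contravar; [apply Rmult_lt_0_compat; apply Rpower_pos|].
  apply Rlt_Rpower_l; [lra|]. replace (- - c) with c by ring. lra.
Qed.

Lemma is_series_telescope (h : nat -> R) :
  is_lim_seq h 0 -> is_series (fun k => h k - h (S k)) (h 0%nat).
Proof.
  intro H. apply is_series_sum_n_lim.
  apply is_lim_seq_ext with (fun n => h 0%nat - h (S n)).
  - intro n. induction n as [|n IH]; [now rewrite sum_O|].
    rewrite sum_Sn, <- IH. change (h 0%nat - h (S (S n)) = h 0%nat - h (S n) + (h (S n) - h (S (S n)))). ring.
  - replace (Finite (h 0%nat)) with (Rbar_minus (h 0%nat) 0) by (simpl; f_equal; ring).
    apply is_lim_seq_minus'; [apply is_lim_seq_const|]. now apply (is_lim_seq_incr_1 h).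
Qed.

Lemma RInt_Rpower_window (k : nat) (t c : R) :
  0 < t -> c <> -1 ->
  RInt (fun v => Rpower (INR k + v) c) t (t + 1) =
  Rpower (INR (S k) + t) (c + 1) / (c + 1) - Rpower (INR k + t) (c + 1) / (c + 1).
Proof.
  intros Ht Hc. apply is_RInt_unique. assert (Hk := pos_INR k).
  replace (INR (S k) + t) with (INR k + (t + 1)) by (rewrite S_INR; ring).
  apply (is_RInt_derive (fun v => Rpower (INR k + v) (c + 1) / (c + 1))).
  - intros v Hv. rewrite Rmin_left, Rmax_right in Hv by lra.
    replace (Rpower (INR k + v) c) with ((c + 1) * Rpower (INR k + v) (c + 1 - 1) * / (c + 1)).
    2: { replace (c + 1 - 1) with c by ring. field. lra. }
    apply (is_derive_mult_const (fun v => Rpower (INR k + v) (c + 1))).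
    apply is_derive_Rpower_shift. lra.
  - intros v Hv. rewrite Rmin_left, Rmax_right in Hv by lra. apply Rpower_shift_cont. lra.
Qed.

Lemma is_series_RInt_power (t s : R) : 0 < t -> 1 < s ->
  is_series (fun k => RInt (fun v => Rpower (INR k + v) (- s)) t (t + 1)) (Rpower t (1 - s) / (s - 1)).
Proof.
  intros Ht Hs. pose (h := fun k => Rpower (INR k + t) (1 - s) / (s - 1)).
  replace (Rpower t (1 - s) / (s - 1)) with (h 0%nat) by (unfold h; simpl; now rewrite Rplus_0_l).
  apply is_series_ext with (fun k => h k - h (S k)).
  - intro k. rewrite RInt_Rpower_window by lra. unfold h. replace (- s + 1) with (1 - s) by ring.
    change (Rpower (INR k + t) (1 - s) / (s - 1) - Rpower (INR (S k) + t) (1 - s) / (s - 1) =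
      Rpower (INR (S k) + t) (1 - s) / (1 - s) - Rpower (INR k + t) (1 - s) / (1 - s)).
    field. lra.
  - apply is_series_telescope. unfold h.
    replace (Finite 0) with (Rbar_mult 0 (/ (s - 1))) by (simpl; f_equal; ring).
    apply is_lim_seq_scal_r. apply Rpower_lim_0; lra.
Qed.

(** Integral test: the term of index [k + 1] is the value at the right end of a unit window, hence
    at most the integral over it, and these integrals telescope. *)
Lemma ex_series_power (t s : R) : 0 < t -> 1 < s -> ex_series (fun k => Rpower (INR k + t) (- s)).
Proof.
  intros Ht Hs. apply (ex_series_incr_1 (fun k => Rpower (INR k + t) (- s))).
  apply ex_series_dom with (2 := ex_intro _ _ (is_series_RInt_power t s Ht Hs)). intro k.
  rewrite Rabs_pos_eq by (left; apply Rpower_pos).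
  replace (Rpower (INR (S k) + t) (- s)) with
    (RInt (fun _ => Rpower (INR (S k) + t) (- s)) t (t + 1)).
  2: { rewrite RInt_const. change ((t + 1 - t) * Rpower (INR (S k) + t) (- s) = Rpower (INR (S k) + t) (- s)). ring. }
  apply RInt_le; [lra|apply ex_RInt_const| |].
  - apply cont_pos_ex_RInt; [apply Rpower_shift_cont|lra|lra].
  - intros v Hv. assert (Hk := pos_INR k). rewrite S_INR. apply Rpower_le_neg; lra.
Qed.

Definition hz (s t : R) : R := Series (fun k => Rpower (INR k + t) (- s)).

Lemma hz_term_bound (s a : R) (k : nat) (v : R) :
  0 <= s -> 0 < a < v -> Rabs (Rpower (INR k + v) (- s)) <= Rpower (INR k + a) (- s).
Proof.
  intros Hs Hv. rewrite Rabs_pos_eq by (left; apply Rpower_pos).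
  assert (Hk := pos_INR k). apply Rpower_le_neg; lra.
Qed.

Lemma hz_cont (s : R) : 1 < s -> cont_pos (hz s).
Proof.
  intros Hs t Ht.
  apply (continuous_Series (fun k v => Rpower (INR k + v) (- s))
    (fun k => Rpower (INR k + t / 2) (- s)) (t / 2) (t + 1)).
  - intros k u Hu. apply Rpower_shift_cont. lra.
  - intros k u Hu. apply hz_term_bound; lra.
  - apply ex_series_power; lra.
  - lra.
Qed.

Lemma hz_pos (s t : R) : 1 < s -> 0 < t -> 0 < hz s t.
Proof.
  intros Hs Ht.
  apply Rlt_le_trans with (sum_n (fun k => Rpower (INR k + t) (- s)) 0).
  - rewrite sum_O. apply Rpower_pos.
  - apply sum_n_nonneg_le; [intro; left; apply Rpower_pos|now apply ex_series_power].
Qed.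

Lemma hz_rec (s t : R) : 1 < s -> 0 < t ->
  hz s t = Rpower t (1 - s) / (s - 1) + s * K (hz (s + 1)) t.
Proof.
  intros Hs Ht.
  assert (HK : is_series (fun k => K (fun v => Rpower (INR k + v) (- (s + 1))) t) (K (hz (s + 1)) t)).
  { apply (K_Series (fun k v => Rpower (INR k + v) (- (s + 1)))
      (fun k => Rpower (INR k + t / 2) (- (s + 1))) (t / 2) (t + 2)); try lra.
    - intro k. apply Rpower_shift_cont.
    - intros k v Hv. apply hz_term_bound; lra.
    - apply ex_series_power; lra. }
  apply is_series_unique.
  eapply is_series_ext; [|apply (is_series_plus (V := R_NormedModule));
    [apply (is_series_RInt_power t s Ht Hs)|apply (is_series_scal_l s) with (1 := HK)]].
  intro k. cbv beta.
  (* The derivative is padded with a zero summand to take the two-term shape of [K_lin]. *)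
  rewrite (one_step (fun v => Rpower (INR k + v) (- s))
    (fun v => (- s) * Rpower (INR k + v) (- (s + 1)) + 0 * Rpower (INR k + v) (- (s + 1))) t); [| | |exact Ht].
  - rewrite (K_lin (- s) 0) by (apply Rpower_shift_cont || exact Ht).
    set (u := RInt _ t (t + 1)). set (v := K _ t). change (u + s * v = u - (- s * v + 0 * v)). ring.
  - intros v Hv. rewrite Rmult_0_l, Rplus_0_r. replace (- (s + 1)) with (- s - 1) by ring.
    apply is_derive_Rpower_shift. assert (Hk := pos_INR k). lra.
  - intros v Hv. apply (continuous_plus (V := R_NormedModule));
      (apply continuous_mult_R; [apply continuous_const|now apply Rpower_shift_cont]).
Qed.

(* [X n w t] is [w * zeta (1 + w, t)] on the half-line [w + n > 0]. *)
Fixpoint X (n : nat) (w t : R) : R :=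
  match n with
  | O => w * hz (1 + w) t
  | S m => Rpower t (- w) + w * K (X m (w + 1)) t
  end.

Lemma Rpower_cont_pos (c : R) : cont_pos (fun t => Rpower t c).
Proof. intros t Ht. eapply is_derive_continuous. now apply is_derive_Rpower. Qed.

Lemma cont_pos_ext (f g : R -> R) : (forall t, f t = g t) -> cont_pos f -> cont_pos g.
Proof. intros H Hf t Ht. apply continuous_ext with f; auto. Qed.

Lemma cont_pos_scal (c : R) (f : R -> R) : cont_pos f -> cont_pos (fun t => c * f t).
Proof. intros Hf t Ht. apply continuous_mult_R; [apply continuous_const|auto]. Qed.

Lemma cont_pos_plus (f g : R -> R) : cont_pos f -> cont_pos g -> cont_pos (fun t => f t + g t).
Proof. intros Hf Hg t Ht. apply (continuous_plus (V := R_NormedModule)); auto. Qed.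

Lemma X_cont (n : nat) : forall w, 0 < w + INR n -> cont_pos (X n w).
Proof.
  induction n as [|n IH]; intros w Hw; [simpl in Hw|rewrite S_INR in Hw].
  - apply cont_pos_scal, hz_cont. lra.
  - apply (cont_pos_plus (fun t => Rpower t (- w))); [apply Rpower_cont_pos|].
    apply (cont_pos_scal w), K_cont_pos, IH. lra.
Qed.

Lemma K_scal (a : R) (f : R -> R) (t : R) :
  cont_pos f -> 0 < t -> K (fun v => a * f v) t = a * K f t.
Proof.
  intros Hf Ht. assert (H := K_lin a 0 f f t Hf Hf Ht).
  rewrite <- (Rplus_0_r (a * K f t)), <- (Rmult_0_l (K f t)) at 1. rewrite <- H.
  apply K_ext. intros v _. ring.
Qed.

(** The base case is [hz_rec] at [s = 1 + w] multiplied by [w = s - 1], which clears the pole.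
    Further unfoldings happen under [K]. *)
Lemma X_succ (n : nat) : forall w t, 0 < w + INR n -> 0 < t -> X (S n) w t = X n w t.
Proof.
  induction n as [|n IH]; intros w t Hw Ht; [simpl in Hw|rewrite S_INR in Hw].
  - change (Rpower t (- w) + w * K (fun t => (w + 1) * hz (1 + (w + 1)) t) t = w * hz (1 + w) t).
    rewrite K_scal; [|apply hz_cont; lra|exact Ht].
    rewrite (hz_rec (1 + w)) by lra.
    replace (1 + (w + 1)) with (1 + w + 1) by ring. replace (1 - (1 + w)) with (- w) by ring.
    field. lra.
  - change (Rpower t (- w) + w * K (X (S n) (w + 1)) t = Rpower t (- w) + w * K (X n (w + 1)) t).
    do 2 f_equal. apply K_ext. intros v Hv. apply IH; lra.
Qed.

Lemma X_le (n m : nat) (w t : R) :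
  0 < w + INR n -> (n <= m)%nat -> 0 < t -> X m w t = X n w t.
Proof.
  intros Hw Hnm Ht. induction Hnm as [|m Hnm IH]; [reflexivity|].
  rewrite X_succ, IH; auto. apply le_INR in Hnm. lra.
Qed.

(** The number of unfoldings is the least natural [n] with [w + n > 0], as in [Gamma]; by [X_le]
    every larger number gives the same value. *)
Definition xi (w t : R) : R := X (Z.to_nat (up (- w))) w t.

Lemma to_nat_up (w : R) : 0 < w + INR (Z.to_nat (up (- w))).
Proof.
  destruct (archimed (- w)) as [H1 _].
  destruct (Z.le_gt_cases 0 (up (- w))) as [H|H].
  - rewrite INR_IZR_INZ, Z2Nat.id by exact H. lra.
  - replace (Z.to_nat (up (- w))) with 0%nat by lia. simpl.
    apply IZR_lt in H. lra.
Qed.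

Lemma xi_X (n : nat) (w t : R) : 0 < w + INR n -> 0 < t -> xi w t = X n w t.
Proof.
  intros Hw Ht. unfold xi. assert (H := to_nat_up w).
  destruct (Nat.le_ge_cases n (Z.to_nat (up (- w)))) as [Hle|Hle].
  - now apply X_le.
  - symmetry. now apply X_le.
Qed.

Lemma xi_cont (w : R) : cont_pos (xi w).
Proof. apply X_cont, to_nat_up. Qed.

Lemma xi_rec (w t : R) : 0 < t -> xi w t = Rpower t (- w) + w * K (xi (w + 1)) t.
Proof.
  intro Ht. assert (H := to_nat_up w). set (n := Z.to_nat (up (- w))) in *.
  rewrite (xi_X (S n)); [|rewrite S_INR; lra|exact Ht].
  simpl X. do 2 f_equal. apply K_ext. intros v Hv. symmetry. apply xi_X; lra.
Qed.

Lemma xi_hz (w t : R) : 0 < w -> 0 < t -> xi w t = w * hz (1 + w) t.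
Proof. intros Hw Ht. apply (xi_X 0); simpl; lra. Qed.

(** This is the residue of the zeta function at [s = 1]. It fixes the polar part of the continuation
    and the logarithmic case of [dg_limit]. *)
Lemma xi_0 (t : R) : 0 < t -> xi 0 t = 1.
Proof. intro Ht. rewrite xi_rec by exact Ht. rewrite Ropp_0, Rpower_O by exact Ht. ring. Qed.

(** * Power series of [w * zeta (1 + w, t)] *)

Lemma is_series_exp (x : R) : is_series (fun n => x ^ n / INR (fact n)) (exp x).
Proof.
  generalize (is_exp_Reals x). apply is_series_ext. intro n.
  rewrite pow_n_pow. reflexivity.
Qed.

(* Power series expansion at [w = 0] of [F w t], with coefficients depending
   continuously on [t] and dominated, locally uniformly in [t], on the disc of
   radius [rho]. *)
Definition tame (rho : R) (F : R -> R -> R) : Prop :=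
  exists c : nat -> R -> R,
    (forall n, cont_pos (c n)) /\
    (forall t1 t2, 0 < t1 -> exists M : nat -> R,
       (forall n t, t1 <= t <= t2 -> Rabs (c n t) <= M n) /\
       ex_series (fun n => M n * rho ^ n)) /\
    (forall w t, Rabs w <= rho -> 0 < t -> is_series (fun n => c n t * w ^ n) (F w t)).

(** Taylor coefficient at [w = 0] of [y^(-(w + b))], from the exponential series in [- w ln y]. *)
Definition pcoef (b : R) (n : nat) (y : R) : R :=
  Rpower y (- b) * ((- ln y) ^ n / INR (fact n)).

Lemma is_series_pcoef (b w y : R) :
  is_series (fun n => pcoef b n y * w ^ n) (Rpower y (- (w + b))).
Proof.
  replace (Rpower y (- (w + b))) with (Rpower y (- b) * exp (w * - ln y)).
  2: { unfold Rpower. rewrite <- exp_plus. f_equal. ring. }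
  eapply is_series_ext; [|apply (is_series_scal_l (V := R_NormedModule) (Rpower y (- b))), (is_series_exp (w * - ln y))].
  intro n. unfold pcoef. rewrite Rpow_mult_distr.
  change (Rpower y (- b) * (w ^ n * (- ln y) ^ n / INR (fact n)) =
    Rpower y (- b) * ((- ln y) ^ n / INR (fact n)) * w ^ n).
  field. apply INR_fact_neq_0.
Qed.

Lemma pcoef_cont (b : R) (n : nat) (k : R) : 0 <= k -> cont_pos (fun t => pcoef b n (k + t)).
Proof.
  intros Hk t Ht. apply (ex_derive_continuous (V := R_NormedModule)).
  unfold pcoef, Rpower. auto_derive. repeat split; lra || apply INR_fact_neq_0.
Qed.

Lemma Rabs_pcoef_le (b C L : R) (n : nat) (y : R) :
  Rpower y (- b) <= C -> Rabs (ln y) <= L -> Rabs (pcoef b n y) <= C * (L ^ n / INR (fact n)).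
Proof.
  intros HC HL. unfold pcoef. assert (Hp := Rpower_pos y (- b)).
  assert (Hf := INR_fact_lt_0 n).
  rewrite Rabs_mult, (Rabs_pos_eq (Rpower y (- b))) by lra.
  apply Rmult_le_compat; [lra|apply Rabs_pos|exact HC|].
  unfold Rdiv. rewrite Rabs_mult, (Rabs_pos_eq (/ _)) by (left; now apply Rinv_0_lt_compat).
  apply Rmult_le_compat_r; [left; now apply Rinv_0_lt_compat|].
  rewrite <- RPow_abs, Rabs_Ropp. apply pow_incr. split; [apply Rabs_pos|exact HL].
Qed.

Lemma Rpower_le_endpoints (t1 t2 t c : R) :
  0 < t1 -> t1 <= t <= t2 -> Rpower t c <= Rpower t1 c + Rpower t2 c.
Proof.
  intros H1 Ht. assert (H2 := Rpower_pos t1 c). assert (H3 := Rpower_pos t2 c).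
  destruct (Rle_dec 0 c).
  - assert (Rpower t c <= Rpower t2 c) by (apply Rle_Rpower_l; lra). lra.
  - assert (Rpower t c <= Rpower t1 c) by (apply Rpower_le_neg; lra). lra.
Qed.

Lemma Rabs_ln_le_endpoints (t1 t2 t : R) :
  0 < t1 -> t1 <= t <= t2 -> Rabs (ln t) <= Rabs (ln t1) + Rabs (ln t2).
Proof.
  intros H1 Ht.
  assert (H2 : ln t1 <= ln t) by (apply ln_le; lra).
  assert (H3 : ln t <= ln t2) by (apply ln_le; lra).
  assert (H4 := Rabs_pos (ln t1)). assert (H5 := Rabs_pos (ln t2)).
  assert (H6 := Rle_abs (ln t2)). assert (H7 := Rle_abs (- ln t1)). rewrite Rabs_Ropp in H7.
  apply Rabs_le_between. lra.
Qed.

Lemma ex_series_exp_scal (C L rho : R) :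
  ex_series (fun n => C * (L ^ n / INR (fact n)) * rho ^ n).
Proof.
  exists (C * exp (L * rho)).
  eapply is_series_ext; [|apply (is_series_scal_l (V := R_NormedModule) C), (is_series_exp (L * rho))].
  intro n. cbv beta. rewrite Rpow_mult_distr.
  change (C * (L ^ n * rho ^ n / INR (fact n)) = C * (L ^ n / INR (fact n)) * rho ^ n).
  field. apply INR_fact_neq_0.
Qed.

Lemma tame_Rpower (rho b : R) : tame rho (fun w t => Rpower t (- (w + b))).
Proof.
  exists (pcoef b). split; [|split].
  - intro n. apply cont_pos_ext with (2 := pcoef_cont b n 0 (Rle_refl 0)).
    intro t. now rewrite Rplus_0_l.
  - intros t1 t2 H1.
    exists (fun n => (Rpower t1 (- b) + Rpower t2 (- b)) * ((Rabs (ln t1) + Rabs (ln t2)) ^ n / INR (fact n))).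
    split; [|apply ex_series_exp_scal].
    intros n t Ht. apply Rabs_pcoef_le; [now apply Rpower_le_endpoints|now apply Rabs_ln_le_endpoints].
  - intros w t _ _. apply is_series_pcoef.
Qed.

(** Frees the estimates from [t]: on a compact interval, powers and logarithms of [k + t] are
    controlled by those of [k + 1], which can be summed over [k]. *)
Lemma shifted_point_bounds (t1 t2 : R) : 0 < t1 <= t2 ->
  exists m L, 0 < m /\ forall k t, t1 <= t <= t2 ->
    m * (INR k + 1) <= INR k + t /\ Rabs (ln (INR k + t)) <= ln (INR k + 1) + L.
Proof.
  intros H. exists (Rmin 1 t1), (Rabs (ln (Rmin 1 t1)) + ln (1 + t2)).
  assert (Hm : 0 < Rmin 1 t1) by (apply Rmin_glb_lt; lra).
  split; [exact Hm|]. intros k t Ht.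
  assert (Hk := pos_INR k). assert (Hm1 := Rmin_l 1 t1). assert (Hm2 := Rmin_r 1 t1).
  assert (H1 : Rmin 1 t1 * (INR k + 1) <= INR k + t) by nra.
  split; [exact H1|].
  assert (H2 : ln (Rmin 1 t1 * (INR k + 1)) <= ln (INR k + t)).
  { apply ln_le; [|exact H1]. apply Rmult_lt_0_compat; lra. }
  assert (H3 : ln (INR k + t) <= ln ((1 + t2) * (INR k + 1))) by (apply ln_le; nra).
  rewrite ln_mult in H2, H3 by lra.
  assert (H4 : 0 <= ln (INR k + 1)) by (rewrite <- ln_1; apply ln_le; lra).
  assert (H5 : 0 <= ln (1 + t2)) by (rewrite <- ln_1; apply ln_le; lra).
  assert (H6 := Rle_abs (- ln (Rmin 1 t1))). rewrite Rabs_Ropp in H6.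
  assert (H7 := Rabs_pos (ln (Rmin 1 t1))).
  apply Rabs_le_between. lra.
Qed.

(* [exp (rho * (ln (k + 1) + L)) * (k + 1)^-b] is summable since [b > rho + 1]. *)
Lemma pcoef_domination (rho b t1 t2 : R) : 0 < rho -> rho + 1 < b -> 0 < t1 <= t2 ->
  exists q : nat -> nat -> R,
    (forall k n t, t1 <= t <= t2 -> Rabs (pcoef b n (INR k + t)) <= q k n) /\
    exists S : nat -> R, ex_series S /\
      forall k N, sum_n (fun n => Rabs (q k n * rho ^ n)) N <= S k.
Proof.
  intros Hrho Hb Ht.
  destruct (shifted_point_bounds t1 t2 Ht) as (m & L & Hm & HmL).
  pose (C := fun k => Rpower m (- b) * Rpower (INR k + 1) (- b)).
  pose (l := fun k => ln (INR k + 1) + L).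
  assert (Hl : forall k, 0 <= l k).
  { intro k. assert (H := proj2 (HmL k t1 ltac:(lra))).
    assert (H1 := Rabs_pos (ln (INR k + t1))). unfold l. lra. }
  assert (HC : forall k, 0 <= C k).
  { intro k. left. apply Rmult_lt_0_compat; apply Rpower_pos. }
  exists (fun k n => C k * (l k ^ n / INR (fact n))). split.
  - intros k n t Htt. destruct (HmL k t Htt) as [H1 H2].
    apply Rabs_pcoef_le; [|exact H2].
    assert (Hk := pos_INR k). unfold C. rewrite Rpower_mult_distr by lra.
    apply Rpower_le_neg; [lra|]. split; [apply Rmult_lt_0_compat; lra|exact H1].
  - exists (fun k => C k * exp (l k * rho)). split.
    + apply ex_series_ext with (fun k => (Rpower m (- b) * exp (L * rho)) * Rpower (INR k + 1) (- (b - rho))).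
      * intro k. unfold C, l.
        replace (Rpower (INR k + 1) (- (b - rho))) with
          (Rpower (INR k + 1) (- b) * exp (ln (INR k + 1) * rho)).
        2: { unfold Rpower. rewrite <- exp_plus. f_equal. ring. }
        rewrite Rmult_plus_distr_r, exp_plus. simpl. ring.
      * apply (ex_series_scal_l (V := R_NormedModule)).
        apply ex_series_power; lra.
    + intros k N.
      assert (H : is_series (fun n => C k * (l k ^ n / INR (fact n)) * rho ^ n) (C k * exp (l k * rho))).
      { eapply is_series_ext; [|apply (is_series_scal_l (V := R_NormedModule) (C k)), (is_series_exp (l k * rho))].
        intro n. cbv beta. rewrite Rpow_mult_distr.
        change (C k * (l k ^ n * rho ^ n / INR (fact n)) = C k * (l k ^ n / INR (fact n)) * rho ^ n).
        field. apply INR_fact_neq_0. }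
      rewrite <- (is_series_unique _ _ H).
      assert (Hpos : forall n, 0 <= C k * (l k ^ n / INR (fact n)) * rho ^ n).
      { intro n. apply Rmult_le_pos; [|apply pow_le; lra]. apply Rmult_le_pos; [apply HC|].
        apply Rmult_le_pos; [apply pow_le, Hl|]. left. apply Rinv_0_lt_compat, INR_fact_lt_0. }
      rewrite (sum_n_ext _ _ N (fun n => Rabs_pos_eq _ (Hpos n))).
      apply sum_n_nonneg_le; [exact Hpos|]. eexists; exact H.
Qed.

Lemma sum_n_le (a b : nat -> R) (N : nat) : (forall n, a n <= b n) -> sum_n a N <= sum_n b N.
Proof. intro H. apply sum_n_m_le. exact H. Qed.

(** Each term is expanded in powers of [w] and the sums over [k] and [n] are exchanged, with
    [pcoef_domination] as majorant. The condition [rho + 1 < b] keeps [w + b > 1] on the whole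
    disc. *)
Lemma tame_hz (rho b : R) : 0 < rho -> rho + 1 < b -> tame rho (fun w t => hz (w + b) t).
Proof.
  intros Hrho Hb. exists (fun n t => Series (fun k => pcoef b n (INR k + t))).
  (* The majorant carries the factor [rho ^ n], which is divided out to sum a single column. *)
  assert (Hn : forall n (q : nat -> nat -> R), (exists S : nat -> R, ex_series S /\
      forall k N, sum_n (fun n => Rabs (q k n * rho ^ n)) N <= S k) -> ex_series (fun k => q k n)).
  { intros n q (S & ES & HS).
    assert (H := double_series_col (fun k n => q k n * rho ^ n) S HS ES n).
    apply (ex_series_scal_r (/ rho ^ n)) in H. revert H. apply ex_series_ext.
    intro k. change (q k n * rho ^ n * / rho ^ n = q k n). field. apply pow_nonzero. lra. }
  split; [|split].
  - intros n t Ht.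
    destruct (pcoef_domination rho b (t / 2) (2 * t) Hrho Hb ltac:(lra)) as (q & Hq & HS).
    apply (continuous_Series (fun k v => pcoef b n (INR k + v)) (fun k => q k n) (t / 2) (2 * t)).
    + intros k u Hu. apply pcoef_cont; [apply pos_INR|lra].
    + intros k u Hu. apply Hq. lra.
    + now apply Hn.
    + lra.
  - intros t1 t2 H1. destruct (Rle_dec t1 t2) as [H2|H2].
    + destruct (pcoef_domination rho b t1 t2 Hrho Hb ltac:(lra)) as (q & Hq & HS).
      exists (fun n => Series (fun k => q k n)). split.
      * intros n t Ht. apply Rle_trans with (Series (fun k => Rabs (pcoef b n (INR k + t)))).
        -- apply Series_Rabs. apply ex_series_dom with (fun k => q k n); [|now apply Hn].
           intro k. rewrite Rabs_Rabsolu. now apply Hq.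
        -- apply Series_le; [|now apply Hn]. intro k. split; [apply Rabs_pos|now apply Hq].
      * destruct HS as (S & ES & HS).
        assert (H := double_series_swap (fun k n => q k n * rho ^ n) S HS ES).
        eexists. apply is_series_ext with (2 := H). intro n. now rewrite Series_scal_r.
    + exists (fun _ => 0). split; [intros; lra|].
      exists 0. apply is_series_ext with (fun _ => 0); [intro; simpl; ring|].
      apply is_series_sum_n_lim. apply is_lim_seq_ext with (fun _ => 0); [|apply is_lim_seq_const].
      intro n. rewrite sum_n_const. ring.
  - intros w t Hw Ht.
    destruct (pcoef_domination rho b t t Hrho Hb ltac:(lra)) as (q & Hq & S & ES & HS).
    assert (H : is_series (fun n => Series (fun k => pcoef b n (INR k + t) * w ^ n))
        (Series (fun k => Series (fun n => pcoef b n (INR k + t) * w ^ n)))).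
    { apply (double_series_swap (fun k n => pcoef b n (INR k + t) * w ^ n) S); [|exact ES].
      intros k N. apply Rle_trans with (2 := HS k N). apply sum_n_le. intro n.
      rewrite !Rabs_mult. assert (H1 := Hq k n t ltac:(lra)).
      apply Rmult_le_compat; try apply Rabs_pos.
      - apply Rle_trans with (1 := H1), Rle_abs.
      - rewrite <- !RPow_abs. apply pow_incr. split; [apply Rabs_pos|].
        rewrite (Rabs_pos_eq rho) by lra. exact Hw. }
    replace (hz (w + b) t) with (Series (fun k => Series (fun n => pcoef b n (INR k + t) * w ^ n))).
    + revert H. apply is_series_ext. intro n. now rewrite Series_scal_r.
    + apply Series_ext. intro k. apply is_series_unique, is_series_pcoef.
Qed.

Lemma tame_ext (rho : R) (F G : R -> R -> R) :
  (forall w t, Rabs w <= rho -> 0 < t -> F w t = G w t) -> tame rho F -> tame rho G.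
Proof.
  intros H (c & H1 & H2 & H3). exists c. split; [exact H1|split; [exact H2|]].
  intros w t Hw Ht. rewrite <- H; auto.
Qed.

Lemma tame_plus (rho : R) (F G : R -> R -> R) :
  tame rho F -> tame rho G -> tame rho (fun w t => F w t + G w t).
Proof.
  intros (c & H1 & H2 & H3) (d & G1 & G2 & G3). exists (fun n t => c n t + d n t).
  split; [|split].
  - intro n. now apply cont_pos_plus.
  - intros t1 t2 Ht. destruct (H2 t1 t2 Ht) as (M & HM & EM). destruct (G2 t1 t2 Ht) as (N & HN & EN).
    exists (fun n => M n + N n). split.
    + intros n t Htt. apply Rle_trans with (1 := Rabs_triang _ _). apply Rplus_le_compat; auto.
    + apply ex_series_ext with (fun n => plus (M n * rho ^ n) (N n * rho ^ n)).
      * intro n. change (M n * rho ^ n + N n * rho ^ n = (M n + N n) * rho ^ n). ring.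
      * now apply (ex_series_plus (V := R_NormedModule)).
  - intros w t Hw Ht.
    eapply is_series_ext; [|apply (is_series_plus (V := R_NormedModule)); [apply H3|apply G3]; auto].
    intro n. change (c n t * w ^ n + d n t * w ^ n = (c n t + d n t) * w ^ n). ring.
Qed.

(** Coefficients of [w] times a power series. *)
Definition shift1 (f : nat -> R) (n : nat) : R := match n with O => 0 | S m => f m end.

Lemma is_series_shift1 (f : nat -> R) (l : R) : is_series f l -> is_series (shift1 f) l.
Proof.
  intro H. apply (is_series_decr_1 (shift1 f)).
  change (is_series f (l + - 0)). replace (l + - 0) with l by ring. exact H.
Qed.

Lemma tame_mul_lin (rho b : R) (F : R -> R -> R) :
  tame rho F -> tame rho (fun w t => (w + b) * F w t).
Proof.
  intros (c & H1 & H2 & H3).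
  exists (fun n t => b * c n t + shift1 (fun m => c m t) n). split; [|split].
  - intro n. apply cont_pos_plus; [now apply cont_pos_scal|].
    destruct n as [|n]; [|apply H1]. intros t Ht. apply continuous_const.
  - intros t1 t2 Ht. destruct (H2 t1 t2 Ht) as (M & HM & EM).
    exists (fun n => Rabs b * M n + shift1 M n). split.
    + intros n t Htt. apply Rle_trans with (1 := Rabs_triang _ _). apply Rplus_le_compat.
      * rewrite Rabs_mult. apply Rmult_le_compat_l; [apply Rabs_pos|auto].
      * destruct n as [|n]; [simpl; rewrite Rabs_R0; lra|simpl; auto].
    + apply ex_series_ext with (fun n => plus (Rabs b * (M n * rho ^ n))
        (rho * shift1 (fun m => M m * rho ^ m) n)).
      * intro n. destruct n as [|n];
        [change (Rabs b * (M 0%nat * rho ^ 0) + rho * 0 = (Rabs b * M 0%nat + 0) * rho ^ 0)|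
         change (Rabs b * (M (S n) * rho ^ S n) + rho * (M n * rho ^ n) = (Rabs b * M (S n) + M n) * rho ^ S n)];
        simpl; ring.
      * apply (ex_series_plus (V := R_NormedModule));
          apply (ex_series_scal_l (V := R_NormedModule)); [exact EM|].
        destruct EM as [l Hl]. exists l. now apply is_series_shift1.
  - intros w t Hw Ht. specialize (H3 w t Hw Ht).
    replace ((w + b) * F w t) with (plus (b * F w t) (w * F w t)).
    2: { change (b * F w t + w * F w t = (w + b) * F w t). ring. }
    eapply is_series_ext; [|apply (is_series_plus (V := R_NormedModule));
      [apply (is_series_scal_l b) with (1 := H3)|
       apply (is_series_scal_l (V := R_NormedModule) w), is_series_shift1 with (1 := H3)]].
    intro n. destruct n as [|n];
      [change (b * (c 0%nat t * w ^ 0) + w * 0 = (b * c 0%nat t + 0) * w ^ 0)|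
       change (b * (c (S n) t * w ^ S n) + w * (c n t * w ^ n) = (b * c (S n) t + c n t) * w ^ S n)];
      simpl; ring.
Qed.

Lemma tame_K (rho : R) (F : R -> R -> R) : 0 <= rho ->
  tame rho F -> tame rho (fun w t => K (F w) t).
Proof.
  intros Hrho (c & H1 & H2 & H3). exists (fun n t => K (c n) t). split; [|split].
  - intro n. now apply K_cont_pos.
  (* [K] looks one unit ahead, so the bound is taken on [[t1, t2 + 1]]. *)
  - intros t1 t2 Ht. destruct (H2 t1 (t2 + 1) Ht) as (M & HM & EM). exists M. split; [|exact EM].
    intros n t Htt. apply K_bound; [apply H1|lra|]. intros v Hv. apply HM. lra.
  - intros w t Hw Ht.
    destruct (H2 (t / 2) (t + 2) ltac:(lra)) as (M & HM & EM).
    assert (H : is_series (fun n => K (fun v => w ^ n * c n v) t)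
       (K (fun v => Series (fun n => w ^ n * c n v)) t)).
    { apply (K_Series (fun n v => w ^ n * c n v) (fun n => M n * rho ^ n) (t / 2) (t + 2)); try lra.
      - intro n. now apply cont_pos_scal.
      - intros n v Hv. rewrite Rabs_mult, Rmult_comm.
        apply Rmult_le_compat; try apply Rabs_pos; [apply HM; lra|].
        rewrite <- RPow_abs. apply pow_incr. split; [apply Rabs_pos|exact Hw].
      - exact EM. }
    replace (K (F w) t) with (K (fun v => Series (fun n => w ^ n * c n v)) t).
    + revert H. apply is_series_ext. intro n. rewrite K_scal by auto. apply Rmult_comm.
    + apply K_ext. intros v Hv. apply is_series_unique.
      apply is_series_ext with (2 := H3 w v Hw ltac:(lra)). intro n. apply Rmult_comm.
Qed.

(** The offset [b] absorbs the shift [w + 1] of the recursion, so the disc stays centred at 0;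
    [rho < n + b] keeps it inside the half-line where [X n] is meaningful. *)
Lemma tame_X (n : nat) : forall rho b, 0 < rho -> rho < INR n + b -> tame rho (fun w t => X n (w + b) t).
Proof.
  induction n as [|n IH]; intros rho b Hrho Hb; [simpl in Hb|rewrite S_INR in Hb]; cbn [X].
  - apply tame_mul_lin. apply tame_ext with (fun w t => hz (w + (1 + b)) t).
    + intros w t _ _. f_equal. ring.
    + apply tame_hz; lra.
  - apply tame_plus; [apply tame_Rpower|]. apply tame_mul_lin.
    apply tame_ext with (fun w t => K (X n (w + (b + 1))) t).
    + intros w t _ _. f_equal. f_equal. ring.
    + apply (tame_K rho (fun w => X n (w + (b + 1)))); [lra|]. apply IH; lra.
Qed.

Lemma xi_tame (rho : R) : 0 < rho -> tame rho xi.
Proof.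
  intro Hrho. destruct (INR_unbounded rho) as [n Hn].
  apply tame_ext with (fun w t => X n (w + 0) t); [|apply tame_X; lra].
  intros w t Hw Ht. rewrite Rplus_0_r. symmetry. apply xi_X; [|exact Ht].
  apply Rabs_le_between in Hw. lra.
Qed.

Lemma series_coeff_unique (a b : nat -> R) (F : R -> R) (r : R) :
  0 < r -> (forall w, Rabs w <= r -> is_series (fun n => a n * w ^ n) (F w)) ->
  (forall w, Rabs w <= r -> is_series (fun n => b n * w ^ n) (F w)) ->
  ex_series (fun n => Rabs (a n * r ^ n)) -> ex_series (fun n => Rabs (b n * r ^ n)) ->
  forall n, a n = b n.
Proof.
  intros Hr Ha Hb Ea Eb n.
  assert (HCV : forall c : nat -> R, ex_series (fun n => Rabs (c n * r ^ n)) -> Rbar_lt 0 (CV_radius c)).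
  { intros c Ec. apply Rbar_lt_le_trans with (Finite r); [exact Hr|].
    exact (proj1 (Lub_Rbar_correct (CV_disk c)) r Ec). }
  apply PSeries_ext_recip; [now apply HCV|now apply HCV|].
  exists (mkposreal r Hr). intros w Hw. change (Rabs (w - 0) < r) in Hw. rewrite Rminus_0_r in Hw.
  unfold PSeries. rewrite (is_series_unique _ _ (Ha w ltac:(lra))).
  now rewrite (is_series_unique _ _ (Hb w ltac:(lra))).
Qed.

(** The coefficients supplied by [xi_tame] may depend on the radius. Uniqueness of power series on
    the unit disc identifies those for radius 1 with those for every larger [rho], so one sequence
    serves all radii. *)
Lemma xi_entire (t : R) : 0 < t ->
  exists e : nat -> R, (forall w, is_series (fun n => e n * w ^ n) (xi w t)) /\
    forall rho, 0 < rho -> ex_series (fun n => Rabs (e n) * rho ^ n).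
Proof.
  intro Ht.
  assert (H : forall rho, 0 < rho -> exists c : nat -> R,
     (forall w, Rabs w <= rho -> is_series (fun n => c n * w ^ n) (xi w t)) /\
     ex_series (fun n => Rabs (c n) * rho ^ n)).
  { intros rho Hrho. destruct (xi_tame rho Hrho) as (c & _ & H2 & H3).
    exists (fun n => c n t). split; [intros; now apply H3|].
    destruct (H2 t t Ht) as (M & HM & EM). apply ex_series_dom with (2 := EM).
    intro n. rewrite Rabs_mult, Rabs_Rabsolu, (Rabs_pos_eq (rho ^ n)) by (apply pow_le; lra).
    apply Rmult_le_compat_r; [apply pow_le; lra|]. apply HM. lra. }
  destruct (H 1 Rlt_0_1) as (e & He & Ee). exists e.
  assert (Hc : forall rho, 1 <= rho -> (forall w, Rabs w <= rho -> is_series (fun n => e n * w ^ n) (xi w t)) /\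
     ex_series (fun n => Rabs (e n) * rho ^ n)).
  { intros rho Hrho. destruct (H rho ltac:(lra)) as (c & Hc & Ec).
    assert (E : forall n, c n = e n).
    { apply (series_coeff_unique c e (fun w => xi w t) 1 Rlt_0_1); [|exact He| |].
      - intros w Hw. apply Hc. lra.
      - apply ex_series_dom with (2 := Ec). intro n. rewrite Rabs_Rabsolu, Rabs_mult, pow1, Rabs_R1.
        assert (1 <= rho ^ n) by now apply pow_R1_Rle. assert (H1 := Rabs_pos (c n)). nra.
      - revert Ee. apply ex_series_ext. intro n. rewrite Rabs_mult, pow1, Rabs_R1. reflexivity. }
    split.
    - intros w Hw. apply is_series_ext with (2 := Hc w Hw). intro n. now rewrite E.
    - revert Ec. apply ex_series_ext. intro n. now rewrite E. }
  split.
  - intro w. apply (Hc (1 + Rabs w)); assert (H1 := Rabs_pos w); lra.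
  - intros rho Hrho. apply ex_series_dom with (2 := proj2 (Hc (1 + rho) ltac:(lra))).
    intro n. rewrite Rabs_mult, Rabs_Rabsolu. apply Rmult_le_compat_l; [apply Rabs_pos|].
    rewrite Rabs_pos_eq by (apply pow_le; lra). apply pow_incr. lra.
Qed.

(** * Complex power series *)

Definition is_Cseries (a : nat -> C) (l : C) : Prop :=
  is_series a l.

(** Summing componentwise gives a total function to which the real results on domination and
    exchange apply. *)
Definition CSeries (a : nat -> C) : C :=
  (Series (fun n => fst (a n)), Series (fun n => snd (a n))).

Lemma sum_n_C (a : nat -> C) (N : nat) :
  sum_n a N = (sum_n (fun n => fst (a n)) N, sum_n (fun n => snd (a n)) N).
Proof.
  induction N as [|N IH]; [rewrite !sum_O; now destruct (a 0%nat)|].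
  rewrite !sum_Sn, IH. reflexivity.
Qed.

Lemma is_Cseries_components (a : nat -> C) (l : C) :
  is_Cseries a l <-> is_series (fun n => fst (a n)) (fst l) /\ is_series (fun n => snd (a n)) (snd l).
Proof.
  split.
  - intro H. assert (H0 := proj1 (filterlim_locally _ l) H).
    split; apply filterlim_locally; intro eps;
      generalize (H0 eps); apply filter_imp; intros N [H1 H2].
    + change (ball (fst l) eps (sum_n (fun n => fst (a n)) N)).
      replace (sum_n (fun n => fst (a n)) N) with (fst (sum_n a N)) by now rewrite sum_n_C.
      exact H1.
    + change (ball (snd l) eps (sum_n (fun n => snd (a n)) N)).
      replace (sum_n (fun n => snd (a n)) N) with (snd (sum_n a N)) by now rewrite sum_n_C.
      exact H2.
  - intros [H1 H2]. apply filterlim_locally. intro eps.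
    assert (G1 := proj1 (filterlim_locally _ _) H1 eps).
    assert (G2 := proj1 (filterlim_locally _ _) H2 eps).
    generalize (filter_and _ _ G1 G2). apply filter_imp.
    intros N [K1 K2]. change (ball l eps (sum_n a N)). rewrite sum_n_C. split; assumption.
Qed.

Lemma is_Cseries_unique (a : nat -> C) (l : C) : is_Cseries a l -> CSeries a = l.
Proof.
  intro H. apply is_Cseries_components in H. destruct H as [H1 H2]. unfold CSeries.
  rewrite (is_series_unique _ _ H1), (is_series_unique _ _ H2). now destruct l.
Qed.

Lemma is_Cseries_ext (a b : nat -> C) (l : C) :
  (forall n, a n = b n) -> is_Cseries a l -> is_Cseries b l.
Proof. exact (is_series_ext a b l). Qed.

Lemma Rabs_fst_le_Cmod (z : C) : Rabs (fst z) <= Cmod z.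
Proof. exact (Rle_trans _ _ _ (Rmax_l _ _) (Rmax_Cmod z)). Qed.

Lemma Rabs_snd_le_Cmod (z : C) : Rabs (snd z) <= Cmod z.
Proof. exact (Rle_trans _ _ _ (Rmax_r _ _) (Rmax_Cmod z)). Qed.

Lemma Cmod_le_components (z : C) : Cmod z <= Rabs (fst z) + Rabs (snd z).
Proof.
  destruct z as [x y]. simpl. replace (x, y) with (RtoC x + Ci * RtoC y)%C.
  - apply Rle_trans with (1 := Cmod_triangle _ _).
    rewrite Cmod_mult, !Cmod_R, Cmod_Ci. lra.
  - unfold Ci, RtoC, Cplus, Cmult. simpl. f_equal; ring.
Qed.

Lemma CSeries_correct (a : nat -> C) :
  ex_series (fun n => Cmod (a n)) -> is_Cseries a (CSeries a).
Proof.
  intro H. apply is_Cseries_components.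
  split; apply Series_correct; apply ex_series_dom with (2 := H); intro n;
    [apply Rabs_fst_le_Cmod|apply Rabs_snd_le_Cmod].
Qed.

(** The factor 2 is the price of bounding the two components separately. *)
Lemma Cmod_CSeries_le (a : nat -> C) (b : nat -> R) :
  (forall n, Cmod (a n) <= b n) -> ex_series b -> Cmod (CSeries a) <= 2 * Series b.
Proof.
  intros H Eb. apply Rle_trans with (1 := Cmod_le_components _). unfold CSeries. simpl.
  assert (H1 : forall f : C -> R, (forall z, Rabs (f z) <= Cmod z) ->
     Rabs (Series (fun n => f (a n))) <= Series b).
  { intros f Hf.
    assert (Hb : forall n, Rabs (f (a n)) <= b n) by (intro n; apply Rle_trans with (2 := H n), Hf).
    apply Rle_trans with (Series (fun n => Rabs (f (a n)))).
    - apply Series_Rabs. apply ex_series_dom with (2 := Eb). intro n. now rewrite Rabs_Rabsolu.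
    - apply Series_le; [|exact Eb]. intro n. split; [apply Rabs_pos|apply Hb]. }
  assert (H2 := H1 fst Rabs_fst_le_Cmod). assert (H3 := H1 snd Rabs_snd_le_Cmod). lra.
Qed.

Lemma is_Cseries_scal (c : C) (a : nat -> C) (l : C) :
  is_Cseries a l -> is_Cseries (fun n => c * a n)%C (c * l)%C.
Proof. exact (is_series_scal_l c a l). Qed.

Lemma is_Cseries_plus (a b : nat -> C) (l m : C) :
  is_Cseries a l -> is_Cseries b m -> is_Cseries (fun n => a n + b n)%C (l + m)%C.
Proof. exact (is_series_plus a b l m). Qed.

Definition Cshift1 (f : nat -> C) (n : nat) : C := match n with O => RtoC 0 | S m => f m end.

Lemma is_Cseries_shift1 (f : nat -> C) (l : C) : is_Cseries f l -> is_Cseries (Cshift1 f) l.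
Proof.
  intro H. apply (is_series_decr_1 (Cshift1 f)).
  change (is_Cseries f (l + - RtoC 0)%C). replace (l + - RtoC 0)%C with l by ring. exact H.
Qed.

Lemma is_Cseries_incr_1 (a : nat -> C) (l : C) :
  is_Cseries a l -> is_Cseries (fun n => a (S n)) (l - a 0%nat)%C.
Proof.
  intro H. apply (is_series_incr_1 a).
  change (is_Cseries a (l - a 0%nat + a 0%nat)%C). replace (l - a 0%nat + a 0%nat)%C with l by ring. exact H.
Qed.

Lemma pow_n_Cpow (z : C) (n : nat) : pow_n z n = (z ^ n)%C.
Proof. induction n as [|n IH]; [reflexivity|]. simpl. now rewrite IH. Qed.

Lemma is_pseries_C (c : nat -> C) (h l : C) :
  is_pseries c h l <-> is_Cseries (fun n => h ^ n * c n)%C l.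
Proof.
  unfold is_pseries. split; apply is_series_ext; intro n.
  - change (pow_n h n * c n = h ^ n * c n)%C. now rewrite pow_n_Cpow.
  - change (h ^ n * c n = pow_n h n * c n)%C. now rewrite <- pow_n_Cpow.
Qed.

Lemma Cdouble_series_swap (a : nat -> nat -> C) (b : nat -> R) :
  (forall m N, sum_n (fun n => Cmod (a m n)) N <= b m) -> ex_series b ->
  is_Cseries (fun n => CSeries (fun m => a m n)) (CSeries (fun m => CSeries (fun n => a m n))).
Proof.
  intros Hab Eb. apply is_Cseries_components. split.
  - apply (double_series_swap (fun m n => fst (a m n)) b); [|exact Eb].
    intros m N. apply Rle_trans with (2 := Hab m N). apply sum_n_le. intro n. apply Rabs_fst_le_Cmod.
  - apply (double_series_swap (fun m n => snd (a m n)) b); [|exact Eb].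
    intros m N. apply Rle_trans with (2 := Hab m N). apply sum_n_le. intro n. apply Rabs_snd_le_Cmod.
Qed.

(** A normally convergent sum of power series is regrouped by powers of [h]. It serves both the
    re-expansion of an entire series about a new centre and the analyticity of the Dirichlet
    series. *)
Lemma is_Cseries_sum_power_series (u : nat -> nat -> C) (F : nat -> C -> C) (r : R) (b : nat -> R) :
  0 < r -> (forall k N, sum_n (fun n => Cmod (u k n) * r ^ n) N <= b k) -> ex_series b ->
  forall h, Cmod h <= r ->
  (forall k, is_Cseries (fun n => h ^ n * u k n)%C (F k h)) ->
  is_Cseries (fun n => h ^ n * CSeries (fun k => u k n))%C (CSeries (fun k => F k h)).
Proof.
  intros Hr Hb Eb h Hh HF.
  assert (Hterm : forall k n, Cmod (u k n) <= b k * / r ^ n).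
  { intros k n. assert (Hrn : 0 < r ^ n) by now apply pow_lt.
    apply Rmult_le_reg_r with (1 := Hrn). rewrite Rmult_assoc, Rinv_l, Rmult_1_r by lra.
    apply Rle_trans with (2 := Hb k n).
    apply (term_le_sum_n (fun n => Cmod (u k n) * r ^ n)). intro m.
    apply Rmult_le_pos; [apply Cmod_ge_0|apply pow_le; lra]. }
  assert (Hcol : forall n, is_Cseries (fun k => u k n) (CSeries (fun k => u k n))).
  { intro n. apply CSeries_correct. apply ex_series_dom with (fun k => b k * / r ^ n).
    - intro k. rewrite Rabs_pos_eq by apply Cmod_ge_0. apply Hterm.
    - now apply ex_series_scal_r. }
  replace (CSeries (fun k => F k h)) with (CSeries (fun k => CSeries (fun n => h ^ n * u k n)%C)).
  - apply is_Cseries_ext with (fun n => CSeries (fun k => h ^ n * u k n)%C).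
    + intro n. apply is_Cseries_unique, is_Cseries_scal, Hcol.
    + apply (Cdouble_series_swap (fun k n => h ^ n * u k n)%C b); [|exact Eb].
      intros k N. apply Rle_trans with (2 := Hb k N). apply sum_n_le. intro n.
      rewrite Cmod_mult, Cmod_pow, Rmult_comm. apply Rmult_le_compat_l; [apply Cmod_ge_0|].
      apply pow_incr. split; [apply Cmod_ge_0|exact Hh].
  - unfold CSeries at 1 3. f_equal; apply Series_ext; intro k; now rewrite (is_Cseries_unique _ _ (HF k)).
Qed.

Lemma analytic_at_plus (f g : C -> C) (z0 : C) :
  analytic_at f z0 -> analytic_at g z0 -> analytic_at (fun z => f z + g z)%C z0.
Proof.
  intros (c & r & Hr & Hc) (d & s & Hs & Hd).
  exists (fun n => c n + d n)%C, (Rmin r s). split; [now apply Rmin_glb_lt|].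
  intros z Hz. apply is_pseries_C.
  apply is_Cseries_ext with (fun n => (z - z0) ^ n * c n + (z - z0) ^ n * d n)%C; [intro n; ring|].
  apply is_Cseries_plus; apply is_pseries_C; [apply Hc|apply Hd]; apply Rlt_le_trans with (1 := Hz);
    [apply Rmin_l|apply Rmin_r].
Qed.

Lemma analytic_at_opp (f : C -> C) (z0 : C) : analytic_at f z0 -> analytic_at (fun z => - f z)%C z0.
Proof.
  intros (c & r & Hr & Hc). exists (fun n => - c n)%C, r. split; [exact Hr|].
  intros z Hz. apply is_pseries_C.
  apply is_Cseries_ext with (fun n => (- (1)) * ((z - z0) ^ n * c n))%C; [intro n; ring|].
  replace (- f z)%C with ((- (1)) * f z)%C by ring.
  apply is_Cseries_scal, is_pseries_C, Hc, Hz.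
Qed.

(** Convergence is absolute, and removing the first term shows that the sum [l] satisfies
    [q l = l - 1]. *)
Lemma is_Cseries_geom (q : C) : Cmod q < 1 -> is_Cseries (fun n => q ^ n)%C (/ (1 - q))%C.
Proof.
  intro Hq.
  assert (H : is_Cseries (fun n => q ^ n)%C (CSeries (fun n => q ^ n)%C)).
  { apply CSeries_correct. apply ex_series_ext with (fun n => Cmod q ^ n).
    - intro n. symmetry. apply Cmod_pow.
    - apply ex_series_geom. rewrite Rabs_pos_eq by apply Cmod_ge_0. exact Hq. }
  set (l := CSeries (fun n => q ^ n)%C) in *.
  assert (E : (q * l = l - 1)%C).
  { rewrite <- (is_Cseries_unique _ _ (is_Cseries_scal q _ _ H)).
    apply is_Cseries_unique.
    apply is_Cseries_ext with (fun n => q ^ S n)%C; [intro n; apply Cpow_S|].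
    exact (is_Cseries_incr_1 _ _ H). }
  replace (/ (1 - q))%C with l; [exact H|].
  assert (Hq1 : (1 - q)%C <> RtoC 0).
  { intro H0. assert (E1 : q = RtoC 1) by (replace q with (1 - (1 - q))%C by ring; rewrite H0; ring).
    rewrite E1, Cmod_1 in Hq. lra. }
  assert (E2 : (l * (1 - q) = 1)%C).
  { replace (l * (1 - q))%C with (l - q * l)%C by ring. rewrite E. ring. }
  replace l with (l * (1 - q) * / (1 - q))%C by (field; exact Hq1).
  rewrite E2. ring.
Qed.

Lemma Cminus_neq_0 (a b : C) : a <> b -> (a - b)%C <> RtoC 0.
Proof. intros H E. apply H. replace a with (a - b + b)%C by ring. rewrite E. ring. Qed.

(** Write [z - p = (s0 - p) (1 - q)] with [q = - (z - s0) / (s0 - p)] and use the geometric series;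
    [|q| < 1] holds up to the distance from [s0] to the pole. *)
Lemma analytic_at_inv (p s0 : C) : s0 <> p -> analytic_at (fun s => / (s - p))%C s0.
Proof.
  intro Hp. assert (Hd := Cminus_neq_0 _ _ Hp). assert (Hm := proj1 (Cmod_gt_0 _) Hd).
  exists (fun n => / (s0 - p) * (- / (s0 - p)) ^ n)%C, (Cmod (s0 - p)). split; [exact Hm|].
  intros z Hz. apply is_pseries_C.
  assert (Hq : Cmod ((z - s0) * (- / (s0 - p))) < 1).
  { rewrite Cmod_mult, Cmod_opp, Cmod_inv by exact Hd.
    apply Rmult_lt_reg_r with (1 := Hm). rewrite Rmult_assoc, Rinv_l by lra. lra. }
  assert (Hzp : (z - p)%C <> RtoC 0).
  { intro E. replace (z - s0)%C with (- (s0 - p))%C in Hz.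
    - rewrite Cmod_opp in Hz. lra.
    - replace (z - s0)%C with ((z - p) - (s0 - p))%C by ring. rewrite E. ring. }
  apply is_Cseries_ext with (fun n => / (s0 - p) * ((z - s0) * (- / (s0 - p))) ^ n)%C.
  { intro n. rewrite Cpow_mult_l. ring. }
  replace (/ (z - p))%C with (/ (s0 - p) * / (1 - (z - s0) * (- / (s0 - p))))%C.
  - now apply is_Cseries_scal, is_Cseries_geom.
  - replace (1 - (z - s0) * - / (s0 - p))%C with ((z - p) * / (s0 - p))%C by (field; exact Hd).
    field. now split.
Qed.

(* Coefficients of [(w0 + h)^k] as a polynomial in [h]. *)
Fixpoint binom_coef (w0 : C) (k n : nat) : C :=
  match k with
  | O => match n with O => RtoC 1 | S _ => RtoC 0 end
  | S j => (w0 * binom_coef w0 j n + Cshift1 (binom_coef w0 j) n)%C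
  end.

Lemma is_Cseries_0 : is_Cseries (fun _ => RtoC 0) (RtoC 0).
Proof.
  apply is_Cseries_components. simpl.
  assert (H : is_series (fun _ : nat => 0) 0); [|now split].
  apply is_series_sum_n_lim. apply is_lim_seq_ext with (fun _ => 0); [|apply is_lim_seq_const].
  intro n. rewrite sum_n_const. ring.
Qed.

Lemma binom_coef_spec (w0 h : C) (k : nat) :
  is_Cseries (fun n => h ^ n * binom_coef w0 k n)%C ((w0 + h) ^ k)%C.
Proof.
  induction k as [|k IH].
  - apply is_series_decr_1.
    change (is_Cseries (fun n => h ^ S n * 0)%C (1 + - (h ^ 0 * 1))%C).
    replace (1 + - (h ^ 0 * 1))%C with (RtoC 0) by (simpl; ring).
    apply is_Cseries_ext with (2 := is_Cseries_0). intro n. ring.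
  - simpl binom_coef.
    replace ((w0 + h) ^ S k)%C with (w0 * (w0 + h) ^ k + h * (w0 + h) ^ k)%C by (rewrite Cpow_S; ring).
    eapply is_Cseries_ext; [|apply is_Cseries_plus; [apply is_Cseries_scal, IH|
      apply is_Cseries_scal, is_Cseries_shift1, IH]].
    intros [|n]; simpl; ring.
Qed.

Lemma Rsum_shift1 (f : nat -> R) (N : nat) :
  (forall n, 0 <= f n) -> sum_n (shift1 f) N <= sum_n f N.
Proof.
  intro Hf. destruct N as [|N]; [rewrite !sum_O; apply Hf|].
  assert (E : sum_n (shift1 f) (S N) = sum_n f N).
  { induction N as [|N IH]; rewrite sum_Sn.
    - rewrite !sum_O. change (0 + f 0%nat = f 0%nat). ring.
    - rewrite IH, sum_Sn. reflexivity. }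
  rewrite E, sum_Sn. change (sum_n f N <= sum_n f N + f (S N)). specialize (Hf (S N)). lra.
Qed.

Lemma sum_n_plus_R (f g : nat -> R) (N : nat) : sum_n (fun n => f n + g n) N = sum_n f N + sum_n g N.
Proof. exact (sum_n_plus f g N). Qed.

Lemma sum_n_scal_R (c : R) (f : nat -> R) (N : nat) : sum_n (fun n => c * f n) N = c * sum_n f N.
Proof. exact (sum_n_mult_l c f N). Qed.

(** The binomial theorem with moduli: multiplication by [w0 + h] multiplies the weighted norm by at
    most [|w0| + r]. *)
Lemma binom_coef_norm (w0 : C) (r : R) (k : nat) : 0 <= r -> forall N,
  sum_n (fun n => Cmod (binom_coef w0 k n) * r ^ n) N <= (Cmod w0 + r) ^ k.
Proof.
  intro Hr. induction k as [|k IH]; intro N.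
  - simpl ((_ + _) ^ 0). induction N as [|N IHN].
    + rewrite sum_O. simpl. rewrite Cmod_1. lra.
    + rewrite sum_Sn. simpl binom_coef. rewrite Cmod_0.
      change (sum_n (fun n => Cmod (binom_coef w0 0 n) * r ^ n) N + 0 * r ^ S N <= 1). lra.
  - apply Rle_trans with (sum_n (fun n => Cmod w0 * (Cmod (binom_coef w0 k n) * r ^ n) +
      r * shift1 (fun n => Cmod (binom_coef w0 k n) * r ^ n) n) N).
    + apply sum_n_le. intro n. simpl binom_coef.
      apply Rle_trans with ((Cmod w0 * Cmod (binom_coef w0 k n) + Cmod (Cshift1 (binom_coef w0 k) n)) * r ^ n).
      * apply Rmult_le_compat_r; [now apply pow_le|].
        apply Rle_trans with (1 := Cmod_triangle _ _). rewrite Cmod_mult. lra.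
      * right. destruct n as [|n]; simpl; [rewrite Cmod_0|]; ring.
    + rewrite sum_n_plus_R, !sum_n_scal_R.
      assert (H0 : forall n, 0 <= Cmod (binom_coef w0 k n) * r ^ n).
      { intro n. apply Rmult_le_pos; [apply Cmod_ge_0|now apply pow_le]. }
      assert (H1 := Rsum_shift1 _ N H0). assert (H2 := IH N). assert (H3 := Cmod_ge_0 w0).
      simpl. rewrite Rmult_plus_distr_r. apply Rplus_le_compat; apply Rmult_le_compat_l; lra.
Qed.

(** Each power [(w0 + h)^k] is expanded in [h] and the double sum regrouped. The radius 1 is
    arbitrary, because the sum of [|e k| (|w0| + r)^k] is finite for every [r]. *)
Lemma analytic_at_entire (e : nat -> C) (p s0 : C) :
  (forall r, 0 < r -> ex_series (fun n => Cmod (e n) * r ^ n)) ->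
  analytic_at (fun s => CSeries (fun n => (s - p) ^ n * e n)%C) s0.
Proof.
  intro He. set (w0 := (s0 - p)%C).
  exists (fun n => CSeries (fun k => e k * binom_coef w0 k n)%C), 1. split; [lra|].
  intros z Hz. apply is_pseries_C.
  replace (CSeries (fun n => (z - p) ^ n * e n)%C) with
    (CSeries (fun k => e k * (w0 + (z - s0)) ^ k)%C).
  - apply (is_Cseries_sum_power_series (fun k n => e k * binom_coef w0 k n)%C
      (fun k h => e k * (w0 + h) ^ k)%C 1 (fun k => Cmod (e k) * (Cmod w0 + 1) ^ k)).
    + lra.
    + intros k N. apply Rle_trans with
        (sum_n (fun n => Cmod (e k) * (Cmod (binom_coef w0 k n) * 1 ^ n)) N).
      * apply sum_n_le. intro n. rewrite Cmod_mult. lra.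
      * rewrite sum_n_scal_R. apply Rmult_le_compat_l; [apply Cmod_ge_0|].
        apply binom_coef_norm. lra.
    + apply He. assert (H := Cmod_ge_0 w0). lra.
    + lra.
    + intro k. eapply is_Cseries_ext; [|apply is_Cseries_scal, binom_coef_spec].
      intro n. cbv beta. ring.
  - unfold CSeries. f_equal; apply Series_ext; intro n; unfold w0; f_equal;
      replace (s0 - p + (z - s0))%C with (z - p)%C by ring; ring.
Qed.

(** As [Cexp] is built from the real [exp], [cos] and [sin], its series is identified by a
    differential equation in a real parameter [t]: the product of [exp (- t z)] and the sum of
    [(t z)^n / n!] has derivative 0 and value 1 at [t = 0]. *)
Lemma Cexp_series (z : C) : is_Cseries (fun n => z ^ n * RtoC (/ INR (fact n)))%C (Cexp z).
Proof.
  pose (u := fun n => fst (z ^ n)%C / INR (fact n)). pose (v := fun n => snd (z ^ n)%C / INR (fact n)).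
  assert (Hbound : forall f : C -> R, (forall y, Rabs (f y) <= Cmod y) -> forall r,
    ex_series (fun n => Rabs (f (z ^ n)%C / INR (fact n) * r ^ n))).
  { intros f Hf r. apply ex_series_dom with (fun n => (Cmod z * Rabs r) ^ n / INR (fact n)).
    - intro n. rewrite Rabs_Rabsolu, Rabs_mult. unfold Rdiv. rewrite Rabs_mult, <- RPow_abs.
      assert (Hi : 0 < / INR (fact n)) by apply Rinv_0_lt_compat, INR_fact_lt_0.
      rewrite (Rabs_pos_eq (/ _)) by lra.
      assert (H := Hf (z ^ n)%C). rewrite Cmod_pow in H. rewrite Rpow_mult_distr.
      assert (H1 := pow_le (Rabs r) n (Rabs_pos r)).
      replace (Cmod z ^ n * Rabs r ^ n * / INR (fact n)) with (Cmod z ^ n * / INR (fact n) * Rabs r ^ n) by ring.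
      apply Rmult_le_compat_r; [exact H1|]. apply Rmult_le_compat_r; lra.
    - eexists. apply is_series_exp. }
  assert (HCV : forall f : C -> R, (forall y, Rabs (f y) <= Cmod y) -> forall t,
    Rbar_lt (Rabs t) (CV_radius (fun n => f (z ^ n)%C / INR (fact n)))).
  { intros f Hf t. apply Rbar_lt_le_trans with (Finite (Rabs t + 1)); [simpl; lra|].
    apply (proj1 (Lub_Rbar_correct (CV_disk (fun n => f (z ^ n)%C / INR (fact n))))).
    apply Hbound, Hf. }
  assert (Hpd : forall f : C -> R, forall n, PS_derive (fun n => f (z ^ n)%C / INR (fact n)) n =
     f (z * z ^ n)%C / INR (fact n)).
  { intros f n. unfold PS_derive. rewrite Cpow_S.
    rewrite fact_simpl, mult_INR. field. split; [apply INR_fact_neq_0|apply not_0_INR; discriminate]. }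
  assert (Hu : forall t, is_derive (PSeries u) t (fst z * PSeries u t - snd z * PSeries v t)).
  { intro t. replace (fst z * PSeries u t - snd z * PSeries v t) with (PSeries (PS_derive u) t).
    - apply is_derive_PSeries. apply (HCV fst), Rabs_fst_le_Cmod.
    - unfold PSeries. rewrite <- !Series_scal_l, <- Series_minus.
      + apply Series_ext. intro n. unfold u at 1. rewrite (Hpd fst). unfold u, v. simpl. unfold Rdiv. ring.
      + apply (ex_series_scal_l (V := R_NormedModule)), ex_series_Rabs, (Hbound fst), Rabs_fst_le_Cmod.
      + apply (ex_series_scal_l (V := R_NormedModule)), ex_series_Rabs, (Hbound snd), Rabs_snd_le_Cmod. }
  assert (Hv : forall t, is_derive (PSeries v) t (fst z * PSeries v t + snd z * PSeries u t)).
  { intro t. replace (fst z * PSeries v t + snd z * PSeries u t) with (PSeries (PS_derive v) t).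
    - apply is_derive_PSeries. apply (HCV snd), Rabs_snd_le_Cmod.
    - unfold PSeries. rewrite <- !Series_scal_l, <- Series_plus.
      + apply Series_ext. intro n. unfold v at 1. rewrite (Hpd snd). unfold u, v. simpl. unfold Rdiv. ring.
      + apply (ex_series_scal_l (V := R_NormedModule)), ex_series_Rabs, (Hbound snd), Rabs_snd_le_Cmod.
      + apply (ex_series_scal_l (V := R_NormedModule)), ex_series_Rabs, (Hbound fst), Rabs_fst_le_Cmod. }
  clear Hpd. set (x := fst z) in *. set (y := snd z) in *.
  (* [A] and [B] are the real and imaginary parts of [exp (- t z)] times the series
     [PSeries u + i PSeries v]. *)
  pose (A := fun t => exp (- x * t) * (PSeries u t * cos (y * t) + PSeries v t * sin (y * t))).
  pose (B := fun t => exp (- x * t) * (PSeries v t * cos (y * t) - PSeries u t * sin (y * t))).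
  assert (HA : forall t, is_derive A t 0).
  { intro t. unfold A. auto_derive.
    - repeat split; eexists; [apply Hu|apply Hv].
    - replace (Derive (fun x0 => PSeries u x0) t) with (x * PSeries u t - y * PSeries v t)
        by (symmetry; apply is_derive_unique, Hu).
      replace (Derive (fun x0 => PSeries v x0) t) with (x * PSeries v t + y * PSeries u t)
        by (symmetry; apply is_derive_unique, Hv). ring. }
  assert (HB : forall t, is_derive B t 0).
  { intro t. unfold B. auto_derive.
    - repeat split; eexists; [apply Hv|apply Hu].
    - replace (Derive (fun x0 => PSeries u x0) t) with (x * PSeries u t - y * PSeries v t)
        by (symmetry; apply is_derive_unique, Hu).
      replace (Derive (fun x0 => PSeries v x0) t) with (x * PSeries v t + y * PSeries u t)
        by (symmetry; apply is_derive_unique, Hv). ring. }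
  assert (Hconst : forall f : R -> R, (forall t, is_derive f t 0) -> f 1 = f 0).
  { intros f Hf. destruct (MVT_gen f 0 1 (fun _ => 0)) as (c & _ & E).
    - intros t _. apply Hf.
    - intros t _. apply continuity_pt_filterlim. eapply is_derive_continuous. apply Hf.
    - lra. }
  assert (EA := Hconst A HA). assert (EB := Hconst B HB). unfold A, B in EA, EB.
  assert (Eu0 : PSeries u 0 = 1).
  { rewrite PSeries_0. unfold u. simpl. field. }
  assert (Ev0 : PSeries v 0 = 0).
  { rewrite PSeries_0. unfold v. simpl. field. }
  rewrite Eu0, Ev0, !Rmult_0_r, exp_0, cos_0, sin_0, !Rmult_1_r in EA, EB.
  assert (Exx : exp x * exp (- x) = 1) by (rewrite <- exp_plus, Rplus_opp_r; apply exp_0).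
  assert (EA' : PSeries u 1 * cos y + PSeries v 1 * sin y = exp x).
  { apply Rmult_eq_reg_l with (exp (- x)); [|apply Rgt_not_eq, exp_pos]. lra. }
  assert (EB' : PSeries v 1 * cos y - PSeries u 1 * sin y = 0).
  { apply Rmult_eq_reg_l with (exp (- x)); [|apply Rgt_not_eq, exp_pos]. lra. }
  assert (Hcs := sin2_cos2 y). unfold Rsqr in Hcs.
  (* The two relations say that the pair rotated by the angle [- y] is [(exp x, 0)]; they are solved
     by rotating back. *)
  assert (E1 : PSeries u 1 = exp x * cos y).
  { rewrite <- EA'. transitivity (PSeries u 1 * (sin y * sin y + cos y * cos y) + sin y * (PSeries v 1 * cos y - PSeries u 1 * sin y)); [rewrite Hcs, EB'|]; ring. }
  assert (E2 : PSeries v 1 = exp x * sin y).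
  { rewrite <- EA'. transitivity (PSeries v 1 * (sin y * sin y + cos y * cos y) - cos y * (PSeries v 1 * cos y - PSeries u 1 * sin y)); [rewrite Hcs, EB'|]; ring. }
  apply is_Cseries_components. unfold Cexp. change (Re z) with x. change (Im z) with y. simpl fst at 2. simpl snd at 2.
  rewrite <- E1, <- E2. split.
  - assert (H := Series_correct _ (ex_series_Rabs _ (Hbound fst Rabs_fst_le_Cmod 1))).
    revert H. apply is_series_ext. intro n. rewrite pow1. simpl. unfold Rdiv. ring.
  - assert (H := Series_correct _ (ex_series_Rabs _ (Hbound snd Rabs_snd_le_Cmod 1))).
    revert H. apply is_series_ext. intro n. rewrite pow1. simpl. unfold Rdiv. ring.
Qed.

(** * The identity theorem and the Hurwitz zeta function *)

(** A convergent series has bounded terms, so convergence at the single point [r] gives a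
    Cauchy-type bound on the coefficients. *)
Lemma is_Cseries_coeff_bound (c : nat -> C) (r : R) (l : C) :
  0 < r -> is_Cseries (fun n => RtoC r ^ n * c n)%C l ->
  exists M, 0 < M /\ forall n, Cmod (c n) * r ^ n <= M.
Proof.
  intros Hr H. apply is_Cseries_components in H. destruct H as [H1 H2].
  assert (B : forall u : nat -> R, ex_series u -> exists M, forall n, Rabs (u n) <= M).
  { intros u Hu. apply ex_series_lim_0 in Hu.
    assert (Hc : Un_cv u 0) by now apply is_lim_seq_Reals.
    destruct (maj_by_pos u (exist _ 0 Hc)) as (M & _ & HM). now exists M. }
  destruct (B _ (ex_intro _ _ H1)) as [M1 HM1]. destruct (B _ (ex_intro _ _ H2)) as [M2 HM2].
  assert (P1 : 0 <= M1) by exact (Rle_trans _ _ _ (Rabs_pos _) (HM1 0%nat)).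
  assert (P2 : 0 <= M2) by exact (Rle_trans _ _ _ (Rabs_pos _) (HM2 0%nat)).
  exists (M1 + M2 + 1). split; [lra|]. intro n.
  assert (E : Cmod (c n) * r ^ n = Cmod (RtoC r ^ n * c n)).
  { rewrite Cmod_mult, Cmod_pow, Cmod_R, Rabs_pos_eq by lra. ring. }
  rewrite E. apply Rle_trans with (1 := Cmod_le_components _).
  specialize (HM1 n). specialize (HM2 n). lra.
Qed.

(* If all coefficients below [m] vanish, the zeros accumulating at the center
   force the [m]-th one to vanish as well. *)
Lemma power_series_zeros_cluster (c : nat -> C) (f : C -> C) (r : R) :
  0 < r -> (forall h, Cmod h < r -> is_Cseries (fun n => h ^ n * c n)%C (f h)) ->
  (forall d, 0 < d -> exists h, h <> RtoC 0 /\ Cmod h < d /\ f h = RtoC 0) ->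
  forall n, c n = RtoC 0.
Proof.
  intros Hr Hc Hz.
  assert (Hstep : forall m, (forall k, (k < m)%nat -> c k = RtoC 0) -> c m = RtoC 0).
  { intros m Hm.
    (* As long as the leading coefficients vanish, the series may be divided by [h] term by term. *)
    assert (Hshift : forall h, Cmod h < r -> h <> RtoC 0 -> forall j, (j <= m)%nat ->
       is_Cseries (fun n => h ^ n * c (j + n)%nat)%C (f h / h ^ j)%C).
    { intros h Hh Hh0 j. induction j as [|j IH]; intro Hj.
      - replace (f h / h ^ 0)%C with (f h) by (simpl; field). now apply Hc.
      - assert (IH' := IH ltac:(lia)).
        apply is_Cseries_incr_1 in IH'. rewrite Nat.add_0_r, Hm in IH' by lia.
        apply is_Cseries_scal with (c := (/ h)%C) in IH'.
        replace (f h / h ^ S j)%C with (/ h * (f h / h ^ j - h ^ 0 * 0))%C.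
        + revert IH'. apply is_Cseries_ext. intro n. cbv beta. rewrite Cpow_S.
          replace (j + S n)%nat with (S j + n)%nat by lia. generalize (h ^ n)%C (c (S j + n)%nat).
          intros p q. field. exact Hh0.
        + rewrite Cpow_S. simpl (h ^ 0)%C. generalize (Cpow_nz h j Hh0). generalize (h ^ j)%C.
          intros p Hp. field. now split. }
    destruct (is_Cseries_coeff_bound c (r / 2) (f (RtoC (r / 2)))) as (M & HM & HMn); [lra| |].
    { apply Hc. rewrite Cmod_R, Rabs_pos_eq; lra. }
    apply Cmod_eq_0. apply Rle_antisym; [|apply Cmod_ge_0]. apply le_epsilon. intros eps Heps.
    set (q := r / 2) in *. assert (Hq : 0 < q) by (unfold q; lra).
    assert (Hqm : 0 < q ^ S m) by now apply pow_lt.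
    (* At a zero [h] of [f], [c m] is minus the sum of [h^n c (m + n)] over [n >= 1]. For
       [|h| < q / 2] this is at most [4 M |h| / q^(m + 1)] in modulus: one factor 2 comes from the
       geometric series, the other from [Cmod_CSeries_le]. *)
    assert (HM4 : 0 < 4 * M / q ^ S m) by (apply Rdiv_lt_0_compat; lra).
    destruct (Hz (Rmin (q / 2) (eps / (4 * M / q ^ S m)))) as (h & Hh0 & Hh & Hfh).
    { apply Rmin_glb_lt; [lra|]. now apply Rdiv_lt_0_compat. }
    assert (Hh1 := Rlt_le_trans _ _ _ Hh (Rmin_l _ _)). assert (Hh2 := Rlt_le_trans _ _ _ Hh (Rmin_r _ _)).
    assert (S0 := Hshift h ltac:(unfold q in *; lra) Hh0 m (Nat.le_refl _)).
    rewrite Hfh in S0. replace (0 / h ^ m)%C with (RtoC 0) in S0 by (field; now apply Cpow_nz).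
    apply is_Cseries_incr_1 in S0. rewrite Nat.add_0_r in S0.
    replace (0 - h ^ 0 * c m)%C with (- c m)%C in S0 by (simpl; ring).
    apply is_Cseries_unique in S0.
    rewrite <- Cmod_opp, <- S0, Rplus_0_l.
    assert (Hx : 0 <= Cmod h / q < / 2).
    { split; [apply Rmult_le_pos; [apply Cmod_ge_0|left; now apply Rinv_0_lt_compat]|].
      apply Rmult_lt_reg_r with (1 := Hq). unfold Rdiv. rewrite Rmult_assoc, Rinv_l by lra. lra. }
    assert (Hgeom : is_series (fun n => (M / q ^ S m * Cmod h) * (Cmod h / q) ^ n)
       ((M / q ^ S m * Cmod h) * / (1 - Cmod h / q))).
    { apply (is_series_scal_l (V := R_NormedModule) (M / q ^ S m * Cmod h)).
      apply is_series_geom. rewrite Rabs_pos_eq; lra. }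
    apply Rle_trans with (2 * Series (fun n => (M / q ^ S m * Cmod h) * (Cmod h / q) ^ n)).
    - apply Cmod_CSeries_le; [|now eexists; exact Hgeom].
      intro n. rewrite Cmod_mult, Cmod_pow.
      assert (H1 := HMn (m + S n)%nat).
      replace (M / q ^ S m * Cmod h * (Cmod h / q) ^ n) with (Cmod h ^ S n * (M / q ^ (m + S n))).
      + apply Rmult_le_compat_l; [apply pow_le, Cmod_ge_0|].
        assert (Hqmn : 0 < q ^ (m + S n)) by now apply pow_lt.
        apply Rmult_le_reg_r with (1 := Hqmn). unfold Rdiv. rewrite Rmult_assoc, Rinv_l by lra. lra.
      + unfold Rdiv. rewrite Rpow_mult_distr, pow_inv. rewrite pow_add. simpl. field.
        repeat split; try lra; apply Rgt_not_eq; now apply pow_lt.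
    - rewrite (is_series_unique _ _ Hgeom).
      assert (Hi : / (1 - Cmod h / q) <= 2).
      { replace 2 with (/ / 2) by field. apply Rinv_le_contravar; lra. }
      assert (Hm2 : (4 * M / q ^ S m) * Cmod h <= eps).
      { apply Rlt_le. apply Rmult_lt_reg_r with (/ (4 * M / q ^ S m)); [now apply Rinv_0_lt_compat|].
        rewrite Rmult_comm, <- Rmult_assoc, Rinv_l, Rmult_1_l by lra. exact Hh2. }
      assert (Hp : 0 <= M / q ^ S m * Cmod h).
      { apply Rmult_le_pos; [|apply Cmod_ge_0]. left. now apply Rdiv_lt_0_compat. }
      replace (4 * M / q ^ S m * Cmod h) with (2 * (M / q ^ S m * Cmod h * 2)) in Hm2 by (unfold Rdiv; ring).
      apply Rle_trans with (2 := Hm2). apply Rmult_le_compat_l; [lra|].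
      apply Rmult_le_compat_l; lra. }
  intro n. induction n as [n IH] using (well_founded_induction Wf_nat.lt_wf). now apply Hstep.
Qed.

Definition zeros_cluster (d : C -> C) (p : C) : Prop :=
  forall eps, 0 < eps -> exists z, z <> p /\ Cmod (z - p) < eps /\ d z = RtoC 0.

Lemma analytic_zero_near (d : C -> C) (p : C) :
  analytic_at d p -> zeros_cluster d p ->
  exists r, 0 < r /\ forall z, Cmod (z - p) < r -> d z = RtoC 0.
Proof.
  intros (c & r & Hr & Hc) Hz. exists r. split; [exact Hr|].
  assert (H0 : forall n, c n = RtoC 0).
  { apply (power_series_zeros_cluster c (fun h => d (p + h)%C) r Hr).
    - intros h Hh. apply is_pseries_C.
      assert (H := Hc (p + h)%C). replace (p + h - p)%C with h in H by ring. now apply H.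
    - intros eps Heps. destruct (Hz eps Heps) as (z & H1 & H2 & H3).
      exists (z - p)%C. repeat split; [now apply Cminus_neq_0|exact H2|].
      replace (p + (z - p))%C with z by ring. exact H3. }
  intros z Hzr. specialize (Hc z Hzr). apply is_pseries_C in Hc.
  rewrite <- (is_Cseries_unique _ _ Hc). apply is_Cseries_unique.
  apply is_Cseries_ext with (2 := is_Cseries_0). intro n. rewrite H0. symmetry. apply Cmult_0_r.
Qed.

Definition seg (p q : C) (t : R) : C := (p + RtoC t * (q - p))%C.

Lemma Cmod_seg (p q : C) (s t : R) : Cmod (seg p q s - seg p q t) = Rabs (s - t) * Cmod (q - p).
Proof.
  unfold seg. replace (p + s * (q - p) - (p + t * (q - p)))%C with (RtoC (s - t) * (q - p))%C.
  - now rewrite Cmod_mult, Cmod_R.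
  - rewrite RtoC_minus. ring.
Qed.

(* The largest [t] such that [d] vanishes on the segment up to [seg p q t] is [1]. *)
Lemma identity_segment (d : C -> C) (p q : C) :
  p <> q -> (forall t, 0 <= t <= 1 -> analytic_at d (seg p q t)) ->
  zeros_cluster d p -> d q = RtoC 0.
Proof.
  intros Hpq Han Hacc.
  assert (Hm : 0 < Cmod (q - p)).
  { apply Cmod_gt_0, Cminus_neq_0. congruence. }
  assert (Hseg0 : seg p q 0 = p) by (unfold seg; ring).
  assert (Hseg1 : seg p q 1 = q) by (unfold seg; ring).
  pose (S := fun t => 0 <= t <= 1 /\ forall u, 0 <= u <= t -> d (seg p q u) = RtoC 0).
  assert (Hnear : forall t, 0 <= t <= 1 -> zeros_cluster d (seg p q t) ->
    exists eta, 0 < eta /\ forall u, Rabs (u - t) < eta -> d (seg p q u) = RtoC 0).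
  { intros t Ht Hz. destruct (analytic_zero_near d _ (Han t Ht) Hz) as (r & Hr & H).
    exists (r / Cmod (q - p)). split; [now apply Rdiv_lt_0_compat|].
    intros u Hu. apply H. rewrite Cmod_seg.
    apply Rmult_lt_reg_r with (/ Cmod (q - p)); [now apply Rinv_0_lt_compat|].
    rewrite Rmult_assoc, Rinv_r, Rmult_1_r by lra. exact Hu. }
  assert (HS0 : S 0).
  { split; [lra|]. intros u Hu. replace u with 0 by lra.
    destruct (Hnear 0 ltac:(lra)) as (eta & Heta & H); [now rewrite Hseg0|].
    apply H. rewrite Rminus_0_r, Rabs_R0. exact Heta. }
  destruct (completeness S) as [s [Hub Hlub]].
  { exists 1. intros t [Ht _]. lra. }
  { now exists 0. }
  assert (Hs : 0 <= s <= 1).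
  { split; [now apply Hub|]. apply Hlub. intros t [Ht _]. lra. }
  assert (Hbelow : forall u, 0 <= u < s -> d (seg p q u) = RtoC 0).
  { intros u Hu. destruct (classic (exists t, S t /\ u < t)) as [[t [[Ht H] Hut]]|Hn].
    - apply H. lra.
    - exfalso. assert (s <= u); [|lra]. apply Hlub. intros t Ht.
      destruct (Rle_lt_dec t u) as [H|H]; [exact H|]. exfalso. apply Hn. now exists t. }
  destruct (Hnear s Hs) as (eta & Heta & Hd).
  { destruct (Req_dec s 0) as [E|E]; [now rewrite E, Hseg0|].
    intros eps Heps.
    (* Points of the segment just before parameter [s] are zeros accumulating there: the bound [s]
       keeps the parameter nonnegative, the other bound keeps the distance below [eps]. *)
    exists (seg p q (s - Rmin s (eps / (2 * Cmod (q - p))))).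
    assert (H1 : 0 < Rmin s (eps / (2 * Cmod (q - p)))).
    { apply Rmin_glb_lt; [lra|]. apply Rdiv_lt_0_compat; lra. }
    assert (H2 := Rmin_l s (eps / (2 * Cmod (q - p)))). assert (H3 := Rmin_r s (eps / (2 * Cmod (q - p)))).
    set (e := Rmin s (eps / (2 * Cmod (q - p)))) in *.
    assert (Emod : Cmod (seg p q (s - e) - seg p q s) = e * Cmod (q - p)).
    { rewrite Cmod_seg. replace (s - e - s) with (- e) by ring. rewrite Rabs_Ropp, Rabs_pos_eq by lra. reflexivity. }
    repeat split.
    - intro E1. rewrite E1 in Emod. replace (seg p q s - seg p q s)%C with (RtoC 0) in Emod by ring.
      rewrite Cmod_0 in Emod. nra.
    - rewrite Emod. apply Rle_lt_trans with (eps / (2 * Cmod (q - p)) * Cmod (q - p)).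
      + apply Rmult_le_compat_r; lra.
      + replace (eps / (2 * Cmod (q - p)) * Cmod (q - p)) with (eps / 2) by (field; lra). lra.
    - apply Hbelow. lra. }
  destruct (Req_dec s 1) as [E|E].
  - rewrite <- Hseg1, <- E. apply Hd. rewrite Rminus_diag, Rabs_R0. exact Heta.
  - exfalso. set (t := Rmin 1 (s + eta / 2)).
    assert (Ht1 : t <= 1) by apply Rmin_l. assert (Ht2 : t <= s + eta / 2) by apply Rmin_r.
    assert (Hst : s < t) by (apply Rmin_glb_lt; lra).
    assert (HSt : S t).
    { split; [lra|]. intros u Hu. destruct (Rlt_le_dec u s) as [H|H]; [apply Hbelow; lra|].
      apply Hd. rewrite Rabs_pos_eq; lra. }
    apply Hub in HSt. lra.
Qed.

(** * The Dirichlet series in the half-plane of convergence, and its continuation *)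

Lemma Cmod_Cexp (z : C) : Cmod (Cexp z) = exp (fst z).
Proof.
  assert (H : 0 <= Cmod (Cexp z)) by apply Cmod_ge_0.
  assert (H' := exp_pos (fst z)).
  apply Rsqr_inj; [exact H|lra|]. unfold Rsqr.
  replace (Cmod (Cexp z) * Cmod (Cexp z)) with (Cmod (Cexp z) ^ 2) by ring.
  rewrite Cmod2_alt. unfold Cexp. simpl. assert (Hcs := sin2_cos2 (snd z)). unfold Rsqr in Hcs.
  transitivity (exp (fst z) * exp (fst z) * (sin (snd z) * sin (snd z) + cos (snd z) * cos (snd z))).
  - unfold Re, Im. ring.
  - rewrite Hcs. ring.
Qed.

Lemma Cexp_plus (z w : C) : Cexp (z + w)%C = (Cexp z * Cexp w)%C.
Proof.
  unfold Cexp, Cmult, Re, Im. simpl. rewrite exp_plus, cos_plus, sin_plus. f_equal; ring.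
Qed.

Definition dirichlet (a : R) (s : C) : C := CSeries (fun k => Cexp (- s * RtoC (ln (INR k + a)))%C).

Lemma fst_mult_RtoC (s : C) (x : R) : fst (- s * RtoC x)%C = - fst s * x.
Proof. simpl. ring. Qed.

Lemma dirichlet_correct (a : R) (s : C) : 0 < a -> 1 < Re s ->
  is_Cseries (fun k => Cexp (- s * RtoC (ln (INR k + a)))%C) (dirichlet a s).
Proof.
  intros Ha Hs. apply CSeries_correct.
  apply ex_series_ext with (fun k => Rpower (INR k + a) (- Re s)).
  - intro k. rewrite Cmod_Cexp, fst_mult_RtoC. reflexivity.
  - now apply ex_series_power.
Qed.

Lemma exp_Rabs_le (x : R) : exp (Rabs x) <= exp x + exp (- x).
Proof.
  assert (H1 := exp_pos x). assert (H2 := exp_pos (- x)).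
  destruct (Rle_dec 0 x); [rewrite Rabs_pos_eq by lra|rewrite Rabs_left by lra]; lra.
Qed.

(** Each [(k + a)^(-z)] is expanded about [s0]. The radius [r] is half the distance to the line
    [Re s = 1], so that the majorant exponents [sg - r] and [sg + r] both exceed 1. *)
Lemma dirichlet_analytic (a : R) (s0 : C) : 0 < a -> 1 < Re s0 -> analytic_at (dirichlet a) s0.
Proof.
  intros Ha Hs. set (sg := Re s0) in *. set (r := (sg - 1) / 2).
  assert (Hr : 0 < r) by (unfold r; lra).
  pose (L := fun k => ln (INR k + a)).
  pose (u := fun k n => (Cexp (- s0 * RtoC (L k)) * ((- RtoC (L k)) ^ n * RtoC (/ INR (fact n))))%C).
  exists (fun n => CSeries (fun k => u k n)), r. split; [exact Hr|].
  intros z Hz. apply is_pseries_C.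
  replace (dirichlet a z) with (CSeries (fun k => Cexp (- (s0 + (z - s0)) * RtoC (L k))%C)).
  2: { unfold dirichlet. f_equal. apply functional_extensionality. intro k.
       f_equal. unfold L. ring. }
  apply (is_Cseries_sum_power_series u (fun k h => Cexp (- (s0 + h) * RtoC (L k))%C) r
    (fun k => Rpower (INR k + a) (- (sg - r)) + Rpower (INR k + a) (- (sg + r)))).
  - exact Hr.
  - intros k N.
    assert (H : is_series (fun n => Rpower (INR k + a) (- sg) * ((Rabs (L k) * r) ^ n / INR (fact n)))
       (Rpower (INR k + a) (- sg) * exp (Rabs (L k) * r))).
    { apply (is_series_scal_l (V := R_NormedModule) (Rpower (INR k + a) (- sg))), is_series_exp. }
    assert (Hpos : forall n, 0 <= Rpower (INR k + a) (- sg) * ((Rabs (L k) * r) ^ n / INR (fact n))).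
    { intro n. apply Rmult_le_pos; [left; apply Rpower_pos|]. apply Rmult_le_pos.
      - apply pow_le, Rmult_le_pos; [apply Rabs_pos|lra].
      - left. apply Rinv_0_lt_compat, INR_fact_lt_0. }
    apply Rle_trans with (sum_n (fun n => Rpower (INR k + a) (- sg) * ((Rabs (L k) * r) ^ n / INR (fact n))) N).
    + right. apply sum_n_ext. intro n. unfold u. rewrite !Cmod_mult, Cmod_Cexp, fst_mult_RtoC.
      rewrite Cmod_pow, Cmod_opp, !Cmod_R, (Rabs_pos_eq (/ _)) by
        (left; apply Rinv_0_lt_compat, INR_fact_lt_0).
      rewrite Rpow_mult_distr. unfold Rpower, L. change (fst s0) with sg. unfold Rdiv.
      change (exp (- sg * ln (INR k + a)) * (Rabs (ln (INR k + a)) ^ n * / INR (fact n)) * r ^ n =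
       exp (- sg * ln (INR k + a)) * (Rabs (ln (INR k + a)) ^ n * r ^ n * / INR (fact n))). ring.
    + apply Rle_trans with (1 := sum_n_nonneg_le _ Hpos (ex_intro _ _ H) N).
      rewrite (is_series_unique _ _ H).
      (* The logarithm [L k] is negative when [k + a < 1]; bounding [exp |L k r|] by the sum of both
         exponentials covers either sign. *)
      replace (Rabs (L k) * r) with (Rabs (L k * r)) by (rewrite Rabs_mult, (Rabs_pos_eq r); lra).
      apply Rle_trans with (Rpower (INR k + a) (- sg) * (exp (L k * r) + exp (- (L k * r)))).
      * apply Rmult_le_compat_l; [left; apply Rpower_pos|apply exp_Rabs_le].
      * right. unfold Rpower, L. rewrite Rmult_plus_distr_l, <- !exp_plus. f_equal; f_equal; ring.
  - apply (ex_series_plus (fun k => Rpower (INR k + a) (- (sg - r)))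
      (fun k => Rpower (INR k + a) (- (sg + r)))); apply ex_series_power; unfold r; lra.
  - lra.
  - intro k. replace (- (s0 + (z - s0)) * L k)%C with (- s0 * L k + (z - s0) * (- L k))%C by ring.
    rewrite Cexp_plus.
    eapply is_Cseries_ext; [|apply is_Cseries_scal, Cexp_series].
    intro n. unfold u. cbv beta. rewrite Cpow_mult_l. ring.
Qed.

Lemma is_Cseries_RtoC (a : nat -> R) (l : R) : is_series a l -> is_Cseries (fun n => RtoC (a n)) (RtoC l).
Proof.
  intro H. apply is_Cseries_components. simpl. split; [exact H|].
  exact (proj2 (proj1 (is_Cseries_components _ _) is_Cseries_0)).
Qed.

Lemma dirichlet_real (a s : R) : 0 < a -> 1 < s -> dirichlet a (RtoC s) = RtoC (hz s a).
Proof.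
  intros Ha Hs. apply is_Cseries_unique.
  apply is_Cseries_ext with (fun k => RtoC (Rpower (INR k + a) (- s))).
  - intro k. rewrite <- RtoC_opp, <- RtoC_mult. unfold Cexp. simpl. rewrite cos_0, sin_0, Rmult_1_r, Rmult_0_r. reflexivity.
  - apply is_Cseries_RtoC, Series_correct, ex_series_power; assumption.
Qed.

(** With [xi w a] the sum of [e n * w^n] and [e 0 = 1], dividing by [w = s - 1] gives [1 / (s - 1)]
    plus the entire series [E]. This agrees with the Dirichlet series for real [s > 1], and the
    identity theorem extends the agreement to [Re s > 1]. *)
Lemma hurwitz_continuation (a : R) : 0 < a ->
  exists f : C -> C, is_hurwitz_zeta a f /\
    forall s : R, s <> 1 -> f (RtoC s) = RtoC (xi (s - 1) a / (s - 1)).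
Proof.
  intro Ha. destruct (xi_entire a Ha) as (e & He & Ee).
  assert (He0 : e 0%nat = 1).
  { assert (H := He 0). rewrite xi_0 in H by exact Ha.
    assert (H1 := is_series_unique _ _ H).
    rewrite <- H1. symmetry. rewrite Series_incr_1 by (eexists; exact H).
    rewrite (Series_ext _ (fun _ => 0 * 0)) by (intro n; simpl; ring).
    rewrite Series_scal_l. simpl. ring. }
  pose (E := fun s => CSeries (fun n => (s - 1) ^ n * RtoC (e (S n)))%C).
  assert (Eshift : forall r, 0 < r -> ex_series (fun n => Cmod (RtoC (e (S n))) * r ^ n)).
  { intros r Hr. assert (H := Ee r Hr). apply ex_series_incr_1 in H.
    apply (ex_series_scal_l (/ r)) in H. revert H.
    apply ex_series_ext. intro n. rewrite Cmod_R.
    change (/ r * (Rabs (e (S n)) * r ^ S n) = Rabs (e (S n)) * r ^ n). simpl. field. lra. }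
  exists (fun s => / (s - 1) + E s)%C.
  assert (Hreal : forall s : R, s <> 1 -> (/ (s - 1) + E (RtoC s))%C = RtoC (xi (s - 1) a / (s - 1))).
  { intros s Hs.
    assert (H : is_series (fun n => (s - 1) ^ n * e (S n)) ((xi (s - 1) a - 1) / (s - 1))).
    { assert (H := He (s - 1)).
      apply is_series_ext with (fun n => / (s - 1) * (e (S n) * (s - 1) ^ S n)).
      - intro n. simpl. field. lra.
      - replace ((xi (s - 1) a - 1) / (s - 1)) with (/ (s - 1) * (xi (s - 1) a - 1)) by (unfold Rdiv; ring).
        apply (is_series_scal_l (V := R_NormedModule) (/ (s - 1))).
        apply (is_series_incr_1 (fun n => e n * (s - 1) ^ n)).
        change (is_series (fun n => e n * (s - 1) ^ n) (xi (s - 1) a - 1 + e 0%nat * 1)).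
        rewrite He0. replace (xi (s - 1) a - 1 + 1 * 1) with (xi (s - 1) a) by ring. exact H. }
    replace (E (RtoC s)) with (RtoC ((xi (s - 1) a - 1) / (s - 1))).
    - rewrite <- RtoC_minus, <- RtoC_inv, <- RtoC_plus by lra. f_equal. field. lra.
    - symmetry. apply is_Cseries_unique.
      apply is_Cseries_ext with (2 := is_Cseries_RtoC _ _ H). intro n.
      now rewrite RtoC_mult, RtoC_pow, RtoC_minus. }
  assert (Han : forall s : C, s <> RtoC 1 -> analytic_at (fun s => / (s - 1) + E s)%C s).
  { intros s Hs. apply analytic_at_plus; [now apply analytic_at_inv|].
    apply (analytic_at_entire (fun n => RtoC (e (S n))) (RtoC 1) s Eshift). }
  split; [|exact Hreal]. split; [exact Han|].
  assert (Hagree : forall s : R, 1 < s -> (/ (s - 1) + E (RtoC s))%C = dirichlet a (RtoC s)).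
  { intros s Hs. rewrite Hreal, dirichlet_real by lra. f_equal. rewrite xi_hz by lra.
    replace (1 + (s - 1)) with s by ring. field. lra. }
  intros s Hs. assert (Hd := dirichlet_correct a s Ha Hs).
  replace (/ (s - 1) + E s)%C with (dirichlet a s); [exact Hd|].
  destruct (classic (RtoC 2 = s)) as [E2|E2].
  - rewrite <- E2. symmetry. apply Hagree. lra.
  - assert (Hz : ((/ (s - 1) + E s) + - dirichlet a s)%C = RtoC 0).
    { apply (identity_segment (fun s => (/ (s - 1) + E s) + - dirichlet a s)%C (RtoC 2) s E2).
      (* The half-plane [Re s > 1] is convex, so it contains the segment from 2 to [s]. *)
      - intros t Ht.
        assert (Hre : 1 < Re (seg (RtoC 2) s t)).
        { unfold seg, Re, Cplus, Cmult, Cminus, RtoC, Copp in *. simpl in *.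
          destruct (Req_dec t 0) as [->|]; [lra|]. unfold Re in Hs. nra. }
        apply analytic_at_plus.
        + apply Han. intro E1. rewrite E1 in Hre. unfold Re in Hre. simpl in Hre. lra.
        + now apply analytic_at_opp, dirichlet_analytic.
      - intros eps Heps. exists (RtoC (2 + eps / 2)). split; [|split].
        + intro E1. apply RtoC_inj in E1. lra.
        + rewrite <- RtoC_minus, Cmod_R, Rabs_pos_eq; lra.
        + rewrite Hagree by lra. ring. }
    replace (/ (s - 1) + E s)%C with ((/ (s - 1) + E s + - dirichlet a s) + dirichlet a s)%C by ring.
    rewrite Hz. ring.
Qed.

Lemma hurwitz_zeta_unique (a : R) (f h : C -> C) (s : R) :
  is_hurwitz_zeta a f -> is_hurwitz_zeta a h -> s <> 1 -> f (RtoC s) = h (RtoC s).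
Proof.
  intros [Hf1 Hf2] [Hh1 Hh2] Hs.
  assert (Heq : forall z : C, 1 < Re z -> f z = h z).
  { intros z Hz. rewrite <- (is_Cseries_unique _ _ (Hf2 z Hz)). apply is_Cseries_unique, Hh2, Hz. }
  assert (Hz : (f (RtoC s) + - h (RtoC s))%C = RtoC 0).
  (* The base point [2 + i] lies off the real axis, so the segment to any real [s <> 1] avoids the
     pole, also when [s < 1]. *)
  { apply (identity_segment (fun z => f z + - h z)%C (2, 1) (RtoC s)).
    - intro E. apply (f_equal snd) in E. simpl in E. lra.
    - intros t Ht.
      assert (Hne : seg (2, 1) (RtoC s) t <> RtoC 1).
      { unfold seg, Cplus, Cmult, Cminus, RtoC, Copp. simpl. intro E.
        assert (E1 := f_equal fst E). assert (E2 := f_equal snd E). simpl in E1, E2.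
        assert (t = 1) by lra. subst t. lra. }
      apply analytic_at_plus; [now apply Hf1|apply analytic_at_opp; now apply Hh1].
    - intros eps Heps. exists ((2 + eps / 2)%R, 1). split; [|split].
      + intro E. apply (f_equal fst) in E. simpl in E. lra.
      + replace (((2 + eps / 2)%R, 1) - (2, 1))%C with (RtoC (eps / 2)).
        * rewrite Cmod_R, Rabs_pos_eq; lra.
        * unfold Cminus, Cplus, Copp, RtoC. simpl. f_equal; ring.
      + rewrite Heq; [ring|]. simpl. lra. }
  replace (f (RtoC s)) with (f (RtoC s) + - h (RtoC s) + h (RtoC s))%C by ring. rewrite Hz. ring.
Qed.

(** Existence makes the [epsilon] choice satisfy the specification; uniqueness identifies it with
    the constructed continuation. *)
Lemma hurwitz_zeta_R_xi (s a : R) : 0 < a -> s <> 1 -> hurwitz_zeta_R s a = xi (s - 1) a / (s - 1).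
Proof.
  intros Ha Hs. destruct (hurwitz_continuation a Ha) as (f & Hf & Hfs).
  unfold hurwitz_zeta_R, hurwitz_zeta.
  rewrite (hurwitz_zeta_unique a _ f s); [|apply epsilon_spec; now exists f|exact Hf|exact Hs].
  rewrite Hfs by exact Hs. reflexivity.
Qed.

(** * The digamma function and the Bohr-Mollerup theorem *)

Lemma RInt_hz_window (s t : R) : 1 < s -> 0 < t ->
  RInt (hz s) t (t + 1) = Rpower t (1 - s) / (s - 1).
Proof.
  intros Hs Ht. rewrite <- (is_series_unique _ _ (is_series_RInt_power t s Ht Hs)).
  symmetry. apply is_series_unique.
  apply (is_series_RInt (fun k v => Rpower (INR k + v) (- s)) (fun k => Rpower (INR k + t / 2) (- s))
    (t / 2) (t + 2)); try lra.
  - intros k u Hu. apply Rpower_shift_cont. lra.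
  - intros k u Hu. apply hz_term_bound; lra.
  - apply ex_series_power; lra.
Qed.

(* The digamma function: this is [one_step] for [psi], whose derivative is [xi 1]
   and whose integral over [[t, t + 1]] is [ln t]. *)
Definition psi (t : R) : R := ln t - K (xi 1) t.

Lemma xi_1_pos (t : R) : 0 < t -> 0 < xi 1 t.
Proof. intro Ht. rewrite xi_hz by lra. rewrite Rmult_1_l. apply hz_pos; lra. Qed.

(** [xi 1] is the trigamma function [zeta (2, t)]. Its window integral is the derivative of [ln],
    which makes the non-[xi] terms cancel in the derivative of [psi]. *)
Lemma RInt_xi_1_window (t : R) : 0 < t -> RInt (xi 1) t (t + 1) = / t.
Proof.
  intro Ht. transitivity (RInt (hz (1 + 1)) t (t + 1)).
  - apply RInt_ext. intros v Hv. rewrite Rmin_left, Rmax_right in Hv by lra.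
    rewrite xi_hz by lra. apply Rmult_1_l.
  - rewrite RInt_hz_window by lra. replace (1 - (1 + 1)) with (- (1)) by ring.
    rewrite Rpower_Ropp, Rpower_1 by exact Ht.
    replace (1 + 1 - 1) with 1 by ring. apply Rdiv_1_r.
Qed.

Lemma is_derive_psi (t : R) : 0 < t -> is_derive psi t (xi 1 t).
Proof.
  intro Ht. replace (xi 1 t) with (/ t - (RInt (xi 1) t (t + 1) - xi 1 t)).
  - apply (is_derive_minus ln); [now apply is_derive_ln|].
    apply is_derive_K; [apply xi_cont|exact Ht].
  - rewrite RInt_xi_1_window by exact Ht. ring.
Qed.

Lemma psi_cont : cont_pos psi.
Proof. intros t Ht. eapply is_derive_continuous. now apply is_derive_psi. Qed.

Lemma RInt_psi_window (t : R) : 0 < t -> RInt psi t (t + 1) = ln t.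
Proof.
  intro Ht. assert (H := one_step psi (xi 1) t is_derive_psi (xi_cont 1) Ht).
  unfold psi at 1 in H. lra.
Qed.

Lemma MVT_pos (f f' : R -> R) (a b : R) :
  (forall v, 0 < v -> is_derive f v (f' v)) -> 0 < a -> a < b ->
  exists c, a < c < b /\ f b - f a = f' c * (b - a).
Proof.
  intros Hd Ha Hab. destruct (MVT_cor2 f f' a b Hab) as (c & E & Hc).
  - intros c Hc. apply is_derive_Reals, Hd. lra.
  - now exists c.
Qed.

Lemma psi_increasing (x y : R) : 0 < x -> x < y -> psi x < psi y.
Proof.
  intros Hx Hxy. destruct (MVT_pos psi (xi 1) x y is_derive_psi Hx Hxy) as (c & Hc & E).
  assert (H := xi_1_pos c ltac:(lra)). nra.
Qed.

Lemma psi_succ (t : R) : 0 < t -> psi (t + 1) = psi t + / t.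
Proof.
  intro Ht. rewrite <- RInt_xi_1_window by exact Ht.
  assert (H : is_RInt (xi 1) t (t + 1) (minus (psi (t + 1)) (psi t))).
  { apply (is_RInt_derive (V := R_CompleteNormedModule)); intros v Hv;
      rewrite Rmin_left, Rmax_right in Hv by lra; [apply is_derive_psi|apply xi_cont]; lra. }
  rewrite (is_RInt_unique _ _ _ _ H). change (psi (t + 1) = psi t + (psi (t + 1) - psi t)). ring.
Qed.

(** Three-slope convexity with denominators cleared. It requires no derivative, so logarithms of
    parameter integrals can be tested for it. *)
Definition slope_convex (f : R -> R) : Prop :=
  forall a b c, 0 < a -> a < b -> b < c -> (f b - f a) * (c - b) <= (f c - f b) * (b - a).

Lemma slope_convex_derive (f f' : R -> R) :
  (forall v, 0 < v -> is_derive f v (f' v)) -> (forall x y, 0 < x -> x < y -> f' x < f' y) ->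
  slope_convex f.
Proof.
  intros Hd Hi a b c Ha Hab Hbc.
  destruct (MVT_pos f f' a b Hd Ha Hab) as (u & Hu & Eu).
  destruct (MVT_pos f f' b c Hd ltac:(lra) Hbc) as (w & Hw & Ew).
  rewrite Eu, Ew. assert (H := Hi u w ltac:(lra) ltac:(lra)).
  assert (0 < (b - a) * (c - b)) by (apply Rmult_lt_0_compat; lra). nra.
Qed.

Definition log_gamma_like (f : R -> R) : Prop :=
  slope_convex f /\ f 1 = 0 /\ forall x, 0 < x -> f (x + 1) = f x + ln x.

Lemma log_gamma_like_nat (f g : R -> R) (n : nat) :
  log_gamma_like f -> log_gamma_like g -> f (INR (S n)) = g (INR (S n)).
Proof.
  intros (_ & Hf1 & Hf) (_ & Hg1 & Hg). induction n as [|n IH].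
  - simpl. now rewrite Hf1, Hg1.
  - rewrite S_INR. rewrite Hf, Hg, IH; [reflexivity| |];
      apply lt_0_INR; lia.
Qed.

(* Convexity confines [f (n + x) - f n] to the interval [x ln (n - 1), x ln n]. *)
Lemma log_gamma_like_sandwich (f : R -> R) (n : nat) (x : R) :
  log_gamma_like f -> 0 < x <= 1 ->
  x * ln (INR (S n)) <= f (INR (S (S n)) + x) - f (INR (S (S n))) <= x * ln (INR (S (S n))).
Proof.
  intros (Hc & _ & Hf) Hx.
  assert (Hn : 0 < INR (S n)) by (apply lt_0_INR; lia).
  assert (E1 : INR (S (S n)) = INR (S n) + 1) by apply S_INR.
  assert (Ef1 := Hf (INR (S n)) Hn). rewrite <- E1 in Ef1.
  assert (Ef2 := Hf (INR (S (S n))) ltac:(lra)).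
  set (N := INR (S (S n))) in *. split.
  - assert (H := Hc (INR (S n)) N (N + x) Hn ltac:(lra) ltac:(lra)).
    replace (N + x - N) with x in H by ring. replace (N - INR (S n)) with 1 in H by lra.
    rewrite Ef1 in H. lra.
  - destruct (Req_dec x 1) as [->|Hx1]; [lra|].
    assert (H := Hc N (N + x) (N + 1) ltac:(lra) ltac:(lra) ltac:(lra)).
    replace (N + x - N) with x in H by ring. replace (N + 1 - (N + x)) with (1 - x) in H by ring.
    rewrite Ef2 in H. lra.
Qed.

Lemma ln_le_sub_1 (y : R) : 0 < y -> ln y <= y - 1.
Proof.
  intro Hy. assert (H := exp_ineq1_le (ln y)). rewrite exp_ln in H by exact Hy. lra.
Qed.

Lemma ln_succ_sub (y : R) : 0 < y -> ln (y + 1) - ln y <= / y.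
Proof.
  intro Hy. rewrite <- ln_div by lra. assert (Hq : 0 < (y + 1) / y) by (apply Rdiv_lt_0_compat; lra).
  apply Rle_trans with (1 := ln_le_sub_1 _ Hq).
  right. field. lra.
Qed.

Lemma eq_0_of_le_inv_nat (d : R) : (forall n, Rabs d <= / INR (S n)) -> d = 0.
Proof.
  intro H. destruct (Req_dec d 0) as [E|E]; [exact E|exfalso].
  assert (Hd := Rabs_pos_lt d E).
  destruct (INR_unbounded (/ Rabs d)) as [n Hn]. specialize (H n). rewrite S_INR in H.
  assert (Hi := Rinv_0_lt_compat _ Hd).
  assert (/ (INR n + 1) < Rabs d); [|lra].
  rewrite <- (Rinv_inv (Rabs d)). apply Rinv_lt_contravar; [|lra]. apply Rmult_lt_0_compat; lra.
Qed.

(** The difference [f - g] is 1-periodic and vanishes at positive integers. For [0 < x <= 1] both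
    functions lie in the same sandwich at [n + 2], of width at most
    [ln (n + 2) - ln (n + 1) <= 1 / (n + 1)]. *)
Theorem bohr_mollerup (f g : R -> R) (x : R) :
  log_gamma_like f -> log_gamma_like g -> 0 < x -> f x = g x.
Proof.
  intros Hf Hg.
  assert (Hper : forall x n, 0 < x -> f (INR n + x) - g (INR n + x) = f x - g x).
  { intros y n Hy. induction n as [|n IH]; [simpl; now rewrite Rplus_0_l|].
    assert (Hn := pos_INR n). rewrite S_INR. replace (INR n + 1 + y) with (INR n + y + 1) by ring.
    rewrite (proj2 (proj2 Hf)), (proj2 (proj2 Hg)) by lra. lra. }
  assert (Hunit : forall x, 0 < x <= 1 -> f x - g x = 0).
  { intros y Hy. apply eq_0_of_le_inv_nat. intro n.
    assert (H1 := log_gamma_like_sandwich f n y Hf Hy). assert (H2 := log_gamma_like_sandwich g n y Hg Hy).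
    rewrite (log_gamma_like_nat f g (S n) Hf Hg) in H1. rewrite <- (Hper y (S (S n))) by lra.
    assert (Hn : 0 < INR (S n)) by (apply lt_0_INR; lia).
    assert (H3 := ln_succ_sub (INR (S n)) Hn). rewrite <- S_INR in H3.
    apply Rabs_le_between. nra. }
  intro Hx.
  assert (H : forall n x, 0 < x <= INR n + 1 -> f x - g x = 0).
  { induction n as [|n IH]; intros y Hy.
    - apply Hunit. simpl in Hy. lra.
    - rewrite S_INR in Hy. destruct (Rle_dec y 1) as [H|H]; [apply Hunit; lra|].
      rewrite <- (IH (y - 1)) by lra. rewrite <- (Hper (y - 1) 1%nat) by lra.
      simpl. f_equal; f_equal; ring. }
  destruct (INR_unbounded x) as [n Hn]. specialize (H n x). lra.
Qed.

(** The logarithm of Gamma, built from [psi] so that its derivative and convexity are known before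
    it is compared with Euler's integral. *)
Definition lnG (x : R) : R := RInt psi 1 x.

Lemma is_derive_lnG (x : R) : 0 < x -> is_derive lnG x (psi x).
Proof. intro Hx. apply is_derive_RInt_pos; [apply psi_cont|lra|exact Hx]. Qed.

Lemma lnG_like : log_gamma_like lnG.
Proof.
  split; [|split].
  - exact (slope_convex_derive lnG psi is_derive_lnG psi_increasing).
  - apply (RInt_point (V := R_CompleteNormedModule)).
  - intros x Hx. rewrite <- RInt_psi_window by exact Hx.
    assert (H := RInt_Chasles_pos psi 1 x (x + 1) psi_cont Rlt_0_1 Hx ltac:(lra)).
    unfold lnG. lra.
Qed.

(** The improper integral over the half-line, encoded by one primitive vanishing at 0+: linearity,
    comparison and uniqueness become statements on limits of a function. [is_IInt_RInt_gen]
    translates back to [RInt_gen]. *)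
Definition is_IInt (f : R -> R) (l : R) : Prop :=
  exists F : R -> R, (forall v, 0 < v -> is_derive F v (f v)) /\
    filterlim F (at_right 0) (locally 0) /\ filterlim F (Rbar_locally p_infty) (locally l).

Lemma at_right_0_intro (P : R -> Prop) (d : R) :
  0 < d -> (forall v, 0 < v < d -> P v) -> at_right 0 P.
Proof.
  intros Hd H. exists (mkposreal d Hd). intros y Hy Hy0. change (Rabs (y - 0) < d) in Hy.
  rewrite Rminus_0_r, Rabs_pos_eq in Hy by lra. apply H. lra.
Qed.

Lemma at_right_0_pos : at_right 0 (fun v => 0 < v).
Proof. apply at_right_0_intro with 1; [lra|]. intros v Hv. apply Hv. Qed.

Lemma increasing_pos (F f : R -> R) :
  (forall v, 0 < v -> is_derive F v (f v)) -> (forall v, 0 < v -> 0 <= f v) ->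
  forall a b, 0 < a <= b -> F a <= F b.
Proof.
  intros Hd Hf a b Hab. destruct (Req_dec a b) as [->|E]; [lra|].
  destruct (MVT_pos F f a b Hd ltac:(lra) ltac:(lra)) as (c & Hc & Ec).
  assert (H := Hf c ltac:(lra)). nra.
Qed.

Lemma primitive_nonneg (F f : R -> R) :
  (forall v, 0 < v -> is_derive F v (f v)) -> (forall v, 0 < v -> 0 <= f v) ->
  filterlim F (at_right 0) (locally 0) -> forall v, 0 < v -> 0 <= F v.
Proof.
  intros Hd Hf H0 v Hv. apply (filterlim_le (F := at_right 0) F (fun _ => F v) 0 (F v)).
  - apply at_right_0_intro with v; [exact Hv|]. intros u Hu. apply (increasing_pos F f Hd Hf). lra.
  - exact H0.
  - apply filterlim_const.
Qed.

Lemma filterlim_lin {T : Type} (F : (T -> Prop) -> Prop) {FF : Filter F} (a b : R) (f g : T -> R) (l m : R) :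
  filterlim f F (locally l) -> filterlim g F (locally m) ->
  filterlim (fun x => a * f x + b * g x) F (locally (a * l + b * m)).
Proof.
  intros Hf Hg.
  assert (H : forall c k u, filterlim k F (locally u) -> filterlim (fun x : T => c * k x) F (locally (c * u))).
  { intros c k u Hk. apply filterlim_comp with (1 := Hk).
    apply (filterlim_scal_r c u). }
  apply (filterlim_comp_2 (fun x => a * f x) (fun x => b * g x) Rplus
    (H a f l Hf) (H b g m Hg)), (filterlim_plus (a * l) (b * m)).
Qed.

Lemma is_derive_lin (a b : R) (f g : R -> R) (x l m : R) :
  is_derive f x l -> is_derive g x m -> is_derive (fun x => a * f x + b * g x) x (a * l + b * m).
Proof.
  intros Hf Hg. apply (is_derive_plus (V := R_NormedModule)); now apply is_derive_scal.
Qed.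

Lemma is_IInt_lin (a b : R) (f g : R -> R) (l m : R) :
  is_IInt f l -> is_IInt g m -> is_IInt (fun v => a * f v + b * g v) (a * l + b * m).
Proof.
  intros (F & F1 & F2 & F3) (G & G1 & G2 & G3). exists (fun v => a * F v + b * G v).
  split; [|split].
  - intros v Hv. apply is_derive_lin; auto.
  - assert (H := filterlim_lin (at_right 0) a b F G 0 0 F2 G2).
    replace (a * 0 + b * 0) with 0 in H by ring. exact H.
  - exact (filterlim_lin (Rbar_locally p_infty) a b F G l m F3 G3).
Qed.

Lemma is_IInt_ext (f g : R -> R) (l : R) :
  (forall v, 0 < v -> f v = g v) -> is_IInt f l -> is_IInt g l.
Proof.
  intros H (F & F1 & F2 & F3). exists F. split; [|now split].
  intros v Hv. rewrite <- H by exact Hv. auto.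
Qed.

Lemma is_IInt_nonneg (f : R -> R) (l : R) : (forall v, 0 < v -> 0 <= f v) -> is_IInt f l -> 0 <= l.
Proof.
  intros Hf (F & F1 & F2 & F3).
  apply (filterlim_le (F := Rbar_locally p_infty) (fun _ => 0) F 0 l).
  - exists 0. intros v Hv. exact (primitive_nonneg F f F1 Hf F2 v Hv).
  - apply filterlim_const.
  - exact F3.
Qed.

Lemma is_IInt_le (f g : R -> R) (l m : R) :
  (forall v, 0 < v -> f v <= g v) -> is_IInt f l -> is_IInt g m -> l <= m.
Proof.
  intros H Hf Hg. assert (0 <= 1 * m + (-1) * l); [|lra].
  apply (is_IInt_nonneg (fun v => 1 * g v + (-1) * f v)).
  - intros v Hv. specialize (H v Hv). lra.
  - now apply is_IInt_lin.
Qed.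

Lemma is_IInt_unique (f : R -> R) (l m : R) : is_IInt f l -> is_IInt f m -> l = m.
Proof.
  intros Hl Hm. apply Rle_antisym; eapply is_IInt_le; try eassumption; intros; lra.
Qed.

Lemma is_IInt_pos (f : R -> R) (l : R) : (forall v, 0 < v -> 0 < f v) -> is_IInt f l -> 0 < l.
Proof.
  intros Hf (F & F1 & F2 & F3).
  assert (Hf' : forall v, 0 < v -> 0 <= f v) by (intros; left; auto).
  assert (H1 := primitive_nonneg F f F1 Hf' F2 1 Rlt_0_1).
  destruct (MVT_pos F f 1 2 F1) as (c & Hc & E); try lra. assert (Hfc := Hf c ltac:(lra)).
  assert (F 2 <= l); [|nra].
  apply (filterlim_le (F := Rbar_locally p_infty) (fun _ => F 2) F (F 2) l).
  - exists 2. intros v Hv. apply (increasing_pos F f F1 Hf'). lra.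
  - apply filterlim_const.
  - exact F3.
Qed.

Lemma is_IInt_RInt_gen (f : R -> R) (l : R) :
  cont_pos f -> is_IInt f l -> RInt_gen f (at_right 0) (Rbar_locally p_infty) = l.
Proof.
  intros Hc (F & F1 & F2 & F3).
  apply is_RInt_gen_unique.
  assert (Hpos : filter_prod (at_right 0) (Rbar_locally p_infty) (fun ab => 0 < Rmin (fst ab) (snd ab))).
  { apply Filter_prod with (fun a => 0 < a) (fun b => 0 < b).
    - apply at_right_0_pos.
    - exists 0. auto.
    - intros a b Ha Hb. now apply Rmin_glb_lt. }
  apply (is_RInt_gen_ext (Derive F)).
  - revert Hpos. apply filter_imp. intros ab H x Hx. apply is_derive_unique, F1. lra.
  - rewrite <- (Rminus_0_r l). apply (is_RInt_gen_Derive F 0 l); [| |exact F2|exact F3].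
    + revert Hpos. apply filter_imp. intros ab H x Hx. eexists. apply F1. lra.
    + revert Hpos. apply filter_imp. intros ab H x Hx.
      apply continuous_ext_loc with f; [|apply Hc; lra].
      assert (Hx0 : 0 < x) by lra.
      generalize (open_gt 0 x Hx0). apply filter_imp. intros y Hy. symmetry. apply is_derive_unique, F1, Hy.
Qed.

(** The tangent of [exp] at the mean [z] lies below the curve; averaging it at [a] and [b] cancels
    the linear part. *)
Lemma young (a b lam : R) : 0 <= lam <= 1 ->
  exp (lam * a + (1 - lam) * b) <= lam * exp a + (1 - lam) * exp b.
Proof.
  intro Hl. set (z := lam * a + (1 - lam) * b).
  assert (H : forall x, exp z * (1 + (x - z)) <= exp x).
  { intro x. replace (exp x) with (exp z * exp (x - z)) by (rewrite <- exp_plus; f_equal; ring).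
    apply Rmult_le_compat_l; [left; apply exp_pos|apply exp_ineq1_le]. }
  assert (Ha := H a). assert (Hb := H b).
  apply Rle_trans with (lam * (exp z * (1 + (a - z))) + (1 - lam) * (exp z * (1 + (b - z)))).
  - right. unfold z. ring.
  - apply Rplus_le_compat; apply Rmult_le_compat_l; lra.
Qed.

(* Hoelder's inequality, from Young's inequality for the normalised integrands. *)
Lemma is_IInt_log_convex (F : R -> R -> R) (I : R -> R) :
  (forall p v, 0 < p -> 0 < v -> 0 < F p v) -> (forall p, 0 < p -> is_IInt (F p) (I p)) ->
  (forall v, 0 < v -> exists A B, forall p, 0 < p -> ln (F p v) = A * p + B) ->
  slope_convex (fun p => ln (I p)).
Proof.
  intros Hpos HI Haff a b c Ha Hab Hbc.
  assert (HIp : forall p, 0 < p -> 0 < I p).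
  { intros p Hp. apply (is_IInt_pos (F p)); auto. }
  set (lam := (c - b) / (c - a)).
  assert (Hlam : 0 <= lam <= 1).
  { unfold lam. split.
    - apply Rmult_le_pos; [lra|left; apply Rinv_0_lt_compat; lra].
    - apply Rmult_le_reg_r with (c - a); [lra|]. unfold Rdiv. rewrite Rmult_assoc, Rinv_l by lra. lra. }
  assert (Eb : b = lam * a + (1 - lam) * c) by (unfold lam; field; lra).
  (* [M] is the weighted geometric mean of [I a] and [I c]. Since [ln (F p v)] is affine in [p], the
     integrand at [b] is the same geometric mean of those at [a] and [c]. *)
  set (M := exp (lam * ln (I a) + (1 - lam) * ln (I c))).
  assert (HM : 0 < M) by apply exp_pos.
  assert (Hle : / M * I b + 0 * I b <= (lam / I a) * I a + ((1 - lam) / I c) * I c).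
  { apply (is_IInt_le (fun v => / M * F b v + 0 * F b v)
      (fun v => (lam / I a) * F a v + ((1 - lam) / I c) * F c v)).
    - intros v Hv.
      assert (H := young (ln (F a v) - ln (I a)) (ln (F c v) - ln (I c)) lam Hlam).
      unfold Rminus in H. rewrite !(exp_plus (ln _)), !exp_Ropp, !exp_ln in H by (apply Hpos || apply HIp; lra).
      replace (lam / I a * F a v + (1 - lam) / I c * F c v) with
        (lam * (F a v * / I a) + (1 - lam) * (F c v * / I c)) by (unfold Rdiv; ring).
      apply Rle_trans with (2 := H).
      right. rewrite Rmult_0_l, Rplus_0_r.
      replace (/ M * F b v) with (exp (- (lam * ln (I a) + (1 - lam) * ln (I c)) + ln (F b v))).
      2: { rewrite exp_plus, exp_Ropp, exp_ln by (apply Hpos; lra). reflexivity. }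
      f_equal. destruct (Haff v Hv) as (A & B & HAB). rewrite !HAB by lra. rewrite Eb. ring.
    - apply is_IInt_lin; apply HI; lra.
    - apply is_IInt_lin; apply HI; lra. }
  assert (HIa := HIp a Ha). assert (HIb := HIp b ltac:(lra)). assert (HIc := HIp c ltac:(lra)).
  replace (lam / I a * I a + (1 - lam) / I c * I c) with 1 in Hle by (field; lra).
  rewrite Rmult_0_l, Rplus_0_r in Hle.
  assert (HbM : I b <= M).
  { apply Rmult_le_reg_l with (/ M); [now apply Rinv_0_lt_compat|]. rewrite Rinv_l; lra. }
  apply ln_le in HbM; [|exact HIb]. unfold M in HbM. rewrite ln_exp in HbM.
  assert (Hc := Rmult_le_compat_r (c - a) _ _ ltac:(lra) HbM).
  replace ((lam * ln (I a) + (1 - lam) * ln (I c)) * (c - a)) with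
    ((c - b) * ln (I a) + (b - a) * ln (I c)) in Hc by (unfold lam; field; lra).
  lra.
Qed.

(** * Gamma and beta integrals *)

(** A primitive of [v^(p-1)] for every [p], including the logarithmic case, so that convergent and
    regularised integrals share one treatment. *)
Definition Hp (p v : R) : R := if Req_EM_T p 0 then ln v else Rpower v p / p.

Lemma is_derive_Hp (p v : R) : 0 < v -> is_derive (Hp p) v (Rpower v (p - 1)).
Proof.
  intro Hv. unfold Hp. destruct (Req_EM_T p 0) as [->|Hp0].
  - replace (Rpower v (0 - 1)) with (/ v).
    + now apply is_derive_ln.
    + replace (0 - 1) with (- (1)) by ring. now rewrite Rpower_Ropp, Rpower_1.
  - replace (Rpower v (p - 1)) with (p * Rpower v (p - 1) * / p) by (field; exact Hp0).
    apply (is_derive_mult_const (fun v => Rpower v p)). now apply is_derive_Rpower.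
Qed.

(* [F] is the antiderivative of [v^(p-1) k v], [k 0 = 1], normalised at [0+] against
   that of [v^(p-1)]; then [l] is the (for [p = 0], regularised) integral over
   the half-line. *)
Definition is_mellin (p D : R) (k F : R -> R) (l : R) : Prop :=
  (forall v, 0 < v -> is_derive F v (Rpower v (p - 1) * k v)) /\
  (forall v, 0 < v -> Rabs (F v - Hp p v) <= D * Rpower v (p + 1)) /\
  filterlim F (Rbar_locally p_infty) (locally l).

Lemma increasing_limit_infty (F : R -> R) (B : R) :
  (forall a b, 0 < a <= b -> F a <= F b) -> (forall v, 1 <= v -> F v <= B) ->
  exists l, filterlim F (Rbar_locally p_infty) (locally l).
Proof.
  intros Hi HB.
  destruct (completeness (fun y => exists v, 1 <= v /\ y = F v)) as [l [H1 H2]].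
  - exists B. intros y (v & Hv & ->). auto.
  - exists (F 1), 1. split; [lra|reflexivity].
  - exists l. apply (filterlim_R (Rbar_locally p_infty)). intros eps Heps.
    destruct (classic (exists v, 1 <= v /\ l - eps < F v)) as [(v & Hv & HF)|Hn].
    + exists v. intros w Hw. assert (G1 : F w <= l) by (apply H1; exists w; split; [lra|reflexivity]).
      assert (G2 := Hi v w ltac:(lra)). apply Rabs_lt_between. lra.
    + exfalso. assert (l <= l - eps); [|lra]. apply H2. intros y (v & Hv & ->).
      apply Rnot_lt_le. intro H. apply Hn. now exists v.
Qed.

(** Compare the primitive [F0] based at 1 with [Hp p]. The difference [D] decreases because
    [k <= 1], and [D + G] increases because [1 - k v <= C v]; so [D] has a limit [c] at 0+, and
    [F0 - c] is the normalised primitive with error at most [G]. *)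
Lemma mellin_exists (p C C' q : R) (k : R -> R) :
  0 <= p -> 0 <= C -> 0 < q -> cont_pos k ->
  (forall v, 0 < v -> 0 <= k v <= 1 /\ 1 - C * v <= k v) ->
  (forall v, 1 <= v -> Rpower v (p - 1) * k v <= C' * Rpower v (- q - 1)) ->
  exists F l, is_mellin p (C / (p + 1)) k F l.
Proof.
  intros Hp0 HC Hq Hk Hkb Htail.
  pose (f := fun v => Rpower v (p - 1) * k v).
  assert (Hf : cont_pos f).
  { intros v Hv. apply continuous_mult_R; [now apply Rpower_cont_pos|now apply Hk]. }
  assert (Hf0 : forall v, 0 < v -> 0 <= f v).
  { intros v Hv. apply Rmult_le_pos; [left; apply Rpower_pos|apply Hkb, Hv]. }
  pose (F0 := RInt f 1).
  assert (HF0 : forall v, 0 < v -> is_derive F0 v (f v)).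
  { intros v Hv. apply is_derive_RInt_pos; [exact Hf|lra|exact Hv]. }
  pose (D := fun v => F0 v - Hp p v).
  assert (HD : forall v, 0 < v -> is_derive D v (f v - Rpower v (p - 1))).
  { intros v Hv. apply (is_derive_minus F0); [auto|now apply is_derive_Hp]. }
  pose (G := fun v => Rpower v (p + 1) * (C / (p + 1))).
  assert (HG : forall v, 0 < v -> is_derive G v (C * Rpower v p)).
  { intros v Hv. replace (C * Rpower v p) with ((p + 1) * Rpower v (p + 1 - 1) * (C / (p + 1))).
    - apply (is_derive_mult_const (fun v => Rpower v (p + 1))). now apply is_derive_Rpower.
    - replace (p + 1 - 1) with p by ring. field. lra. }
  assert (HGpos : forall v, 0 <= G v).
  { intro v. apply Rmult_le_pos; [left; apply Rpower_pos|].
    apply Rmult_le_pos; [exact HC|left; apply Rinv_0_lt_compat; lra]. }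
  assert (Hdec : forall a b, 0 < a <= b -> D b <= D a).
  { intros a b Hab. assert (- D a <= - D b); [|lra].
    apply (increasing_pos (fun v => - D v) (fun v => - (f v - Rpower v (p - 1)))); [| |exact Hab].
    - intros v Hv. apply (is_derive_opp (V := R_NormedModule)). auto.
    - intros v Hv. unfold f. assert (H := Hkb v Hv). assert (H1 := Rpower_pos v (p - 1)). nra. }
  assert (Hinc : forall a b, 0 < a <= b -> D a + G a <= D b + G b).
  { apply (increasing_pos (fun v => D v + G v) (fun v => f v - Rpower v (p - 1) + C * Rpower v p)).
    - intros v Hv. apply (is_derive_plus (V := R_NormedModule)); auto.
    - intros v Hv. unfold f. assert (H := Hkb v Hv). assert (H1 := Rpower_pos v (p - 1)).
      replace (Rpower v p) with (Rpower v (p - 1) * v).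
      + nra.
      + rewrite <- (Rpower_1 v Hv) at 2. rewrite <- Rpower_plus. f_equal. ring. }
  (* Valid in either order of [u] and [v]; hence the supremum [c] of [D] lies between [D v] and
     [D v + G v]. *)
  assert (Hle : forall u v, 0 < u -> 0 < v -> D u <= D v + G v).
  { intros u v Hu Hv. destruct (Rle_dec u v) as [H|H].
    - assert (H1 := Hinc u v ltac:(lra)). assert (H2 := HGpos u). lra.
    - assert (H1 := Hdec v u ltac:(lra)). assert (H2 := HGpos v). lra. }
  destruct (completeness (fun y => exists u, 0 < u /\ y = D u)) as [c [Hc1 Hc2]].
  { exists (D 1 + G 1). intros y (u & Hu & ->). apply Hle; lra. }
  { exists (D 1), 1. split; [lra|reflexivity]. }
  destruct (increasing_limit_infty F0 (F0 1 + C' / q)) as [l Hl].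
  { apply (increasing_pos F0 f HF0 Hf0). }
  { intros v Hv.
    assert (HC' : 0 <= C').
    { assert (H := Htail 1 (Rle_refl 1)). assert (H0 := Hf0 1 Rlt_0_1). unfold f in H0.
      assert (H1 := Rpower_pos 1 (- q - 1)). nra. }
    (* By the tail bound, [F0 + (C' / q) w^(-q)] has nonpositive derivative for [w >= 1], which
       bounds [F0] there. *)
    assert (HT : forall w, 0 < w -> is_derive (fun w => F0 w + Rpower w (- q) * (C' / q)) w
       (f w + - q * Rpower w (- q - 1) * (C' / q))).
    { intros w Hw. apply (is_derive_plus (V := R_NormedModule)); [auto|].
      apply (is_derive_mult_const (fun v => Rpower v (- q))). now apply is_derive_Rpower. }
    destruct (Req_dec v 1) as [->|Hv1].
    - assert (0 <= C' / q); [|lra]. apply Rmult_le_pos; [exact HC'|left; now apply Rinv_0_lt_compat].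
    - destruct (MVT_pos _ _ 1 v HT Rlt_0_1) as (w & Hw & E); [lra|].
      replace (f w + - q * Rpower w (- q - 1) * (C' / q)) with (f w - C' * Rpower w (- q - 1)) in E by (field; lra).
      assert (H := Htail w ltac:(lra)). fold (f w) in H.
      assert (E1 : Rpower 1 (- q) = 1) by (unfold Rpower; rewrite ln_1, Rmult_0_r; apply exp_0).
      rewrite E1 in E.
      assert (H2 : 0 <= Rpower v (- q) * (C' / q)).
      { apply Rmult_le_pos; [left; apply Rpower_pos|].
        apply Rmult_le_pos; [exact HC'|left; now apply Rinv_0_lt_compat]. }
      nra. }
  exists (fun v => F0 v - c), (l - c). split; [|split].
  - intros v Hv. rewrite <- (Rminus_0_r (_ * _)).
    apply (is_derive_minus F0 (fun _ => c)); [now apply HF0|].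
    apply (is_derive_const (V := R_NormedModule)).
  - intros v Hv. assert (H1 : D v <= c) by (apply Hc1; now exists v).
    assert (H2 : c <= D v + G v) by (apply Hc2; intros y (u & Hu & ->); now apply Hle).
    unfold D, G in *. apply Rabs_le_between. lra.
  - assert (H := filterlim_lin (Rbar_locally p_infty) 1 (-1) F0 (fun _ => c) l c Hl (filterlim_const c)).
    replace (l - c) with (1 * l + -1 * c) by ring.
    apply filterlim_ext with (2 := H). intro v. ring.
Qed.

Lemma Rpower_lim_at_0 (p : R) : 0 < p -> filterlim (fun v => Rpower v p) (at_right 0) (locally 0).
Proof.
  intro Hp0. apply (filterlim_R (at_right 0)). intros eps Heps.
  apply at_right_0_intro with (Rpower eps (/ p)); [apply Rpower_pos|].
  intros v Hv. rewrite Rminus_0_r, Rabs_pos_eq by (left; apply Rpower_pos).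
  replace eps with (Rpower (Rpower eps (/ p)) p).
  - now apply Rlt_Rpower_l.
  - rewrite Rpower_mult. replace (/ p * p) with 1 by (field; lra). now apply Rpower_1.
Qed.

Lemma Rpower_lim_infty (q : R) : 0 < q ->
  filterlim (fun v => Rpower v (- q)) (Rbar_locally p_infty) (locally 0).
Proof.
  intro Hq. apply (filterlim_R (Rbar_locally p_infty)). intros eps Heps.
  exists (Rpower eps (- / q)). intros v Hv. assert (H := Rpower_pos eps (- / q)).
  rewrite Rminus_0_r, Rabs_pos_eq by (left; apply Rpower_pos).
  replace eps with (Rpower (Rpower eps (- / q)) (- q)).
  - rewrite !(Rpower_Ropp _ q). apply Rinv_lt_contravar; [apply Rmult_lt_0_compat; apply Rpower_pos|].
    apply Rlt_Rpower_l; lra.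
  - rewrite Rpower_mult. replace (- / q * - q) with 1 by (field; lra). now apply Rpower_1.
Qed.

Lemma filterlim_squeeze_0 {T : Type} (F : (T -> Prop) -> Prop) {FF : Filter F} (f g : T -> R) :
  F (fun x => Rabs (f x) <= g x) -> filterlim g F (locally 0) -> filterlim f F (locally 0).
Proof.
  intros Hfg Hg. apply (filterlim_R F). intros eps Heps. rewrite (filterlim_R F) in Hg.
  generalize (filter_and _ _ Hfg (Hg eps Heps)). apply filter_imp. intros x [H1 H2].
  rewrite Rminus_0_r in *. apply Rle_lt_trans with (1 := H1). apply Rle_lt_trans with (1 := Rle_abs _). exact H2.
Qed.

(** For [p > 0] the comparison function [v^p / p] itself tends to 0, so the normalisation is the
    ordinary one. *)
Lemma is_mellin_IInt (p D : R) (k F : R -> R) (l : R) : 0 < p ->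
  is_mellin p D k F l -> is_IInt (fun v => Rpower v (p - 1) * k v) l.
Proof.
  intros Hp0 (H1 & H2 & H3). exists F. split; [exact H1|split; [|exact H3]].
  apply (filterlim_squeeze_0 (at_right 0) F (fun v => / p * Rpower v p + D * Rpower v (p + 1))).
  - generalize at_right_0_pos. apply filter_imp. intros v Hv.
    assert (H := H2 v Hv). unfold Hp in H. destruct (Req_EM_T p 0); [lra|].
    replace (F v) with (Rpower v p / p + (F v - Rpower v p / p)) by ring.
    apply Rle_trans with (1 := Rabs_triang _ _). apply Rplus_le_compat; [|exact H].
    rewrite Rabs_pos_eq; [right; unfold Rdiv; ring|].
    apply Rmult_le_pos; [left; apply Rpower_pos|left; now apply Rinv_0_lt_compat].
  - assert (H := filterlim_lin (at_right 0) (/ p) D _ _ 0 0 (Rpower_lim_at_0 p Hp0)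
      (Rpower_lim_at_0 (p + 1) ltac:(lra))).
    replace (/ p * 0 + D * 0) with 0 in H by ring. exact H.
Qed.

Lemma Rpower_le_exp (c v : R) : 0 < c -> 0 < v -> Rpower v c <= Rpower c c * exp v.
Proof.
  intros Hc Hv. unfold Rpower. rewrite <- exp_plus.
  assert (H : ln v <= ln c + v / c - 1).
  { assert (H1 := ln_le_sub_1 (v / c) ltac:(now apply Rdiv_lt_0_compat)).
    rewrite ln_div in H1 by lra. lra. }
  assert (H2 : c * ln v <= c * ln c + v).
  { apply Rle_trans with (c * (ln c + v / c - 1)); [apply Rmult_le_compat_l; lra|].
    replace (c * (ln c + v / c - 1)) with (c * ln c + v - c) by (field; lra). lra. }
  destruct H2 as [H2|H2]; [left; now apply exp_increasing|right; now rewrite H2].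
Qed.

Definition gamma_integrand (x v : R) : R := Rpower v (x - 1) * exp (- v).

Lemma exp_opp_cont : cont_pos (fun v => exp (- v)).
Proof.
  intros v _. apply continuous_exp_comp. apply (continuous_opp (V := R_NormedModule)). apply continuous_id.
Qed.

Lemma gamma_integrand_cont (x : R) : cont_pos (gamma_integrand x).
Proof. intros v Hv. apply continuous_mult_R; [now apply Rpower_cont_pos|now apply exp_opp_cont]. Qed.

Lemma gamma_integrand_decay (x v : R) : 0 < x -> 0 < v ->
  Rpower v x * exp (- v) <= Rpower (x + 1) (x + 1) * Rpower v (- (1)).
Proof.
  intros Hx Hv. assert (H := Rpower_le_exp (x + 1) v ltac:(lra) Hv).
  replace (Rpower v x) with (Rpower v (x + 1) * Rpower v (- (1))).
  2: { rewrite <- Rpower_plus. f_equal. ring. }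
  assert (H1 := Rpower_pos v (- (1))). assert (H2 := exp_pos (- v)).
  assert (E : exp v * exp (- v) = 1) by (rewrite <- exp_plus, Rplus_opp_r; apply exp_0).
  assert (H3 : Rpower v (x + 1) * exp (- v) <= Rpower (x + 1) (x + 1)).
  { apply Rle_trans with (Rpower (x + 1) (x + 1) * exp v * exp (- v)).
    - apply Rmult_le_compat_r; lra.
    - rewrite Rmult_assoc, E. lra. }
  nra.
Qed.

Lemma Euler_integral_IInt (x : R) : 0 < x -> is_IInt (gamma_integrand x) (Euler_integral x).
Proof.
  intro Hx.
  destruct (mellin_exists x 1 (Rpower (x + 1) (x + 1)) 1 (fun v => exp (- v))) as (F & l & HFl); try lra.
  - apply exp_opp_cont.
  - intros v Hv. assert (H := exp_ineq1_le (- v)). assert (H1 := exp_pos (- v)).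
    assert (H2 : exp (- v) < 1) by (rewrite <- exp_0; apply exp_increasing; lra). lra.
  - intros v Hv. assert (H := gamma_integrand_decay x v Hx ltac:(lra)).
    assert (H1 := Rpower_pos v (- (1))).
    replace (Rpower v (x - 1)) with (Rpower v x * Rpower v (- (1))) by (rewrite <- Rpower_plus; f_equal; ring).
    replace (Rpower v (- (1) - 1)) with (Rpower v (- (1)) * Rpower v (- (1))) by (rewrite <- Rpower_plus; f_equal; ring).
    nra.
  - apply (is_mellin_IInt _ _ _ _ _ Hx) in HFl.
    rewrite <- (is_IInt_RInt_gen _ _ (gamma_integrand_cont x) HFl) in HFl. exact HFl.
Qed.

Lemma Euler_integral_pos (x : R) : 0 < x -> 0 < Euler_integral x.
Proof.
  intro Hx. apply (is_IInt_pos (gamma_integrand x)); [|now apply Euler_integral_IInt].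
  intros v Hv. apply Rmult_lt_0_compat; [apply Rpower_pos|apply exp_pos].
Qed.

Lemma Euler_integral_1 : Euler_integral 1 = 1.
Proof.
  apply (is_IInt_unique (gamma_integrand 1)); [apply Euler_integral_IInt; lra|].
  exists (fun v => 1 - exp (- v)). split; [|split].
  - intros v Hv. unfold gamma_integrand. rewrite Rminus_diag, Rpower_O by exact Hv. auto_derive; [exact I|ring].
  - apply (filterlim_squeeze_0 (at_right 0) _ (fun v => Rpower v 1)); [|apply Rpower_lim_at_0; lra].
    generalize at_right_0_pos. apply filter_imp. intros v Hv. rewrite Rpower_1 by exact Hv.
    assert (H := exp_ineq1_le (- v)). assert (H2 : exp (- v) < 1) by (rewrite <- exp_0; apply exp_increasing; lra).
    apply Rabs_le_between. lra.
  - assert (H : filterlim (fun v => exp (- v)) (Rbar_locally p_infty) (locally 0)).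
    { apply (filterlim_squeeze_0 (Rbar_locally p_infty) _ (fun v => Rpower v (- (1)))); [|apply Rpower_lim_infty; lra].
      exists 0. intros v Hv. rewrite Rabs_pos_eq by (left; apply exp_pos).
      rewrite Rpower_Ropp, Rpower_1, exp_Ropp by exact Hv. apply Rinv_le_contravar; [exact Hv|].
      assert (H := exp_ineq1_le v). lra. }
    assert (H' := filterlim_lin (Rbar_locally p_infty) 1 (-1) (fun _ => 1) _ 1 0 (filterlim_const 1) H).
    replace (1 * 1 + -1 * 0) with 1 in H' by ring.
    apply filterlim_ext with (2 := H'). intro v. ring.
Qed.

(** The derivative of [v^x exp (- v)] integrates to 0, since this function vanishes at both ends. *)
Lemma Euler_integral_succ (x : R) : 0 < x -> Euler_integral (x + 1) = x * Euler_integral x.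
Proof.
  intro Hx. assert (0 = x * Euler_integral x + (-1) * Euler_integral (x + 1)); [|lra].
  apply (is_IInt_unique (fun v => x * gamma_integrand x v + (-1) * gamma_integrand (x + 1) v)).
  - exists (fun v => Rpower v x * exp (- v)). split; [|split].
    + intros v Hv. unfold gamma_integrand. replace (x + 1 - 1) with x by ring.
      replace (x * (Rpower v (x - 1) * exp (- v)) + -1 * (Rpower v x * exp (- v))) with
        (x * Rpower v (x - 1) * exp (- v) + Rpower v x * (- exp (- v))) by ring.
      apply (is_derive_mult (fun v => Rpower v x) (fun v => exp (- v))).
      * now apply is_derive_Rpower.
      * auto_derive; [exact I|ring].
      * intros; apply Rmult_comm.
    + apply (filterlim_squeeze_0 (at_right 0) _ (fun v => Rpower v x)); [|now apply Rpower_lim_at_0].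
      generalize at_right_0_pos. apply filter_imp. intros v Hv.
      assert (H := Rpower_pos v x). assert (H1 := exp_pos (- v)).
      assert (H2 : exp (- v) < 1) by (rewrite <- exp_0; apply exp_increasing; lra).
      rewrite Rabs_pos_eq; nra.
    + apply (filterlim_squeeze_0 (Rbar_locally p_infty) _
        (fun v => Rpower (x + 1) (x + 1) * Rpower v (- (1)) + 0 * Rpower v (- (1)))).
      * exists 0. intros v Hv. assert (H := gamma_integrand_decay x v Hx Hv).
        assert (H1 := Rpower_pos v x). assert (H2 := exp_pos (- v)).
        rewrite Rabs_pos_eq; [lra|]. apply Rmult_le_pos; lra.
      * assert (H := Rpower_lim_infty 1 Rlt_0_1).
        assert (H' := filterlim_lin (Rbar_locally p_infty) (Rpower (x + 1) (x + 1)) 0 _ _ 0 0 H H).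
        rewrite !Rmult_0_r, Rplus_0_r in H'. exact H'.
  - apply is_IInt_lin; apply Euler_integral_IInt; lra.
Qed.

Lemma ln_Euler_integral (x : R) : 0 < x -> ln (Euler_integral x) = lnG x.
Proof.
  intro Hx. apply (bohr_mollerup (fun x => ln (Euler_integral x))); [|apply lnG_like|exact Hx].
  split; [|split].
  - apply (is_IInt_log_convex gamma_integrand).
    + intros p v _ _. apply Rmult_lt_0_compat; [apply Rpower_pos|apply exp_pos].
    + apply Euler_integral_IInt.
    + intros v Hv. exists (ln v), (- ln v - v). intros p _. unfold gamma_integrand.
      rewrite ln_mult, ln_Rpower, ln_exp by (apply Rpower_pos || apply exp_pos). ring.
  - rewrite Euler_integral_1. apply ln_1.
  - intros y Hy. rewrite Euler_integral_succ, ln_mult by (auto; now apply Euler_integral_pos). ring.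
Qed.

Lemma Gamma_Euler (x : R) : 0 < x -> Gamma x = Euler_integral x.
Proof.
  intro Hx. unfold Gamma. replace (Z.to_nat (up (- x))) with 0%nat; [reflexivity|].
  destruct (archimed (- x)) as [_ H]. assert (H1 : IZR (up (- x)) < IZR 1) by lra.
  apply lt_IZR in H1. lia.
Qed.

Lemma Gamma_exp_lnG (x : R) : 0 < x -> Gamma x = exp (lnG x).
Proof.
  intro Hx. rewrite <- ln_Euler_integral, exp_ln by (auto; now apply Euler_integral_pos). now apply Gamma_Euler.
Qed.

Lemma Gamma_pos (x : R) : 0 < x -> 0 < Gamma x.
Proof. intro Hx. rewrite Gamma_exp_lnG by exact Hx. apply exp_pos. Qed.

Lemma Gamma_1 : Gamma 1 = 1.
Proof. rewrite Gamma_Euler by lra. apply Euler_integral_1. Qed.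

(** For [x <= 0] the definition at [x] unfolds exactly once more than at [x + 1], so the equation is
    that unfolding and [x = 0] is the only exception. *)
Lemma Gamma_succ (x : R) : x <> 0 -> Gamma (x + 1) = x * Gamma x.
Proof.
  intro Hx. destruct (Rlt_le_dec 0 x) as [H|H].
  - rewrite !Gamma_Euler by lra. now apply Euler_integral_succ.
  - unfold Gamma.
    replace (Z.to_nat (up (- x))) with (S (Z.to_nat (up (- (x + 1))))).
    + simpl. field. exact Hx.
    + assert (E : up (- x) = (up (- (x + 1)) + 1)%Z).
      { symmetry. destruct (archimed (- (x + 1))) as [H1 H2].
        apply tech_up; rewrite plus_IZR; lra. }
      assert (H1 : (0 <= up (- (x + 1)))%Z).
      { destruct (archimed (- (x + 1))) as [H1 _].
        assert (H2 : IZR (-1) < IZR (up (- (x + 1)))) by lra. apply lt_IZR in H2. lia. }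
      rewrite E. lia.
Qed.

Lemma is_derive_Gamma (x : R) : 0 < x -> is_derive Gamma x (psi x * Gamma x).
Proof.
  intro Hx. apply is_derive_ext_loc with (fun x => exp (lnG x)).
  - generalize (open_gt 0 x Hx). apply filter_imp. intros y Hy. symmetry. now apply Gamma_exp_lnG.
  - rewrite Gamma_exp_lnG by exact Hx.
    apply (is_derive_comp exp lnG); [|now apply is_derive_lnG].
    apply is_derive_exp.
Qed.

Lemma digamma (x : R) : 0 < x -> Derive Gamma x / Gamma x = psi x.
Proof.
  intro Hx. rewrite (is_derive_unique _ _ _ (is_derive_Gamma x Hx)). field.
  apply Rgt_not_eq. now apply Gamma_pos.
Qed.

(** * The beta integral and its regularised limit case *)

Lemma Rpower_one_plus_bounds (mu v : R) : 0 <= mu -> 0 < v ->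
  0 <= Rpower (1 + v) (- mu) <= 1 /\ 1 - mu * v <= Rpower (1 + v) (- mu).
Proof.
  intros Hmu Hv. assert (H0 := Rpower_pos (1 + v) (- mu)).
  assert (Hl' := ln_le_sub_1 (1 + v) ltac:(lra)).
  split; [split; [lra|]|].
  - apply Rle_trans with (Rpower (1 + v) 0); [apply Rle_Rpower; lra|right; apply Rpower_O; lra].
  - unfold Rpower. assert (H := exp_ineq1_le (- mu * ln (1 + v))). nra.
Qed.

Lemma Rpower_one_plus_cont (c : R) : cont_pos (fun v => Rpower (1 + v) c).
Proof. exact (Rpower_shift_cont 1 c). Qed.

Lemma is_derive_Rpower_one_plus (c v : R) : 0 < v ->
  is_derive (fun v => Rpower (1 + v) c) v (c * Rpower (1 + v) (c - 1)).
Proof. intro Hv. apply (is_derive_Rpower_shift 1). lra. Qed.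

Definition beta_kernel (mu v : R) : R := Rpower (1 + v) (- mu).

(** The constant [mu] comes from [1 - mu v <= (1 + v)^(-mu)]; the integrand decays like
    [v^(-(mu - p) - 1)]. *)
Lemma beta_mellin_exists (p mu : R) : 0 <= p < mu ->
  exists F l, is_mellin p (mu / (p + 1)) (beta_kernel mu) F l.
Proof.
  intros Hp0. apply (mellin_exists p mu 1 (mu - p)); try lra.
  - apply Rpower_one_plus_cont.
  - intros v Hv. apply Rpower_one_plus_bounds; lra.
  - intros v Hv. rewrite Rmult_1_l.
    replace (Rpower v (- (mu - p) - 1)) with (Rpower v (p - 1) * Rpower v (- mu)) by
      (rewrite <- Rpower_plus; f_equal; ring).
    apply Rmult_le_compat_l; [left; apply Rpower_pos|]. apply Rpower_le_neg; lra.
Qed.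

(** The integrand of the beta function [B (p, y)] on the half-line. With [y] fixed rather than
    [p + y], its logarithm is affine in [p] and both log-convexity and the recursion run in [p]
    alone. *)
Definition beta_integrand (y p v : R) : R := Rpower v (p - 1) * beta_kernel (p + y) v.

Definition beta_integral (p y : R) : R := RInt_gen (beta_integrand y p) (at_right 0) (Rbar_locally p_infty).

Lemma beta_integral_IInt (p y : R) : 0 < p -> 0 < y -> is_IInt (beta_integrand y p) (beta_integral p y).
Proof.
  intros Hp0 Hy. destruct (beta_mellin_exists p (p + y)) as (F & l & HFl); [lra|].
  apply (is_mellin_IInt _ _ _ _ _ Hp0) in HFl.
  assert (Hc : cont_pos (beta_integrand y p)).
  { intros v Hv. apply continuous_mult_R; [now apply Rpower_cont_pos|now apply Rpower_one_plus_cont]. }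
  rewrite <- (is_IInt_RInt_gen _ _ Hc HFl) in HFl. exact HFl.
Qed.

Lemma beta_integral_pos (p y : R) : 0 < p -> 0 < y -> 0 < beta_integral p y.
Proof.
  intros Hp0 Hy. apply (is_IInt_pos (beta_integrand y p)); [|now apply beta_integral_IInt].
  intros v Hv. apply Rmult_lt_0_compat; apply Rpower_pos.
Qed.

Lemma beta_kernel_le (y v : R) : 0 < y -> 0 < v -> Rpower (1 + v) (- y) <= Rpower v (- y).
Proof. intros Hy Hv. apply Rpower_le_neg; lra. Qed.

Lemma beta_integral_1 (y : R) : 0 < y -> beta_integral 1 y = / y.
Proof.
  intro Hy. apply (is_IInt_unique (beta_integrand y 1)); [apply beta_integral_IInt; lra|].
  exists (fun v => / y * 1 + (- / y) * Rpower (1 + v) (- y)). split; [|split].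
  - intros v Hv. unfold beta_integrand, beta_kernel. rewrite Rminus_diag, Rpower_O by exact Hv.
    replace (1 * Rpower (1 + v) (- (1 + y))) with (/ y * 0 + - / y * (- y * Rpower (1 + v) (- y - 1))).
    + apply (is_derive_lin (/ y) (- / y) (fun _ => 1)); [apply (is_derive_const (V := R_NormedModule))|].
      now apply is_derive_Rpower_one_plus.
    + replace (- (1 + y)) with (- y - 1) by ring. field. lra.
  - apply (filterlim_squeeze_0 (at_right 0) _ (fun v => Rpower v 1)); [|apply Rpower_lim_at_0; lra].
    generalize at_right_0_pos. apply filter_imp. intros v Hv. rewrite Rpower_1 by exact Hv.
    assert (H := Rpower_one_plus_bounds y v ltac:(lra) Hv). assert (Hi := Rinv_0_lt_compat y Hy).
    assert (E : / y * y = 1) by (field; lra).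
    replace (/ y * 1 + - / y * Rpower (1 + v) (- y)) with (/ y * (1 - Rpower (1 + v) (- y))) by ring.
    rewrite Rabs_pos_eq by (apply Rmult_le_pos; lra).
    apply Rle_trans with (/ y * (y * v)); [apply Rmult_le_compat_l; lra|].
    rewrite <- Rmult_assoc, E. lra.
  - assert (H : filterlim (fun v => Rpower (1 + v) (- y)) (Rbar_locally p_infty) (locally 0)).
    { apply (filterlim_squeeze_0 (Rbar_locally p_infty) _ (fun v => Rpower v (- y))); [|now apply Rpower_lim_infty].
      exists 0. intros v Hv. rewrite Rabs_pos_eq by (left; apply Rpower_pos). now apply beta_kernel_le. }
    assert (H' := filterlim_lin (Rbar_locally p_infty) (/ y) (- / y) (fun _ => 1) _ 1 0 (filterlim_const 1) H).
    replace (/ y * 1 + - / y * 0) with (/ y) in H' by ring. exact H'.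
Qed.

Lemma beta_integral_succ (p y : R) : 0 < p -> 0 < y ->
  (p + y) * beta_integral (p + 1) y = p * beta_integral p y.
Proof.
  intros Hp0 Hy. assert (0 = p * beta_integral p y + (- (p + y)) * beta_integral (p + 1) y); [|lra].
  apply (is_IInt_unique (fun v => p * beta_integrand y p v + (- (p + y)) * beta_integrand y (p + 1) v)).
  - exists (fun v => Rpower v p * Rpower (1 + v) (- (p + y))). split; [|split].
    + intros v Hv. unfold beta_integrand, beta_kernel. replace (p + 1 - 1) with p by ring.
      replace (- (p + 1 + y)) with (- (p + y) - 1) by ring.
      replace (p * (Rpower v (p - 1) * Rpower (1 + v) (- (p + y))) +
         - (p + y) * (Rpower v p * Rpower (1 + v) (- (p + y) - 1))) with
        (p * Rpower v (p - 1) * Rpower (1 + v) (- (p + y)) +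
         Rpower v p * (- (p + y) * Rpower (1 + v) (- (p + y) - 1))) by ring.
      apply (is_derive_mult (fun v => Rpower v p) (fun v => Rpower (1 + v) (- (p + y)))).
      * now apply is_derive_Rpower.
      * now apply is_derive_Rpower_one_plus.
      * intros; apply Rmult_comm.
    + apply (filterlim_squeeze_0 (at_right 0) _ (fun v => Rpower v p)); [|now apply Rpower_lim_at_0].
      generalize at_right_0_pos. apply filter_imp. intros v Hv.
      assert (H := Rpower_pos v p). assert (H1 := Rpower_one_plus_bounds (p + y) v ltac:(lra) Hv).
      rewrite Rabs_pos_eq; nra.
    + apply (filterlim_squeeze_0 (Rbar_locally p_infty) _ (fun v => Rpower v (- y))); [|now apply Rpower_lim_infty].
      exists 0. intros v Hv. assert (H := Rpower_pos v p). assert (H1 := Rpower_pos (1 + v) (- (p + y))).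
      rewrite Rabs_pos_eq by (apply Rmult_le_pos; lra).
      replace (Rpower v (- y)) with (Rpower v p * Rpower v (- (p + y))) by (rewrite <- Rpower_plus; f_equal; ring).
      apply Rmult_le_compat_l; [lra|]. apply beta_kernel_le; lra.
  - apply is_IInt_lin; apply beta_integral_IInt; lra.
Qed.

(* For fixed [y], [B (p, y) Gamma (p + y) / Gamma y] satisfies the characterisation of [Gamma p]. *)
Lemma beta_integral_Gamma (p y : R) : 0 < p -> 0 < y ->
  beta_integral p y = Gamma p * Gamma y / Gamma (p + y).
Proof.
  intros Hp0 Hy.
  assert (H : ln (beta_integral p y) + (lnG (p + y) - lnG y) = lnG p).
  { apply (bohr_mollerup (fun p => ln (beta_integral p y) + (lnG (p + y) - lnG y))); [|apply lnG_like|exact Hp0].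
    destruct lnG_like as (HG1 & HG2 & HG3). split; [|split].
    - assert (Hc : slope_convex (fun p => ln (beta_integral p y))).
      { apply (is_IInt_log_convex (beta_integrand y)).
        + intros q v _ _. apply Rmult_lt_0_compat; apply Rpower_pos.
        + intros q Hq. now apply beta_integral_IInt.
        + intros v Hv. exists (ln v - ln (1 + v)), (- ln v - y * ln (1 + v)). intros q _.
          unfold beta_integrand, beta_kernel. rewrite ln_mult, !ln_Rpower by apply Rpower_pos. ring. }
      intros a b c Ha Hab Hbc. assert (H1 := Hc a b c Ha Hab Hbc).
      assert (H2 := HG1 (a + y) (b + y) (c + y) ltac:(lra) ltac:(lra) ltac:(lra)).
      replace (c + y - (b + y)) with (c - b) in H2 by ring. replace (b + y - (a + y)) with (b - a) in H2 by ring.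
      lra.
    - rewrite beta_integral_1, ln_Rinv by exact Hy. replace (1 + y) with (y + 1) by ring. rewrite HG3 by exact Hy. ring.
    - intros q Hq. replace (q + 1 + y) with (q + y + 1) by ring. rewrite HG3 by lra.
      assert (H1 := f_equal ln (beta_integral_succ q y Hq Hy)).
      assert (H2 := beta_integral_pos q y Hq Hy). assert (H3 := beta_integral_pos (q + 1) y ltac:(lra) Hy).
      rewrite !ln_mult in H1 by lra. lra. }
  assert (H2 := beta_integral_pos p y Hp0 Hy).
  rewrite <- (exp_ln (beta_integral p y)) by exact H2.
  rewrite !Gamma_exp_lnG by lra. unfold Rdiv. rewrite <- exp_Ropp, <- !exp_plus. f_equal. lra.
Qed.

Lemma beta_mellin_value (p mu D : R) (F : R -> R) (l : R) : 0 < p < mu ->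
  is_mellin p D (beta_kernel mu) F l -> l = Gamma p * Gamma (mu - p) / Gamma mu.
Proof.
  intros Hp0 HFl. apply (is_mellin_IInt _ _ _ _ _ (proj1 Hp0)) in HFl.
  replace mu with (p + (mu - p)) at 2 by ring. rewrite <- beta_integral_Gamma by lra.
  apply (is_IInt_unique _ _ _ HFl).
  replace (fun v => Rpower v (p - 1) * beta_kernel mu v) with (beta_integrand (mu - p) p).
  - apply beta_integral_IInt; lra.
  - unfold beta_integrand. now replace (p + (mu - p)) with mu by ring.
Qed.

(** [l] is the limit, as [e -> 0+], of [ln e] plus the integral of [(1 + v)^(-mu) / v] from [e] to
    infinity: the beta integral at [p = 0] with its logarithm removed. *)
Definition is_kappa (mu l : R) : Prop := exists F D, is_mellin 0 D (beta_kernel mu) F l.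

Lemma Hp_0 (v : R) : Hp 0 v = ln v.
Proof. unfold Hp. destruct (Req_EM_T 0 0); [reflexivity|lra]. Qed.

(** Both primitives have the same logarithm at 0+, so their difference is an ordinary convergent
    integral. *)
Lemma is_kappa_IInt_diff (mu nu l m : R) : is_kappa mu l -> is_kappa nu m ->
  is_IInt (fun v => 1 * (Rpower v (0 - 1) * beta_kernel mu v) + (-1) * (Rpower v (0 - 1) * beta_kernel nu v)) (l - m).
Proof.
  intros (F & D & F1 & F2 & F3) (G & E & G1 & G2 & G3).
  exists (fun v => 1 * F v + (-1) * G v). split; [|split].
  - intros v Hv. apply is_derive_lin; auto.
  - apply (filterlim_squeeze_0 (at_right 0) _ (fun v => D * Rpower v (0 + 1) + E * Rpower v (0 + 1))).
    + generalize at_right_0_pos. apply filter_imp. intros v Hv.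
      replace (1 * F v + -1 * G v) with ((F v - Hp 0 v) + - (G v - Hp 0 v)) by ring.
      apply Rle_trans with (1 := Rabs_triang _ _). rewrite Rabs_Ropp. apply Rplus_le_compat; auto.
    + assert (H0 : 0 < 0 + 1) by lra. assert (H := Rpower_lim_at_0 _ H0).
      assert (H' := filterlim_lin (at_right 0) D E _ _ 0 0 H H).
      replace (D * 0 + E * 0) with 0 in H' by ring. exact H'.
  - replace (l - m) with (1 * l + -1 * m) by ring. exact (filterlim_lin (Rbar_locally p_infty) 1 (-1) F G l m F3 G3).
Qed.

Lemma is_kappa_exists (mu : R) : 0 < mu -> exists l, is_kappa mu l.
Proof.
  intro Hmu. destruct (beta_mellin_exists 0 mu) as (F & l & H); [lra|]. exists l, F. eexists. exact H.
Qed.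

Lemma is_kappa_antitone (mu nu l m : R) : mu <= nu -> is_kappa mu l -> is_kappa nu m -> m <= l.
Proof.
  intros H Hl Hm. assert (0 <= l - m); [|lra].
  apply (is_IInt_nonneg) with (2 := is_kappa_IInt_diff _ _ _ _ Hl Hm). intros v Hv.
  assert (H1 : beta_kernel nu v <= beta_kernel mu v) by (apply Rle_Rpower; lra).
  assert (H2 := Rpower_pos v (0 - 1)). nra.
Qed.

(** The factor [1 / v] cancels in the difference of the kernels, leaving [(1 + v)^(-(mu + 1))], the
    beta integrand at [p = 1]. *)
Lemma is_kappa_succ (mu l m : R) : 0 < mu -> is_kappa mu l -> is_kappa (mu + 1) m -> l - m = / mu.
Proof.
  intros Hmu Hl Hm. rewrite <- beta_integral_1 by exact Hmu.
  apply (is_IInt_unique _ _ _ (is_kappa_IInt_diff _ _ _ _ Hl Hm)).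
  apply is_IInt_ext with (2 := beta_integral_IInt 1 mu Rlt_0_1 Hmu).
  intros v Hv. unfold beta_integrand, beta_kernel. rewrite Rminus_diag, Rpower_O by exact Hv.
  replace (0 - 1) with (- (1)) by ring. rewrite (Rpower_Ropp v 1), Rpower_1 by exact Hv.
  replace (- mu) with (- (1 + mu) + 1) by ring. replace (mu + 1) with (1 + mu) by ring.
  rewrite Rpower_plus, Rpower_1 by lra. field. lra.
Qed.

Lemma is_kappa_1 : is_kappa 1 0.
Proof.
  exists (fun v => ln v - ln (1 + v)), 1. split; [|split].
  - intros v Hv. unfold beta_kernel. replace (0 - 1) with (- (1)) by ring.
    rewrite !(Rpower_Ropp _ 1), !Rpower_1 by lra. auto_derive; [lra|field; lra].
  - intros v Hv. rewrite Hp_0, Rplus_0_l, Rpower_1, Rmult_1_l by exact Hv.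
    replace (ln v - ln (1 + v) - ln v) with (- ln (1 + v)) by ring. rewrite Rabs_Ropp.
    assert (Hl : 0 <= ln (1 + v)) by (rewrite <- ln_1; apply ln_le; lra).
    assert (Hl' := ln_le_sub_1 (1 + v) ltac:(lra)). rewrite Rabs_pos_eq; lra.
  - apply (filterlim_squeeze_0 (Rbar_locally p_infty) _ (fun v => Rpower v (- (1)))); [|apply Rpower_lim_infty; lra].
    exists 0. intros v Hv. rewrite Rpower_Ropp, Rpower_1 by exact Hv.
    assert (H := ln_succ_sub v Hv). replace (v + 1) with (1 + v) in H by ring.
    assert (H1 : ln v <= ln (1 + v)) by (apply ln_le; lra).
    rewrite Rabs_left1; lra.
Qed.

(** Monotone form of Bohr-Mollerup: both sides are antitone in [mu], drop by [1 / mu] under [mu + 1]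
    and agree at positive integers. Shifting [mu] far to the right traps it between consecutive
    integers, where the gap of [psi] tends to 0. *)
Lemma is_kappa_psi (mu l : R) : 0 < mu -> is_kappa mu l -> l = psi 1 - psi mu.
Proof.
  assert (Hstep : forall n mu l m, 0 < mu -> is_kappa mu l -> is_kappa (mu + INR n) m ->
    l - (psi 1 - psi mu) = m - (psi 1 - psi (mu + INR n))).
  { induction n as [|n IH]; intros nu l' m Hnu Hl Hm.
    - simpl in *. rewrite Rplus_0_r in *.
      assert (l' = m); [|lra]. apply Rle_antisym; eapply is_kappa_antitone; try eassumption; apply Rle_refl.
    - assert (Hn := pos_INR n). destruct (is_kappa_exists (nu + INR n)) as [m' Hm']; [lra|].
      rewrite S_INR, <- Rplus_assoc in *. rewrite (IH _ _ _ Hnu Hl Hm').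
      assert (H1 := is_kappa_succ (nu + INR n) m' m ltac:(lra) Hm' Hm).
      assert (H2 := psi_succ (nu + INR n) ltac:(lra)). lra. }
  assert (Hnat : forall n m, is_kappa (1 + INR n) m -> m = psi 1 - psi (1 + INR n)).
  { intros n m Hm. assert (H := Hstep n 1 0 m Rlt_0_1 is_kappa_1 Hm). lra. }
  intros Hmu Hl. assert (l - (psi 1 - psi mu) = 0); [|lra].
  apply eq_0_of_le_inv_nat. intro n.
  (* With [j] the integer part of [mu], the point [mu + n + 1] lies between [1 + n + j] and
     [2 + n + j]. *)
  destruct (nfloor_ex mu (Rlt_le _ _ Hmu)) as [j Hj].
  assert (HN := pos_INR n). assert (HJ := pos_INR j).
  destruct (is_kappa_exists (mu + INR (S n))) as [m Hm]; [rewrite S_INR; lra|].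
  rewrite (Hstep (S n) mu l m Hmu Hl Hm). rewrite S_INR in *.
  destruct (is_kappa_exists (1 + INR (n + j))) as [m1 Hm1]; [assert (H := pos_INR (n + j)); lra|].
  destruct (is_kappa_exists (1 + INR (S (n + j)))) as [m2 Hm2]; [assert (H := pos_INR (S (n + j))); lra|].
  assert (E1 := Hnat _ _ Hm1). assert (E2 := Hnat _ _ Hm2).
  rewrite S_INR, plus_INR in *.
  assert (A1 := is_kappa_antitone (1 + (INR n + INR j)) (mu + (INR n + 1)) m1 m ltac:(lra) Hm1 Hm).
  assert (A2 := is_kappa_antitone (mu + (INR n + 1)) (1 + (INR n + INR j + 1)) m m2 ltac:(lra) Hm Hm2).
  assert (Hpsi : forall x y, 0 < x <= y -> psi x <= psi y).
  { intros x y Hxy. destruct (Req_dec x y) as [->|]; [lra|]. left. apply psi_increasing; lra. }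
  assert (B1 := Hpsi (1 + (INR n + INR j)) (mu + (INR n + 1)) ltac:(lra)).
  assert (B2 := Hpsi (mu + (INR n + 1)) (1 + (INR n + INR j + 1)) ltac:(lra)).
  assert (S := psi_succ (1 + (INR n + INR j)) ltac:(lra)).
  replace (1 + (INR n + INR j) + 1) with (1 + (INR n + INR j + 1)) in S by ring.
  assert (Hi : / (1 + (INR n + INR j)) <= / (INR n + 1)) by (apply Rinv_le_contravar; lra).
  apply Rabs_le_between. lra.
Qed.

(** * The expansion of order zero *)

Definition term (alpha x gam mu y : R) : R := Rpower y gam / Rpower (x * Rpower y alpha + 1) mu.

Lemma term_eq (alpha x gam mu y : R) :
  term alpha x gam mu y = Rpower y gam * Rpower (x * Rpower y alpha + 1) (- mu).
Proof. unfold term, Rdiv. now rewrite Rpower_Ropp. Qed.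

Lemma term_pos (alpha x gam mu y : R) : 0 < term alpha x gam mu y.
Proof. rewrite term_eq. apply Rmult_lt_0_compat; apply Rpower_pos. Qed.

Lemma term_base_pos (alpha x y : R) : 0 < x -> 0 < x * Rpower y alpha + 1.
Proof. intro Hx. assert (H := Rpower_pos y alpha). nra. Qed.

(** The factor [x y^alpha] from the inner derivative is written as [(x y^alpha + 1) - 1]. The
    derivative is thus a combination of terms of the same family whose coefficients do not contain
    [x]. *)
Lemma is_derive_term (alpha x gam mu y : R) : 0 < x -> 0 < y ->
  is_derive (term alpha x gam mu) y
    ((gam - alpha * mu) * term alpha x (gam - 1) mu y + alpha * mu * term alpha x (gam - 1) (mu + 1) y).
Proof.
  intros Hx Hy. assert (Hb := term_base_pos alpha x y Hx).
  apply is_derive_ext with (fun y => Rpower y gam * Rpower (x * Rpower y alpha + 1) (- mu)).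
  { intro t. symmetry. apply term_eq. }
  rewrite !term_eq.
  replace ((gam - alpha * mu) * (Rpower y (gam - 1) * Rpower (x * Rpower y alpha + 1) (- mu)) +
     alpha * mu * (Rpower y (gam - 1) * Rpower (x * Rpower y alpha + 1) (- (mu + 1)))) with
    (gam * Rpower y (gam - 1) * Rpower (x * Rpower y alpha + 1) (- mu) +
     Rpower y gam * ((x * (alpha * Rpower y (alpha - 1))) * (- mu * Rpower (x * Rpower y alpha + 1) (- mu - 1)))).
  - apply (is_derive_mult (fun y => Rpower y gam) (fun y => Rpower (x * Rpower y alpha + 1) (- mu))).
    + now apply is_derive_Rpower.
    + apply (is_derive_comp (fun z => Rpower z (- mu)) (fun y => x * Rpower y alpha + 1)).
      * now apply is_derive_Rpower.
      * replace (x * (alpha * Rpower y (alpha - 1))) with (x * (alpha * Rpower y (alpha - 1)) + 0) by ring.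
        apply (is_derive_plus (V := R_NormedModule)); [|apply (is_derive_const (V := R_NormedModule))].
        apply is_derive_scal. now apply is_derive_Rpower.
    + intros; apply Rmult_comm.
  - replace (- (mu + 1)) with (- mu - 1) by ring.
    replace (Rpower (x * Rpower y alpha + 1) (- mu)) with
      ((x * Rpower y alpha + 1) * Rpower (x * Rpower y alpha + 1) (- mu - 1)).
    2: { rewrite <- (Rpower_1 (x * Rpower y alpha + 1) Hb) at 1. rewrite <- Rpower_plus. f_equal. ring. }
    replace (Rpower y gam) with (Rpower y (gam - 1) * y).
    2: { rewrite <- (Rpower_1 y Hy) at 2. rewrite <- Rpower_plus. f_equal. ring. }
    replace (Rpower y alpha) with (Rpower y (alpha - 1) * y).
    2: { rewrite <- (Rpower_1 y Hy) at 2. rewrite <- Rpower_plus. f_equal. ring. }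
    ring.
Qed.

Lemma term_cont_pos (alpha x gam mu : R) : 0 < x -> cont_pos (term alpha x gam mu).
Proof. intros Hx y Hy. eapply is_derive_continuous. now apply is_derive_term. Qed.

Lemma cont_pos_shift (f : R -> R) (k : nat) : cont_pos f -> cont_pos (fun t => f (INR k + t)).
Proof. intros Hf t Ht. apply continuous_shift, Hf. assert (H := pos_INR k). lra. Qed.

Lemma is_derive_shift (f : R -> R) (k t l : R) : is_derive f (k + t) l -> is_derive (fun t => f (k + t)) t l.
Proof.
  intro H. replace l with (1 * l) by ring.
  apply (is_derive_comp f (fun t => k + t)); [exact H|].
  auto_derive; [exact I|ring].
Qed.

Lemma term_bound (alpha x1 x gam mu y1 y : R) :
  0 < x1 <= x -> 0 < y1 <= y -> 0 < mu -> gam <= alpha * mu ->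
  Rabs (term alpha x gam mu y) <= Rpower x1 (- mu) * Rpower y1 (- (alpha * mu - gam)).
Proof.
  intros Hx Hy Hmu Hg. rewrite Rabs_pos_eq by (left; apply term_pos). rewrite term_eq.
  assert (H1 := Rpower_pos y alpha).
  apply Rle_trans with (Rpower y gam * Rpower (x1 * Rpower y alpha) (- mu)).
  - apply Rmult_le_compat_l; [left; apply Rpower_pos|]. apply Rpower_le_neg; nra.
  - rewrite <- Rpower_mult_distr by lra. rewrite Rpower_mult.
    replace (Rpower y gam * (Rpower x1 (- mu) * Rpower y (alpha * - mu))) with
      (Rpower x1 (- mu) * (Rpower y gam * Rpower y (alpha * - mu))) by ring.
    rewrite <- Rpower_plus. apply Rmult_le_compat_l; [left; apply Rpower_pos|].
    replace (gam + alpha * - mu) with (- (alpha * mu - gam)) by ring. apply Rpower_le_neg; lra.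
Qed.

(** Majorant uniform in [x >= x1] and [t >= t1], obtained by dropping the 1 in the base; it is
    summable when [gam + 1 < alpha mu]. *)
Definition gbound (alpha x1 gam mu t1 : R) (k : nat) : R :=
  Rpower x1 (- mu) * Rpower (INR k + t1) (- (alpha * mu - gam)).

Lemma ex_series_gbound (alpha x1 gam mu t1 : R) :
  0 < t1 -> gam + 1 < alpha * mu -> ex_series (gbound alpha x1 gam mu t1).
Proof.
  intros Ht Hg. apply (ex_series_scal_l (V := R_NormedModule)).
  apply ex_series_power; lra.
Qed.

Lemma g_term_bound (alpha x1 x gam mu t1 t : R) (k : nat) :
  0 < x1 <= x -> 0 < t1 <= t -> 0 < mu -> gam <= alpha * mu ->
  Rabs (term alpha x gam mu (INR k + t)) <= gbound alpha x1 gam mu t1 k.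
Proof.
  intros Hx Ht Hmu Hg. assert (Hk := pos_INR k). apply term_bound; lra.
Qed.

Lemma g_Series (alpha x gam mu t : R) :
  g x t gam alpha mu = Series (fun k => term alpha x gam mu (INR k + t)).
Proof. reflexivity. Qed.

Lemma ex_series_g (alpha x gam mu t : R) : 0 < x -> 0 < t -> 0 < mu -> gam + 1 < alpha * mu ->
  ex_series (fun k => term alpha x gam mu (INR k + t)).
Proof.
  intros Hx Ht Hmu Hg. apply ex_series_dom with (gbound alpha x gam mu t); [|now apply ex_series_gbound].
  intro k. apply g_term_bound; lra.
Qed.

Lemma g_cont_pos (alpha x gam mu : R) : 0 < x -> 0 < mu -> gam + 1 < alpha * mu ->
  cont_pos (fun t => g x t gam alpha mu).
Proof.
  intros Hx Hmu Hg t Ht.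
  apply (continuous_Series (fun k t => term alpha x gam mu (INR k + t)) (gbound alpha x gam mu (t / 2))
    (t / 2) (t + 1)).
  - intros k u Hu. apply (cont_pos_shift (term alpha x gam mu)); [now apply term_cont_pos|lra].
  - intros k u Hu. apply g_term_bound; lra.
  - apply ex_series_gbound; lra.
  - lra.
Qed.

(* The [t]-derivative of [g]. *)
Definition dg (alpha gam mu x t : R) : R :=
  (gam - alpha * mu) * g x t (gam - 1) alpha mu + alpha * mu * g x t (gam - 1) alpha (mu + 1).

Lemma K_g_series (alpha gam mu x t : R) : 0 < alpha -> 0 < x -> 0 < t -> 0 < mu -> gam + 1 < alpha * mu ->
  is_series (fun k => K (fun v => term alpha x gam mu (INR k + v)) t) (K (fun v => g x v gam alpha mu) t).
Proof.
  intros Ha Hx Ht Hmu Hg.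
  apply (K_Series (fun k v => term alpha x gam mu (INR k + v)) (gbound alpha x gam mu (t / 2)) (t / 2) (t + 2)); try lra.
  - intro k. now apply (cont_pos_shift (term alpha x gam mu)), term_cont_pos.
  - intros k v Hv. apply g_term_bound; lra.
  - apply ex_series_gbound; lra.
Qed.

Lemma power_lim_infty (alpha x t : R) : 0 < alpha -> 0 < x -> 0 < t ->
  filterlim (fun k => x * Rpower (INR k + t) alpha) eventually (Rbar_locally p_infty).
Proof.
  intros Ha Hx Ht P [M HM].
  set (M' := Rmax M 1). assert (HM' : 0 < M') by (apply Rlt_le_trans with 1; [lra|apply Rmax_r]).
  destruct (INR_unbounded (Rpower (M' / x) (/ alpha))) as [N HN].
  exists N. intros n Hn. apply HM. apply le_INR in Hn.
  apply Rle_lt_trans with M'; [apply Rmax_l|].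
  assert (Hq : 0 < M' / x) by now apply Rdiv_lt_0_compat.
  apply Rmult_lt_reg_r with (/ x); [now apply Rinv_0_lt_compat|].
  replace (x * Rpower (INR n + t) alpha * / x) with (Rpower (INR n + t) alpha) by (field; lra).
  change (M' * / x) with (M' / x).
  replace (M' / x) with (Rpower (Rpower (M' / x) (/ alpha)) alpha).
  2: { rewrite Rpower_mult. replace (/ alpha * alpha) with 1 by (field; lra). now apply Rpower_1. }
  apply Rlt_Rpower_l; [exact Ha|]. split; [apply Rpower_pos|lra].
Qed.

(* Substituting [v = x y^alpha]. *)
Lemma is_derive_scaled_mellin (alpha gam mu x y D : R) (F : R -> R) (l : R) :
  0 < alpha -> 0 < x -> 0 < y -> is_mellin ((gam + 1) / alpha) D (beta_kernel mu) F l ->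
  is_derive (fun y => Rpower x (- ((gam + 1) / alpha)) / alpha * F (x * Rpower y alpha)) y (term alpha x gam mu y).
Proof.
  intros Ha Hx Hy (HF & _ & _). set (p := (gam + 1) / alpha) in *.
  assert (H1 := Rpower_pos y alpha). assert (Hv : 0 < x * Rpower y alpha) by nra.
  replace (term alpha x gam mu y) with (Rpower x (- p) / alpha *
    (x * (alpha * Rpower y (alpha - 1)) * (Rpower (x * Rpower y alpha) (p - 1) * beta_kernel mu (x * Rpower y alpha)))).
  - apply is_derive_scal.
    apply (is_derive_comp F (fun y => x * Rpower y alpha)); [now apply HF|].
    apply is_derive_scal. now apply is_derive_Rpower.
  - rewrite term_eq. unfold beta_kernel. rewrite (Rplus_comm 1).
    rewrite <- Rpower_mult_distr by lra. rewrite Rpower_mult.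
    replace (Rpower y gam) with (Rpower y (alpha - 1) * Rpower y (alpha * (p - 1))).
    2: { rewrite <- Rpower_plus. f_equal. unfold p. field. lra. }
    assert (E : Rpower x (- p) * x * Rpower x (p - 1) = 1).
    { rewrite <- (Rpower_1 x Hx) at 2. rewrite <- !Rpower_plus.
      replace (- p + 1 + (p - 1)) with 0 by ring. now apply Rpower_O. }
    transitivity ((Rpower x (- p) * x * Rpower x (p - 1)) * (Rpower y (alpha - 1) * Rpower y (alpha * (p - 1))) *
      Rpower (x * Rpower y alpha + 1) (- mu)); [field; lra|rewrite E; ring].
Qed.

(** [one_step] is summed over the shifts of [t]. In the variable [x y^alpha] the window integrals
    have primitive [c F], so they telescope to the incomplete beta integral from [x t^alpha] to
    infinity. *)
Lemma g_one_step (alpha gam mu x t D : R) (F : R -> R) (l : R) :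
  0 < alpha -> 0 < x -> 0 < t -> 0 < mu -> gam + 1 < alpha * mu ->
  is_mellin ((gam + 1) / alpha) D (beta_kernel mu) F l ->
  g x t gam alpha mu =
    Rpower x (- ((gam + 1) / alpha)) / alpha * (l - F (x * Rpower t alpha)) - K (dg alpha gam mu x) t.
Proof.
  intros Ha Hx Ht Hmu Hg HF. set (c := Rpower x (- ((gam + 1) / alpha)) / alpha).
  assert (Hg1 : gam - 1 + 1 < alpha * mu) by lra. assert (Hg2 : gam - 1 + 1 < alpha * (mu + 1)) by nra.
  pose (h := fun k => c * (l - F (x * Rpower (INR k + t) alpha))).
  assert (Hh : is_series (fun k => h k - h (S k)) (h 0%nat)).
  { apply is_series_telescope. unfold h.
    assert (HFl := filterlim_comp _ _ _ _ _ _ _ _ (power_lim_infty alpha x t Ha Hx Ht) (proj2 (proj2 HF))).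
    assert (H := filterlim_lin eventually c (- c) (fun _ => l) _ l l (filterlim_const l) HFl).
    replace (c * l + - c * l) with 0 in H by ring.
    apply is_lim_seq_ext with (2 := H). intro n. ring. }
  assert (HK1 := K_g_series alpha (gam - 1) mu x t Ha Hx Ht Hmu Hg1).
  assert (HK2 := K_g_series alpha (gam - 1) (mu + 1) x t Ha Hx Ht ltac:(lra) Hg2).
  assert (E : K (dg alpha gam mu x) t = (gam - alpha * mu) * K (fun v => g x v (gam - 1) alpha mu) t +
     alpha * mu * K (fun v => g x v (gam - 1) alpha (mu + 1)) t).
  { apply (K_lin _ _ (fun v => g x v (gam - 1) alpha mu) (fun v => g x v (gam - 1) alpha (mu + 1)));
      [apply g_cont_pos|apply g_cont_pos|]; lra. }
  rewrite E. replace (c * (l - F (x * Rpower t alpha))) with (h 0%nat) by (unfold h; simpl; now rewrite Rplus_0_l).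
  rewrite g_Series. apply is_series_unique.
  eapply is_series_ext; [|apply (is_series_minus (V := R_NormedModule)); [exact Hh|
    apply (is_series_plus (V := R_NormedModule));
      [apply (is_series_scal_l (gam - alpha * mu)) with (1 := HK1)|
       apply (is_series_scal_l (alpha * mu)) with (1 := HK2)]]].
  intro k. cbv beta. assert (Hk := pos_INR k).
  assert (Hc : forall ga m, cont_pos (fun v => term alpha x ga m (INR k + v))).
  { intros ga m. now apply (cont_pos_shift (term alpha x ga m)), term_cont_pos. }
  rewrite (one_step (fun v => term alpha x gam mu (INR k + v))
    (fun v => (gam - alpha * mu) * term alpha x (gam - 1) mu (INR k + v) +
      alpha * mu * term alpha x (gam - 1) (mu + 1) (INR k + v)) t); [| | |exact Ht].
  - rewrite (K_lin _ _ (fun v => term alpha x (gam - 1) mu (INR k + v))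
      (fun v => term alpha x (gam - 1) (mu + 1) (INR k + v))) by auto.
    assert (HI : is_RInt (fun v => term alpha x gam mu (INR k + v)) t (t + 1)
      (minus (c * F (x * Rpower (INR k + (t + 1)) alpha)) (c * F (x * Rpower (INR k + t) alpha)))).
    { apply (is_RInt_derive (fun v => c * F (x * Rpower (INR k + v) alpha)));
        intros v Hv; rewrite Rmin_left, Rmax_right in Hv by lra; [|apply Hc; lra].
      apply (is_derive_shift (fun y => c * F (x * Rpower y alpha))).
      unfold c. apply (is_derive_scaled_mellin alpha gam mu x (INR k + v) D F l); lra || exact HF. }
    replace (RInt (fun v => term alpha x gam mu (INR k + v)) t (t + 1)) with (h k - h (S k)).
    + change (h k - h (S k) + - ((gam - alpha * mu) * K (fun v => term alpha x (gam - 1) mu (INR k + v)) t +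
        alpha * mu * K (fun v => term alpha x (gam - 1) (mu + 1) (INR k + v)) t) =
        h k - h (S k) - ((gam - alpha * mu) * K (fun v => term alpha x (gam - 1) mu (INR k + v)) t +
        alpha * mu * K (fun v => term alpha x (gam - 1) (mu + 1) (INR k + v)) t)). ring.
    + symmetry. apply is_RInt_unique.
      replace (h k - h (S k)) with (c * F (x * Rpower (INR k + (t + 1)) alpha) - c * F (x * Rpower (INR k + t) alpha)).
      * exact HI.
      * unfold h. rewrite S_INR. replace (INR k + 1 + t) with (INR k + (t + 1)) by ring. ring.
  - intros v Hv. apply is_derive_shift. apply is_derive_term; lra.
  - apply cont_pos_plus; apply cont_pos_scal; auto.
Qed.

(** Convergence as [x -> 0+], uniform on compact intervals of [t]; this is the mode of convergence
    that [K] preserves. *)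
Definition unif (G : R -> R -> R) (L : R -> R) : Prop :=
  forall t1 t2 eps, 0 < t1 -> 0 < eps ->
    at_right 0 (fun x => forall t, t1 <= t <= t2 -> Rabs (G x t - L t) <= eps).

Lemma unif_ext (G H : R -> R -> R) (L M : R -> R) :
  (forall x t, 0 < x -> 0 < t -> G x t = H x t) -> (forall t, 0 < t -> L t = M t) -> unif G L -> unif H M.
Proof.
  intros E1 E2 HG t1 t2 eps Ht Heps.
  generalize (filter_and _ _ at_right_0_pos (HG t1 t2 eps Ht Heps)). apply filter_imp.
  intros x [Hx Hb] t Htt. rewrite <- E1, <- E2 by lra. now apply Hb.
Qed.

Lemma unif_lin (a b : R) (G H : R -> R -> R) (L M : R -> R) :
  unif G L -> unif H M -> unif (fun x t => a * G x t + b * H x t) (fun t => a * L t + b * M t).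
Proof.
  intros HG HH t1 t2 eps Ht Heps.
  assert (Hc : forall c, 0 < eps / (2 * (Rabs c + 1))).
  { intro c. apply Rdiv_lt_0_compat; [exact Heps|]. assert (H0 := Rabs_pos c). lra. }
  generalize (filter_and _ _ (HG t1 t2 _ Ht (Hc a)) (HH t1 t2 _ Ht (Hc b))). apply filter_imp.
  intros x [H1 H2] t Htt. specialize (H1 t Htt). specialize (H2 t Htt).
  assert (Hle : forall c d, Rabs d <= eps / (2 * (Rabs c + 1)) -> Rabs (c * d) <= eps / 2).
  { intros c d Hd. rewrite Rabs_mult. assert (H0 := Rabs_pos c).
    apply Rle_trans with ((Rabs c + 1) * (eps / (2 * (Rabs c + 1)))).
    - apply Rmult_le_compat; [exact H0|apply Rabs_pos|lra|exact Hd].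
    - right. field. lra. }
  replace (a * G x t + b * H x t - (a * L t + b * M t)) with (a * (G x t - L t) + b * (H x t - M t)) by ring.
  apply Rle_trans with (1 := Rabs_triang _ _). assert (H3 := Hle a _ H1). assert (H4 := Hle b _ H2). lra.
Qed.

Lemma unif_K (G : R -> R -> R) (L : R -> R) :
  (forall x, 0 < x -> cont_pos (G x)) -> cont_pos L -> unif G L -> unif (fun x => K (G x)) (K L).
Proof.
  intros HGc HLc HG t1 t2 eps Ht Heps.
  generalize (filter_and _ _ at_right_0_pos (HG t1 (t2 + 1) eps Ht Heps)). apply filter_imp.
  intros x [Hx Hb] t Htt.
  replace (K (G x) t - K L t) with (K (fun v => 1 * G x v + (-1) * L v) t).
  - apply K_bound; [|lra|].
    + apply cont_pos_plus; apply cont_pos_scal; auto.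
    + intros v Hv. replace (1 * G x v + -1 * L v) with (G x v - L v) by ring. apply Hb. lra.
  - rewrite K_lin by (auto; lra). ring.
Qed.

(** Interpolates between the bounds 1 and [mu z]. The fractional power of [z] loses only
    [alpha theta] in the exponent of the summand, which a full power might not allow. *)
Lemma one_minus_power_le (mu theta z : R) : 0 < mu -> 0 < theta <= 1 -> 0 < z ->
  0 <= 1 - Rpower (z + 1) (- mu) <= (1 + mu) * Rpower z theta.
Proof.
  intros Hmu Hth Hz. rewrite (Rplus_comm z 1).
  assert (H := Rpower_one_plus_bounds mu z ltac:(lra) Hz).
  split; [lra|]. destruct (Rle_dec z 1) as [H1|H1].
  - assert (Hzt : z <= Rpower z theta).
    { rewrite <- (Rpower_1 z Hz) at 1. unfold Rpower.
      assert (Hl : ln z <= 0) by (rewrite <- ln_1; apply ln_le; lra).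
      assert (H2 : 1 * ln z <= theta * ln z) by nra.
      destruct H2 as [H2|H2]; [left; now apply exp_increasing|right; now rewrite H2]. }
    nra.
  - assert (Hzt : 1 <= Rpower z theta).
    { apply Rle_trans with (Rpower z 0); [right; symmetry; now apply Rpower_O|]. apply Rle_Rpower; lra. }
    nra.
Qed.

Lemma g_unif_convergent (alpha gam mu : R) : 0 < alpha -> 0 < mu -> gam < -1 ->
  unif (fun x t => g x t gam alpha mu) (hz (- gam)).
Proof.
  intros Ha Hmu Hg t1 t2 eps Ht1 Heps.
  (* Only half of the available room [-1 - gam] is spent, so [gam + alpha theta] stays below -1 and
     the series still converges. *)
  set (theta := Rmin 1 ((-1 - gam) / (2 * alpha))).
  assert (Hth0 : 0 < theta) by (apply Rmin_glb_lt; [lra|apply Rdiv_lt_0_compat; lra]).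
  assert (Hth1 : theta <= 1) by apply Rmin_l.
  assert (Hth2 : gam + alpha * theta < -1).
  { assert (H : theta <= (-1 - gam) / (2 * alpha)) by apply Rmin_r.
    apply Rmult_le_compat_l with (r := alpha) in H; [|lra].
    replace (alpha * ((-1 - gam) / (2 * alpha))) with ((-1 - gam) / 2) in H by (field; lra). lra. }
  pose (b := fun k => Rpower (INR k + t1) (- - (gam + alpha * theta))).
  assert (Eb : ex_series b) by (apply ex_series_power; lra).
  assert (Hb : 0 <= Series b).
  { apply Rle_trans with (sum_n b 0); [rewrite sum_O; left; apply Rpower_pos|].
    apply sum_n_nonneg_le; [intro; left; apply Rpower_pos|exact Eb]. }
  assert (HB : 0 < (1 + mu) * (Series b + 1)) by (apply Rmult_lt_0_compat; lra).
  assert (Hlim := proj1 (filterlim_R (at_right 0) _ 0) (Rpower_lim_at_0 theta Hth0)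
     (eps / ((1 + mu) * (Series b + 1))) ltac:(now apply Rdiv_lt_0_compat)).
  generalize (filter_and _ _ at_right_0_pos Hlim). apply filter_imp. intros x [Hx Hxe] t Ht.
  rewrite Rminus_0_r, Rabs_pos_eq in Hxe by (left; apply Rpower_pos).
  assert (Hterm : forall k, 0 <= Rpower (INR k + t) (- - gam) - term alpha x gam mu (INR k + t) <=
     (1 + mu) * Rpower x theta * b k).
  { intro k. assert (Hk := pos_INR k). rewrite term_eq, Ropp_involutive.
    assert (Hz : 0 < x * Rpower (INR k + t) alpha) by (apply Rmult_lt_0_compat; [exact Hx|apply Rpower_pos]).
    assert (H := one_minus_power_le mu theta _ Hmu (conj Hth0 Hth1) Hz).
    set (P := Rpower (x * Rpower (INR k + t) alpha + 1) (- mu)) in *.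
    assert (HP := Rpower_pos (INR k + t) gam).
    replace (Rpower (INR k + t) gam - Rpower (INR k + t) gam * P) with (Rpower (INR k + t) gam * (1 - P)) by ring.
    split; [apply Rmult_le_pos; lra|].
    apply Rle_trans with (Rpower (INR k + t) gam * ((1 + mu) * Rpower (x * Rpower (INR k + t) alpha) theta)).
    - apply Rmult_le_compat_l; lra.
    - rewrite <- Rpower_mult_distr by (auto; apply Rpower_pos). rewrite Rpower_mult.
      replace (Rpower (INR k + t) gam * ((1 + mu) * (Rpower x theta * Rpower (INR k + t) (alpha * theta)))) with
        ((1 + mu) * Rpower x theta * (Rpower (INR k + t) gam * Rpower (INR k + t) (alpha * theta))) by ring.
      rewrite <- Rpower_plus. apply Rmult_le_compat_l.
      + apply Rmult_le_pos; [lra|left; apply Rpower_pos].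
      + unfold b. rewrite Ropp_involutive. apply Rpower_le_neg; lra. }
  assert (Ed : ex_series (fun k => (1 + mu) * Rpower x theta * b k)).
  { now apply (ex_series_scal_l (V := R_NormedModule)). }
  assert (E1 : ex_series (fun k => Rpower (INR k + t) (- - gam))) by (apply ex_series_power; lra).
  assert (E2 : ex_series (fun k => term alpha x gam mu (INR k + t))).
  { apply ex_series_dom with (2 := E1). intro k. rewrite Rabs_pos_eq by (left; apply term_pos).
    specialize (Hterm k). lra. }
  rewrite Rabs_minus_sym. unfold hz. rewrite g_Series, <- Series_minus by assumption.
  apply Rle_trans with (Series (fun k => (1 + mu) * Rpower x theta * b k)).
  - rewrite Rabs_pos_eq.
    + now apply Series_le.
    + assert (Ex : ex_series (fun k => Rpower (INR k + t) (- - gam) - term alpha x gam mu (INR k + t))).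
      { now apply (ex_series_minus (V := R_NormedModule)). }
      apply Rle_trans with (sum_n (fun k => Rpower (INR k + t) (- - gam) - term alpha x gam mu (INR k + t)) 0).
      * rewrite sum_O. apply Hterm.
      * apply sum_n_nonneg_le; [intro; apply Hterm|exact Ex].
  - rewrite Series_scal_l. apply Rle_trans with ((1 + mu) * (Series b + 1) * Rpower x theta).
    + assert (Hp := Rpower_pos x theta).
      replace ((1 + mu) * Rpower x theta * Series b) with ((1 + mu) * Rpower x theta * (Series b + 0)) by ring.
      replace ((1 + mu) * (Series b + 1) * Rpower x theta) with ((1 + mu) * Rpower x theta * (Series b + 1)) by ring.
      apply Rmult_le_compat_l; [apply Rmult_le_pos|]; lra.
    + left. apply Rmult_lt_reg_l with (/ ((1 + mu) * (Series b + 1))); [now apply Rinv_0_lt_compat|].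
      rewrite <- Rmult_assoc, Rinv_l, Rmult_1_l by lra. rewrite Rmult_comm. exact Hxe.
Qed.

(** The error [D v^(p+1)] at [v = x t^alpha], multiplied by [x^(-p)], is of order [x]. *)
Lemma unif_integral_part (alpha gam mu D : R) (F : R -> R) (l : R) : 0 < alpha -> 0 <= D ->
  is_mellin ((gam + 1) / alpha) D (beta_kernel mu) F l ->
  unif (fun x t => Rpower x (- ((gam + 1) / alpha)) / alpha *
     (Hp ((gam + 1) / alpha) (x * Rpower t alpha) - F (x * Rpower t alpha))) (fun _ => 0).
Proof.
  intros Ha HD (_ & HF & _) t1 t2 eps Ht Heps. set (p := (gam + 1) / alpha) in *.
  set (C := Rpower t1 (alpha * (p + 1)) + Rpower t2 (alpha * (p + 1))).
  assert (HC : 0 < C) by (assert (H1 := Rpower_pos t1 (alpha * (p + 1))); assert (H2 := Rpower_pos t2 (alpha * (p + 1))); unfold C; lra).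
  assert (HDC : 0 < D * C + 1) by nra.
  apply at_right_0_intro with (eps * alpha / (D * C + 1)).
  { apply Rdiv_lt_0_compat; nra. }
  intros x [Hx Hxe] t Htt. rewrite Rminus_0_r.
  assert (Hy := Rpower_pos t alpha). assert (Hv : 0 < x * Rpower t alpha) by nra.
  assert (Hxp := Rpower_pos x (- p)).
  rewrite Rabs_mult, Rabs_minus_sym, (Rabs_pos_eq (_ / alpha)) by (left; apply Rdiv_lt_0_compat; lra).
  apply Rle_trans with (Rpower x (- p) / alpha * (D * Rpower (x * Rpower t alpha) (p + 1))).
  - apply Rmult_le_compat_l; [left; apply Rdiv_lt_0_compat; lra|now apply HF].
  - rewrite <- Rpower_mult_distr by lra. rewrite Rpower_mult.
    assert (E : Rpower x (- p) * Rpower x (p + 1) = x).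
    { rewrite <- Rpower_plus. replace (- p + (p + 1)) with 1 by ring. now apply Rpower_1. }
    replace (Rpower x (- p) / alpha * (D * (Rpower x (p + 1) * Rpower t (alpha * (p + 1))))) with
      (Rpower x (- p) * Rpower x (p + 1) * (D * Rpower t (alpha * (p + 1))) / alpha) by (field; lra).
    rewrite E.
    assert (Hle : Rpower t (alpha * (p + 1)) <= C) by now apply Rpower_le_endpoints.
    apply Rmult_le_reg_r with (1 := Ha). unfold Rdiv at 1. rewrite Rmult_assoc, Rinv_l, Rmult_1_r by lra.
    apply Rle_trans with (x * (D * C + 1)).
    + apply Rmult_le_compat_l; [lra|]. assert (D * Rpower t (alpha * (p + 1)) <= D * C) by now apply Rmult_le_compat_l. lra.
    + left. apply Rmult_lt_reg_r with (/ (D * C + 1)); [now apply Rinv_0_lt_compat|].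
      rewrite Rmult_assoc, Rinv_r, Rmult_1_r by lra. exact Hxe.
Qed.

Lemma dg_cont_pos (alpha gam mu x : R) : 0 < alpha -> 0 < mu -> gam < alpha * mu -> 0 < x ->
  cont_pos (dg alpha gam mu x).
Proof.
  intros Ha Hmu Hg Hx. apply cont_pos_plus; apply cont_pos_scal; apply g_cont_pos; nra.
Qed.

(** [unif_integral_part] replaces [F] by the explicit [Hp] at the lower endpoint in [g_one_step],
    and [unif_K] passes to the limit under [K]. *)
Lemma g_unif_step (alpha gam mu D : R) (F : R -> R) (l : R) :
  0 < alpha -> 0 < mu -> gam + 1 < alpha * mu -> 0 <= D ->
  is_mellin ((gam + 1) / alpha) D (beta_kernel mu) F l ->
  unif (dg alpha gam mu) (fun t => - xi (- gam) t) ->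
  unif (fun x t => g x t gam alpha mu - Rpower x (- ((gam + 1) / alpha)) / alpha *
     (l - Hp ((gam + 1) / alpha) (x * Rpower t alpha))) (K (xi (- gam))).
Proof.
  intros Ha Hmu Hg HD HF Hu.
  assert (HxiN : cont_pos (fun t => - xi (- gam) t)).
  { intros t Ht. apply (continuous_opp (V := R_NormedModule)). now apply xi_cont. }
  assert (HK := unif_K _ _ (fun x Hx => dg_cont_pos alpha gam mu x Ha Hmu ltac:(lra) Hx) HxiN Hu).
  assert (HI := unif_integral_part alpha gam mu D F l Ha HD HF).
  assert (H := unif_lin 1 (-1) _ _ _ _ HI HK). revert H. apply unif_ext.
  - intros x t Hx Ht. rewrite (g_one_step alpha gam mu x t D F l) by assumption. ring.
  - intros t Ht. rewrite (K_ext (fun t => - xi (- gam) t) (fun v => (-1) * xi (- gam) v)) by (intros; ring).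
    rewrite K_scal; [ring|apply xi_cont|exact Ht].
Qed.

(* The part of [g] that does not converge as [x -> 0+] (none for [gam < -1]) and
   the limit [L0] of the rest. *)
Definition T0 (alpha gam mu x : R) : R :=
  if Rlt_dec gam (-1) then 0
  else if Req_EM_T gam (-1) then - (ln x / alpha)
  else Gamma ((gam + 1) / alpha) * Gamma (mu - (gam + 1) / alpha) / (alpha * Gamma mu) *
       Rpower x (- ((gam + 1) / alpha)).

Definition L0 (alpha gam mu t : R) : R :=
  if Req_EM_T gam (-1) then (psi 1 - psi mu) / alpha - psi t
  else xi (- gam - 1) t / (- gam - 1).

(** The singular part of [g] does not depend on [t], so it must disappear from the [t]-derivative.
    For powers this is the functional equation of Gamma at [mu] and at [mu - gam / alpha]; for
    [gam = 0] the coefficients of the logarithm sum to 0. *)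
Lemma dg_leading_cancel (alpha gam mu x : R) : 0 < alpha -> 0 < mu -> -1 <= gam -> gam < alpha * mu ->
  (gam - alpha * mu) * T0 alpha (gam - 1) mu x + alpha * mu * T0 alpha (gam - 1) (mu + 1) x = 0.
Proof.
  intros Ha Hmu Hg1 Hg2. unfold T0.
  destruct (Rlt_dec (gam - 1) (-1)); [ring|].
  destruct (Req_EM_T (gam - 1) (-1)) as [E|E].
  - assert (gam = 0) by lra. subst gam. field. lra.
  - replace (gam - 1 + 1) with gam by ring.
    assert (Hgm : mu - gam / alpha <> 0).
    { assert (gam / alpha < mu); [|lra]. apply Rmult_lt_reg_r with (1 := Ha).
      unfold Rdiv. rewrite Rmult_assoc, Rinv_l by lra. lra. }
    replace (mu + 1 - gam / alpha) with (mu - gam / alpha + 1) by ring.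
    rewrite !Gamma_succ by lra. assert (HG := Gamma_pos mu Hmu). field. lra.
Qed.

(** Away from [gam = 0] the limit [L0] does not involve [mu] and the coefficients sum to [gam]. At
    [gam = 0] only [psi (mu + 1) - psi mu = 1 / mu] survives, giving [-1 = - xi 0 t]. *)
Lemma dg_limit (alpha gam mu t : R) : 0 < alpha -> 0 < mu -> 0 < t ->
  (gam - alpha * mu) * L0 alpha (gam - 1) mu t + alpha * mu * L0 alpha (gam - 1) (mu + 1) t = - xi (- gam) t.
Proof.
  intros Ha Hmu Ht. unfold L0. destruct (Req_EM_T (gam - 1) (-1)) as [E|E].
  - assert (gam = 0) by lra. subst gam. rewrite Ropp_0, xi_0, psi_succ by assumption. field. lra.
  - replace (- (gam - 1) - 1) with (- gam) by ring. field. lra.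
Qed.

Lemma Hp_nonzero (p v : R) : p <> 0 -> Hp p v = Rpower v p / p.
Proof. intro H. unfold Hp. destruct (Req_EM_T p 0); [contradiction|reflexivity]. Qed.

(** Induction on the number of unit steps that bring [gam] below -1, the convergent range. [mu] is
    generalised because each step uses both [mu] and [mu + 1]. *)
Lemma g_unif_order_0 (alpha : R) (n : nat) : 0 < alpha -> forall gam mu,
  gam < INR n - 1 -> 0 < mu -> gam + 1 < alpha * mu ->
  unif (fun x t => g x t gam alpha mu - T0 alpha gam mu x) (L0 alpha gam mu).
Proof.
  intro Ha.
  assert (Hbase : forall gam mu, gam < -1 -> 0 < mu ->
    unif (fun x t => g x t gam alpha mu - T0 alpha gam mu x) (L0 alpha gam mu)).
  { intros gam mu Hg Hmu. generalize (g_unif_convergent alpha gam mu Ha Hmu Hg). apply unif_ext.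
    - intros x t _ _. unfold T0. destruct (Rlt_dec gam (-1)); [ring|contradiction].
    - intros t Ht. unfold L0. destruct (Req_EM_T gam (-1)); [lra|].
      rewrite xi_hz by lra. replace (1 + (- gam - 1)) with (- gam) by ring. field. lra. }
  induction n as [|n IH]; intros gam mu Hg Hmu Hgm.
  - apply Hbase; [simpl in Hg; lra|exact Hmu].
  - destruct (Rlt_dec gam (-1)) as [Hlt|Hge]; [now apply Hbase|].
    rewrite S_INR in Hg. apply Rnot_lt_le in Hge.
    assert (Hp1 : (gam + 1) / alpha < mu).
    { apply Rmult_lt_reg_r with (1 := Ha). unfold Rdiv. rewrite Rmult_assoc, Rinv_l by lra. lra. }
    assert (Hp0 : 0 <= (gam + 1) / alpha).
    { apply Rmult_le_pos; [lra|left; now apply Rinv_0_lt_compat]. }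
    destruct (beta_mellin_exists ((gam + 1) / alpha) mu (conj Hp0 Hp1)) as (F & l & HF).
    assert (Hu : unif (dg alpha gam mu) (fun t => - xi (- gam) t)).
    { assert (H := unif_lin (gam - alpha * mu) (alpha * mu) _ _ _ _
        (IH (gam - 1) mu ltac:(lra) Hmu ltac:(lra)) (IH (gam - 1) (mu + 1) ltac:(lra) ltac:(lra) ltac:(nra))).
      revert H. apply unif_ext.
      - intros x t _ _. assert (E := dg_leading_cancel alpha gam mu x Ha Hmu Hge ltac:(lra)). unfold dg. lra.
      - intros t Ht. now apply dg_limit. }
    assert (HD : 0 <= mu / ((gam + 1) / alpha + 1)).
    { apply Rmult_le_pos; [lra|left; apply Rinv_0_lt_compat; lra]. }
    assert (H := g_unif_step alpha gam mu _ F l Ha Hmu Hgm HD HF Hu).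
    set (p := (gam + 1) / alpha) in *.
    destruct (Req_EM_T gam (-1)) as [E|E].
    + assert (Ep : p = 0) by (unfold p; rewrite E; field; lra).
      rewrite Ep in H, HF.
      assert (Hl : l = psi 1 - psi mu) by (apply is_kappa_psi; [exact Hmu|eexists; eexists; exact HF]).
      (* Here [Hp 0 (x t^alpha) = ln x + alpha ln t]. The part free of [x] is moved to the limit,
         where [- ln t + K (xi 1) t] is [- psi t]. *)
      assert (Hln : unif (fun _ t => l / alpha - ln t) (fun t => l / alpha - ln t)).
      { intros t1 t2 eps _ Heps. apply at_right_0_intro with 1; [lra|]. intros x _ t _.
        rewrite Rminus_diag, Rabs_R0. lra. }
      assert (H' := unif_lin 1 1 _ _ _ _ H Hln). revert H'. apply unif_ext.
      * intros x t Hx Ht. unfold T0. destruct (Rlt_dec gam (-1)); [lra|].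
        destruct (Req_EM_T gam (-1)); [|contradiction].
        rewrite Hp_0, Ropp_0, Rpower_O, ln_mult, ln_Rpower by (auto; apply Rpower_pos). field. lra.
      * intros t Ht. unfold L0. destruct (Req_EM_T gam (-1)); [|contradiction].
        unfold psi at 3. rewrite E, Hl. replace (- -1) with 1 by ring. ring.
    + assert (Hpp : 0 < p).
      { unfold p. apply Rdiv_lt_0_compat; lra. }
      assert (Hl : l = Gamma p * Gamma (mu - p) / Gamma mu) by (eapply beta_mellin_value; [|exact HF]; lra).
      (* The factor [x^(-p)] cancels in the [Hp] term, leaving [t^(gam+1) / (gam + 1)]; moved to the
         limit, it completes [xi_rec] at [w = - gam - 1] divided by [w]. *)
      assert (Hln : unif (fun _ t => - (Rpower t (gam + 1) / (gam + 1))) (fun t => - (Rpower t (gam + 1) / (gam + 1)))).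
      { intros t1 t2 eps _ Heps. apply at_right_0_intro with 1; [lra|]. intros x _ t _.
        rewrite Rminus_diag, Rabs_R0. lra. }
      assert (H' := unif_lin 1 1 _ _ _ _ H Hln). revert H'. apply unif_ext.
      * intros x t Hx Ht. unfold T0. destruct (Rlt_dec gam (-1)); [lra|].
        destruct (Req_EM_T gam (-1)); [contradiction|]. fold p.
        rewrite Hp_nonzero by lra. rewrite <- Rpower_mult_distr by (auto; apply Rpower_pos). rewrite Rpower_mult.
        replace (alpha * p) with (gam + 1) by (unfold p; field; lra).
        rewrite Hl. assert (HG := Gamma_pos mu Hmu).
        assert (Ex : Rpower x (- p) * Rpower x p = 1).
        { rewrite <- Rpower_plus. replace (- p + p) with 0 by ring. now apply Rpower_O. }
        replace (gam + 1) with (p * alpha) by (unfold p; field; lra).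
        transitivity (g x t gam alpha mu - Gamma p * Gamma (mu - p) / (alpha * Gamma mu) * Rpower x (- p) +
          (Rpower x (- p) * Rpower x p - 1) * (Rpower t (p * alpha) / (p * alpha))); [field; lra|rewrite Ex; ring].
      * intros t Ht. unfold L0. destruct (Req_EM_T gam (-1)); [contradiction|].
        rewrite (xi_rec (- gam - 1)) by exact Ht.
        replace (- (- gam - 1)) with (gam + 1) by ring. replace (- gam - 1 + 1) with (- gam) by ring.
        field. lra.
Qed.

(** * Expansions of all orders *)

Lemma term_cont_x (alpha gam mu y : R) : cont_pos (fun x => term alpha x gam mu y).
Proof.
  intros x Hx. apply (ex_derive_continuous (V := R_NormedModule)).
  assert (Hb := term_base_pos alpha x y Hx).
  apply ex_derive_ext with (fun x => Rpower y gam * Rpower (x * Rpower y alpha + 1) (- mu)).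
  - intro t. symmetry. apply term_eq.
  - unfold Rpower at 2. auto_derive. repeat split; exact Hb.
Qed.

Lemma is_derive_term_x (alpha gam mu y x : R) : 0 < x -> 0 < y ->
  is_derive (fun x => term alpha x gam mu y) x (- mu * term alpha x (gam + alpha) (mu + 1) y).
Proof.
  intros Hx Hy. assert (Hb := term_base_pos alpha x y Hx).
  apply is_derive_ext with (fun x => Rpower y gam * Rpower (x * Rpower y alpha + 1) (- mu)).
  { intro t. symmetry. apply term_eq. }
  rewrite term_eq, Rpower_plus. replace (- (mu + 1)) with (- mu - 1) by ring.
  replace (- mu * (Rpower y gam * Rpower y alpha * Rpower (x * Rpower y alpha + 1) (- mu - 1))) with
    (Rpower y gam * (Rpower y alpha * (- mu * Rpower (x * Rpower y alpha + 1) (- mu - 1)))) by ring.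
  apply is_derive_scal.
  apply (is_derive_comp (fun z => Rpower z (- mu)) (fun x => x * Rpower y alpha + 1)).
  - now apply is_derive_Rpower.
  - auto_derive; [exact I|ring].
Qed.

(** The series of derivatives is integrated term by term from [x / 2], which gives
    [g z - g (x / 2)]; the fundamental theorem then differentiates [g] at [x]. *)
Lemma is_derive_g (alpha gam mu a x : R) : 0 < alpha -> 0 < a -> 0 < mu -> gam + 1 < alpha * mu -> 0 < x ->
  is_derive (fun x => g x a gam alpha mu) x (- mu * g x a (gam + alpha) alpha (mu + 1)).
Proof.
  intros Ha Hapos Hmu Hg Hx.
  pose (f := fun k u => - mu * term alpha u (gam + alpha) (mu + 1) (INR k + a)).
  assert (Hpos : forall k, 0 < INR k + a) by (intro k; assert (H := pos_INR k); lra).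
  assert (Hfc : forall k, cont_pos (f k)) by (intro k; apply cont_pos_scal, term_cont_x).
  pose (M := fun A k => mu * gbound alpha A (gam + alpha) (mu + 1) a k).
  assert (HM : forall A k u, 0 < A < u -> Rabs (f k u) <= M A k).
  { intros A k u HA. unfold f, M. rewrite Rabs_mult, Rabs_Ropp, (Rabs_pos_eq mu) by lra.
    apply Rmult_le_compat_l; [lra|]. apply g_term_bound; nra. }
  assert (EM : forall A, ex_series (M A)).
  { intro A. apply (ex_series_scal_l (V := R_NormedModule)). apply ex_series_gbound; nra. }
  pose (G := fun u => - mu * g u a (gam + alpha) alpha (mu + 1)).
  assert (EG : forall u, G u = Series (fun k => f k u)).
  { intro u. symmetry. apply Series_scal_l. }
  assert (HG : cont_pos G).
  { intros u Hu. apply continuous_ext with (fun u => Series (fun k => f k u)); [intro; now rewrite EG|].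
    apply (continuous_Series f (M (u / 2)) (u / 2) (u + 1)); [| |apply EM|lra].
    - intros k v Hv. apply Hfc. lra.
    - intros k v Hv. apply HM. lra. }
  apply is_derive_ext_loc with (fun z => g (x / 2) a gam alpha mu + RInt G (x / 2) z).
  - assert (Hx2 : x / 2 < x) by lra. generalize (open_gt (x / 2) x Hx2). apply filter_imp. intros z Hz.
    assert (Ez : ex_series (fun k => term alpha z gam mu (INR k + a))) by (apply ex_series_g; lra).
    assert (Ex : ex_series (fun k => term alpha (x / 2) gam mu (INR k + a))) by (apply ex_series_g; lra).
    assert (HI := is_series_RInt f (M (x / 4)) (x / 4) (z + 1) (x / 2) z ltac:(lra) ltac:(lra) ltac:(lra)
      (fun k u Hu => Hfc k u ltac:(lra)) (fun k u Hu => HM (x / 4) k u ltac:(lra)) (EM (x / 4))).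
    apply is_series_unique in HI.
    assert (E1 : RInt G (x / 2) z = RInt (fun u => Series (fun k => f k u)) (x / 2) z).
    { apply RInt_ext. intros u _. apply EG. }
    assert (E2 : RInt G (x / 2) z = g z a gam alpha mu - g (x / 2) a gam alpha mu); [|rewrite E2; apply Rplus_minus].
    rewrite E1, <- HI, !g_Series.
    rewrite <- Series_minus by assumption. apply Series_ext. intro k. apply is_RInt_unique.
    apply (is_RInt_derive (fun u => term alpha u gam mu (INR k + a)));
      intros u Hu; rewrite Rmin_left, Rmax_right in Hu by lra; [apply is_derive_term_x|apply Hfc]; lra || apply Hpos.
  - rewrite <- (Rplus_0_l (- mu * _)). apply (is_derive_plus (V := R_NormedModule)).
    + apply (is_derive_const (V := R_NormedModule)).
    + apply (is_derive_RInt_pos G); [exact HG|lra|exact Hx].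
Qed.

Definition poly_part (adm : nat -> bool) (c : nat -> R) (N : nat) (x : R) : R :=
  sum_n (fun k => if adm k then c k * x ^ k else 0) N.

(** A single order [N] is isolated, so that induction can pass from order [N] at shifted parameters
    to order [N + 1]. *)
Definition expands (F T : R -> R) (adm : nat -> bool) (c : nat -> R) (N : nat) : Prop :=
  forall eps, 0 < eps -> at_right 0 (fun x => Rabs (F x - T x - poly_part adm c N x) <= eps * x ^ N).

Lemma pow_lim_at_0 (k : nat) : filterlim (fun x => x ^ S k) (at_right 0) (locally 0).
Proof.
  apply (filterlim_squeeze_0 (at_right 0) _ (fun x => Rpower x (INR (S k)))).
  - generalize at_right_0_pos. apply filter_imp. intros x Hx.
    rewrite Rpower_pow by exact Hx. rewrite Rabs_pos_eq; [lra|apply pow_le; lra].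
  - apply Rpower_lim_at_0. apply lt_0_INR. lia.
Qed.

Lemma poly_part_lim (adm : nat -> bool) (c : nat -> R) (N : nat) :
  filterlim (poly_part adm c N) (at_right 0) (locally (if adm 0%nat then c 0%nat else 0)).
Proof.
  induction N as [|N IH].
  - apply filterlim_ext with (fun _ => if adm 0%nat then c 0%nat else 0); [|apply filterlim_const].
    intro x. unfold poly_part. rewrite sum_O. destruct (adm 0%nat); [simpl; ring|reflexivity].
  - assert (H := filterlim_lin (at_right 0) 1 (if adm (S N) then c (S N) else 0) _ _ _ _ IH (pow_lim_at_0 N)).
    rewrite Rmult_1_l, Rmult_0_r, Rplus_0_r in H. apply filterlim_ext with (2 := H).
    intro x. unfold poly_part. rewrite sum_Sn.
    change (1 * sum_n (fun k => if adm k then c k * x ^ k else 0) N + (if adm (S N) then c (S N) else 0) * x ^ S N =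
      sum_n (fun k => if adm k then c k * x ^ k else 0) N + (if adm (S N) then c (S N) * x ^ S N else 0)).
    destruct (adm (S N)); ring.
Qed.

Lemma expands_0 (F T : R -> R) (adm : nat -> bool) (c : nat -> R) :
  filterlim (fun x => F x - T x) (at_right 0) (locally (if adm 0%nat then c 0%nat else 0)) ->
  expands F T adm c 0.
Proof.
  intros H eps Heps. generalize (proj1 (filterlim_R (at_right 0) _ _) H eps Heps).
  apply filter_imp. intros x Hx. unfold poly_part. rewrite sum_O, pow_O, Rmult_1_r.
  destruct (adm 0%nat); rewrite ?Rmult_1_r; lra.
Qed.

Lemma is_derive_poly_part (mu : R) (adm adm' : nat -> bool) (c c' : nat -> R) (N : nat) (x : R) :
  (forall k, adm' k = adm (S k)) -> (forall k, INR (S k) * c (S k) = - mu * c' k) ->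
  is_derive (poly_part adm c (S N)) x (- mu * poly_part adm' c' N x).
Proof.
  intros Hadm Hc.
  assert (Hk : forall k, is_derive (fun x => if adm (S k) then c (S k) * x ^ S k else 0) x
     (- mu * (if adm' k then c' k * x ^ k else 0))).
  { intro k. rewrite Hadm. destruct (adm (S k)).
    - replace (- mu * (c' k * x ^ k)) with (c (S k) * (INR (S k) * x ^ k)).
      + apply is_derive_scal. auto_derive; [exact I|]. rewrite Rmult_1_l. reflexivity.
      + rewrite <- Rmult_assoc, <- (Rmult_assoc (- mu)), <- Hc. ring.
    - rewrite Rmult_0_r. apply (is_derive_const (V := R_NormedModule)). }
  induction N as [|N IH].
  - apply is_derive_ext with (fun x => (if adm 0%nat then c 0%nat else 0) + (if adm 1%nat then c 1%nat * x ^ 1 else 0)).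
    + intro t. unfold poly_part. rewrite sum_Sn, sum_O.
      change ((if adm 0%nat then c 0%nat else 0) + (if adm 1%nat then c 1%nat * t ^ 1 else 0) =
        (if adm 0%nat then c 0%nat * t ^ 0 else 0) + (if adm 1%nat then c 1%nat * t ^ 1 else 0)).
      destruct (adm 0%nat); simpl; ring.
    + rewrite <- (Rplus_0_l (- mu * _)). unfold poly_part. rewrite sum_O.
      apply (is_derive_plus (V := R_NormedModule)); [apply (is_derive_const (V := R_NormedModule))|apply Hk].
  - apply is_derive_ext with (fun x => poly_part adm c (S N) x + (if adm (S (S N)) then c (S (S N)) * x ^ S (S N) else 0)).
    + intro t. unfold poly_part. now rewrite (sum_Sn _ (S N)).
    + replace (poly_part adm' c' (S N) x) with
        (poly_part adm' c' N x + (if adm' (S N) then c' (S N) * x ^ S N else 0)) by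
        (unfold poly_part; now rewrite sum_Sn).
      rewrite Rmult_plus_distr_l. apply (is_derive_plus (V := R_NormedModule)); [exact IH|apply Hk].
Qed.

(* Integrating the expansion of the derivative; the limit at [0+] fixes the constant. *)
Lemma expands_integrate (mu : R) (F F' T T' : R -> R) (adm adm' : nat -> bool) (c c' : nat -> R) (N : nat) :
  0 < mu ->
  (forall x, 0 < x -> is_derive F x (- mu * F' x)) ->
  (forall x, 0 < x -> is_derive T x (- mu * T' x)) ->
  (forall k, adm' k = adm (S k)) -> (forall k, INR (S k) * c (S k) = - mu * c' k) ->
  filterlim (fun x => F x - T x) (at_right 0) (locally (if adm 0%nat then c 0%nat else 0)) ->
  expands F' T' adm' c' N -> expands F T adm c (S N).
Proof.
  intros Hmu HF HT Hadm Hc Hlim HN eps Heps.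
  pose (R1 := fun x => F x - T x - poly_part adm c (S N) x).
  pose (R0 := fun x => F' x - T' x - poly_part adm' c' N x).
  assert (HR : forall x, 0 < x -> is_derive R1 x (- mu * R0 x)).
  { intros x Hx. unfold R0. rewrite !Rmult_minus_distr_l.
    apply (is_derive_minus (V := R_NormedModule)).
    - apply (is_derive_minus (V := R_NormedModule)); auto.
    - now apply is_derive_poly_part. }
  assert (HR1 : filterlim R1 (at_right 0) (locally 0)).
  { assert (H := filterlim_lin (at_right 0) 1 (-1) _ _ _ _ Hlim (poly_part_lim adm c (S N))).
    assert (E : forall z, 1 * z + -1 * z = 0) by (intro; ring). rewrite E in H.
    apply filterlim_ext with (2 := H). intro x. unfold R1. ring. }
  assert (Heps' : 0 < eps / mu) by now apply Rdiv_lt_0_compat.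
  destruct (HN (eps / mu) Heps') as [d Hd].
  apply at_right_0_intro with d; [apply cond_pos|]. intros x Hx.
  fold (R1 x).
  (* The mean value theorem bounds [R1 x - R1 y] for [0 < y < x]; letting [y -> 0+], where [R1]
     vanishes, bounds [R1 x] itself. *)
  apply (filterlim_le (F := at_right 0) (fun y => Rabs (R1 x - R1 y)) (fun _ => eps * x ^ S N)
    (Rabs (R1 x)) (eps * x ^ S N)).
  - apply at_right_0_intro with x; [lra|]. intros y Hy.
    destruct (MVT_pos R1 (fun x => - mu * R0 x) y x HR) as (z & Hz & E); try lra.
    rewrite E, Rabs_mult, (Rabs_pos_eq (x - y)), Rabs_mult, Rabs_Ropp, (Rabs_pos_eq mu) by lra.
    assert (Hbz : Rabs (R0 z) <= eps / mu * z ^ N).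
    { apply Hd; [|lra]. change (Rabs (z - 0) < d). rewrite Rminus_0_r, Rabs_pos_eq; lra. }
    assert (Hzx : z ^ N <= x ^ N) by (apply pow_incr; lra).
    apply Rle_trans with (mu * (eps / mu * x ^ N) * x).
    + apply Rmult_le_compat; [|lra| |lra].
      * apply Rmult_le_pos; [lra|apply Rabs_pos].
      * apply Rmult_le_compat_l; [lra|]. apply Rle_trans with (1 := Hbz). apply Rmult_le_compat_l; lra.
    + right. simpl. field. lra.
  - assert (H := filterlim_lin (at_right 0) 1 (-1) (fun _ => R1 x) R1 (R1 x) 0 (filterlim_const (R1 x)) HR1).
    replace (1 * R1 x + -1 * 0) with (R1 x) in H by ring.
    apply filterlim_comp with (g := Rabs) (2 := filterlim_norm (R1 x)).
    apply filterlim_ext with (2 := H). intro y. ring.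
  - apply filterlim_const.
Qed.

(** * Coefficients and leading terms under differentiation in [x] *)

Lemma unif_pointwise (G : R -> R -> R) (L : R -> R) (t : R) :
  0 < t -> unif G L -> filterlim (fun x => G x t) (at_right 0) (locally (L t)).
Proof.
  intros Ht H. apply (filterlim_R (at_right 0)). intros eps Heps.
  generalize (H t t (eps / 2) Ht ltac:(lra)). apply filter_imp. intros x Hx. specialize (Hx t ltac:(lra)). lra.
Qed.

Lemma g_order_0 (alpha gam mu a : R) : 0 < alpha -> 0 < a -> 0 < mu -> gam + 1 < alpha * mu ->
  filterlim (fun x => g x a gam alpha mu - T0 alpha gam mu x) (at_right 0) (locally (L0 alpha gam mu a)).
Proof.
  intros Ha Hapos Hmu Hg. destruct (INR_unbounded (gam + 1)) as [n Hn].
  apply (unif_pointwise (fun x t => g x t gam alpha mu - T0 alpha gam mu x)); [exact Hapos|].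
  apply (g_unif_order_0 alpha n); lra.
Qed.

(** The only evaluation of the zeta function: higher coefficients are reached by [g_coeff_succ] at
    shifted parameters. *)
Lemma g_coeff_0 (alpha gam mu a : R) : 0 < mu -> 0 < a -> gam <> -1 ->
  g_coeff a gam alpha mu 0 = L0 alpha gam mu a.
Proof.
  intros Hmu Ha Hg. unfold g_coeff, L0. destruct (Req_EM_T gam (-1)); [contradiction|].
  simpl INR. rewrite !Rmult_0_r, Rplus_0_r.
  rewrite hurwitz_zeta_R_xi by lra. replace (0 - gam - 1) with (- gam - 1) by ring.
  assert (HG := Gamma_pos mu Hmu). simpl. field. lra.
Qed.

(** The zeta factor is literally the same on both sides and stays unevaluated, so even the index
    where its argument is 1 needs no exception. *)
Lemma g_coeff_succ (alpha gam mu a : R) (k : nat) : 0 < mu ->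
  INR (S k) * g_coeff a gam alpha mu (S k) = - mu * g_coeff a (gam + alpha) alpha (mu + 1) k.
Proof.
  intro Hmu. unfold g_coeff.
  replace (- alpha * INR (S k) - gam) with (- alpha * INR k - (gam + alpha)) by (rewrite S_INR; ring).
  replace (mu + INR (S k)) with (mu + 1 + INR k) by (rewrite S_INR; ring).
  rewrite (Gamma_succ mu) by lra. rewrite fact_simpl, mult_INR.
  assert (HG := Gamma_pos mu Hmu). assert (Hf := INR_fact_lt_0 k).
  assert (Hk : 0 < INR (S k)) by (apply lt_0_INR; lia). simpl pow. field. lra.
Qed.

Definition T_power (alpha gam mu x : R) : R :=
  Gamma ((gam + 1) / alpha) * Gamma (mu - (gam + 1) / alpha) / (alpha * Gamma mu) *
  Rpower x (- ((gam + 1) / alpha)).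

Lemma is_derive_T_power (alpha gam mu x : R) : 0 < alpha -> 0 < mu -> gam <> -1 -> 0 < x ->
  is_derive (T_power alpha gam mu) x (- mu * T_power alpha (gam + alpha) (mu + 1) x).
Proof.
  intros Ha Hmu Hg Hx. unfold T_power.
  assert (Hp0 : (gam + 1) / alpha <> 0).
  { intro E. apply (f_equal (Rmult alpha)) in E. replace (alpha * ((gam + 1) / alpha)) with (gam + 1) in E by (field; lra). lra. }
  replace ((gam + alpha + 1) / alpha) with ((gam + 1) / alpha + 1) by (field; lra).
  set (p := (gam + 1) / alpha) in *.
  replace (mu + 1 - (p + 1)) with (mu - p) by ring.
  rewrite (Gamma_succ p), (Gamma_succ mu) by lra. replace (- (p + 1)) with (- p - 1) by ring.
  replace (- mu * (p * Gamma p * Gamma (mu - p) / (alpha * (mu * Gamma mu)) * Rpower x (- p - 1))) with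
    (Gamma p * Gamma (mu - p) / (alpha * Gamma mu) * (- p * Rpower x (- p - 1))).
  - apply is_derive_scal. now apply is_derive_Rpower.
  - assert (HG := Gamma_pos mu Hmu). field. lra.
Qed.

Definition T_log (a alpha mu : R) (r : nat) (x : R) : R :=
  Gamma (mu + INR r) * (-1) ^ r * x ^ r / (Gamma mu * Gamma (INR r + 1))
  * (- (ln x / alpha)
     + Derive Gamma (INR r + 1) / (alpha * Gamma (INR r + 1))
     - Derive Gamma a / Gamma a
     - Derive Gamma (mu + INR r) / (alpha * Gamma (mu + INR r))).

Lemma T_log_eq (a alpha mu : R) (r : nat) (x : R) : 0 < a -> 0 < alpha -> 0 < mu ->
  T_log a alpha mu r x = Gamma (mu + INR r) * (-1) ^ r / (Gamma mu * Gamma (INR r + 1)) *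
    (x ^ r * (- (ln x / alpha) + psi (INR r + 1) / alpha - psi a - psi (mu + INR r) / alpha)).
Proof.
  intros Ha Hal Hmu. assert (Hr := pos_INR r). unfold T_log.
  rewrite <- !digamma by lra.
  assert (H1 := Gamma_pos mu Hmu). assert (H2 := Gamma_pos (INR r + 1) ltac:(lra)).
  assert (H3 := Gamma_pos (mu + INR r) ltac:(lra)). assert (H4 := Gamma_pos a Ha). field. lra.
Qed.

(** Differentiating the logarithm produces [- x^r / alpha], which cancels against the increment
    [1 / (r + 1)] between [psi (r + 2)] and [psi (r + 1)]. *)
Lemma is_derive_T_log_succ (a alpha mu : R) (r : nat) (x : R) : 0 < a -> 0 < alpha -> 0 < mu -> 0 < x ->
  is_derive (T_log a alpha mu (S r)) x (- mu * T_log a alpha (mu + 1) r x).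
Proof.
  intros Ha Hal Hmu Hx. assert (Hr := pos_INR r).
  eapply is_derive_ext; [intro t; symmetry; apply T_log_eq; assumption|].
  rewrite (T_log_eq a alpha (mu + 1)) by lra. rewrite S_INR.
  replace (mu + 1 + INR r) with (mu + (INR r + 1)) by ring.
  rewrite (Gamma_succ mu), (Gamma_succ (INR r + 1)), (psi_succ (INR r + 1)) by lra.
  assert (H1 := Gamma_pos mu Hmu). assert (H2 := Gamma_pos (INR r + 1) ltac:(lra)).
  set (A := Gamma (mu + (INR r + 1))). set (ps := psi (INR r + 1)). set (pm := psi (mu + (INR r + 1))).
  replace (- mu * (A * (-1) ^ r / (mu * Gamma mu * Gamma (INR r + 1)) *
     (x ^ r * (- (ln x / alpha) + ps / alpha - psi a - pm / alpha)))) with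
    (A * (-1) ^ S r / (Gamma mu * ((INR r + 1) * Gamma (INR r + 1))) *
     ((INR (S r) * x ^ r) * (- (ln x / alpha) + (ps + / (INR r + 1)) / alpha - psi a - pm / alpha) +
      x ^ S r * (- (/ x / alpha)))).
  - apply is_derive_scal.
    apply (is_derive_mult (fun x => x ^ S r) (fun x => - (ln x / alpha) + (ps + / (INR r + 1)) / alpha - psi a - pm / alpha)).
    + auto_derive; [exact I|]. rewrite Rmult_1_l. reflexivity.
    + auto_derive; [exact Hx|]. field. lra.
    + intros; apply Rmult_comm.
  - rewrite S_INR. simpl. field. repeat split; lra.
Qed.

Lemma T_log_0 (a alpha mu x : R) : 0 < a -> 0 < alpha -> 0 < mu ->
  T_log a alpha mu 0 x = - (ln x / alpha) + ((psi 1 - psi mu) / alpha - psi a).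
Proof.
  intros Ha Hal Hmu. rewrite T_log_eq by assumption. simpl INR. rewrite Rplus_0_l, Rplus_0_r, Gamma_1.
  assert (H := Gamma_pos mu Hmu). simpl. field. lra.
Qed.

(** The derivative of the pure logarithm is the power [x^(-1)]: the case [r = 0] passes into the
    non-logarithmic case with [(gam + alpha + 1) / alpha = 1]. *)
Lemma is_derive_T_log_0 (a alpha mu x : R) : 0 < a -> 0 < alpha -> 0 < mu -> 0 < x ->
  is_derive (T_log a alpha mu 0) x (- mu * T_power alpha (-1 + alpha) (mu + 1) x).
Proof.
  intros Ha Hal Hmu Hx.
  eapply is_derive_ext; [intro t; symmetry; apply T_log_0; assumption|].
  unfold T_power. replace ((-1 + alpha + 1) / alpha) with 1 by (field; lra).
  replace (mu + 1 - 1) with mu by ring. rewrite Gamma_1, Gamma_succ, Rpower_Ropp, Rpower_1 by lra.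
  assert (H := Gamma_pos mu Hmu). auto_derive; [exact Hx|]. field. lra.
Qed.

Lemma T_power_lim_0 (alpha gam mu : R) : 0 < alpha -> gam < -1 ->
  filterlim (T_power alpha gam mu) (at_right 0) (locally 0).
Proof.
  intros Ha Hg. unfold T_power.
  set (c := Gamma ((gam + 1) / alpha) * Gamma (mu - (gam + 1) / alpha) / (alpha * Gamma mu)).
  assert (Hp0 : 0 < - ((gam + 1) / alpha)).
  { replace (- ((gam + 1) / alpha)) with ((- (gam + 1)) / alpha) by (field; lra). apply Rdiv_lt_0_compat; lra. }
  assert (H := filterlim_lin (at_right 0) c 0 _ _ 0 0 (Rpower_lim_at_0 _ Hp0) (Rpower_lim_at_0 _ Hp0)).
  replace (c * 0 + 0 * 0) with 0 in H by ring. apply filterlim_ext with (2 := H). intro x. ring.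
Qed.

(** From [ln y <= y - 1] at [y = x^(-1/2)] follows [- ln x <= 2 x^(-1/2)], so one factor [x]
    suffices. *)
Lemma pow_ln_lim_0 (r : nat) : filterlim (fun x => x ^ S r * ln x) (at_right 0) (locally 0).
Proof.
  apply (filterlim_squeeze_0 (at_right 0) _ (fun x => 2 * Rpower x (/ 2) + 0 * Rpower x (/ 2))).
  - apply at_right_0_intro with 1; [lra|]. intros x Hx.
    assert (Hl : ln x <= 0) by (rewrite <- ln_1; apply ln_le; lra).
    assert (Hpow : 0 < x ^ r <= 1).
    { split; [apply pow_lt; lra|]. rewrite <- (pow1 r). apply pow_incr. lra. }
    assert (H := ln_le_sub_1 (Rpower x (- / 2)) (Rpower_pos _ _)). rewrite ln_Rpower in H.
    assert (E : x * Rpower x (- / 2) = Rpower x (/ 2)).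
    { rewrite <- (Rpower_1 x) at 1 by lra. rewrite <- Rpower_plus. f_equal. field. }
    rewrite Rabs_mult, (Rabs_pos_eq (x ^ S r)), Rabs_left1 by (lra || (apply pow_le; lra)).
    simpl pow. apply Rle_trans with (x * - ln x).
    + apply Rmult_le_compat_r; [lra|]. apply Rle_trans with (x * 1); [apply Rmult_le_compat_l|]; lra.
    + rewrite Rmult_0_l, Rplus_0_r, <- E. apply Rle_trans with (x * (2 * Rpower x (- / 2))); [|right; ring].
      apply Rmult_le_compat_l; lra.
  - assert (Hh : 0 < / 2) by lra.
    assert (H := filterlim_lin (at_right 0) 2 0 _ _ 0 0 (Rpower_lim_at_0 _ Hh) (Rpower_lim_at_0 _ Hh)).
    replace (2 * 0 + 0 * 0) with 0 in H by ring. exact H.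
Qed.

Lemma T_log_lim_0 (a alpha mu : R) (r : nat) : 0 < a -> 0 < alpha -> 0 < mu ->
  filterlim (T_log a alpha mu (S r)) (at_right 0) (locally 0).
Proof.
  intros Ha Hal Hmu.
  set (c := Gamma (mu + INR (S r)) * (-1) ^ S r / (Gamma mu * Gamma (INR (S r) + 1))).
  set (d := psi (INR (S r) + 1) / alpha - psi a - psi (mu + INR (S r)) / alpha).
  assert (H := filterlim_lin (at_right 0) (c * d) (- c / alpha) _ _ 0 0 (pow_lim_at_0 r) (pow_ln_lim_0 r)).
  rewrite !Rmult_0_r, Rplus_0_r in H. apply filterlim_ext with (2 := H).
  intro x. rewrite T_log_eq by assumption. fold c. unfold d. field. lra.
Qed.

Lemma filterlim_sub_0 (F T : R -> R) (l : R) :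
  filterlim F (at_right 0) (locally l) -> filterlim T (at_right 0) (locally 0) ->
  filterlim (fun x => F x - T x) (at_right 0) (locally l).
Proof.
  intros HF HT. assert (H := filterlim_lin (at_right 0) 1 (-1) _ _ _ _ HF HT).
  replace (1 * l + -1 * 0) with l in H by ring. apply filterlim_ext with (2 := H). intro x. ring.
Qed.

Lemma g_lim_0 (alpha gam mu a : R) : 0 < alpha -> 0 < a -> 0 < mu -> gam < -1 ->
  filterlim (fun x => g x a gam alpha mu) (at_right 0) (locally (L0 alpha gam mu a)).
Proof.
  intros Ha Hapos Hmu Hg. assert (H := g_order_0 alpha gam mu a Ha Hapos Hmu ltac:(nra)).
  apply filterlim_ext with (2 := H). intro x. unfold T0. destruct (Rlt_dec gam (-1)); [ring|contradiction].
Qed.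

Lemma g_minus_T_power_lim (alpha gam mu a : R) : 0 < alpha -> 0 < a -> 0 < mu -> gam + 1 < alpha * mu ->
  gam <> -1 ->
  filterlim (fun x => g x a gam alpha mu - T_power alpha gam mu x) (at_right 0) (locally (g_coeff a gam alpha mu 0)).
Proof.
  intros Ha Hapos Hmu Hg Hg1. rewrite g_coeff_0 by assumption.
  destruct (Rlt_dec gam (-1)) as [H|H].
  - apply filterlim_sub_0; [now apply g_lim_0|now apply T_power_lim_0].
  - assert (H0 := g_order_0 alpha gam mu a Ha Hapos Hmu Hg).
    apply filterlim_ext with (2 := H0). intro x. unfold T0, T_power.
    destruct (Rlt_dec gam (-1)); [contradiction|]. destruct (Req_EM_T gam (-1)); [contradiction|reflexivity].
Qed.

(** For [r = 0] the constant of order zero is already contained in [T_log], so the limit is 0; for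
    [r > 0] the logarithmic term vanishes at 0+ and the limit is the coefficient of index 0. *)
Lemma g_minus_T_log_lim (alpha gam mu a : R) (r : nat) :
  0 < alpha -> 0 < a -> 0 < mu -> gam + 1 < alpha * mu -> gam = - alpha * INR r - 1 ->
  filterlim (fun x => g x a gam alpha mu - T_log a alpha mu r x) (at_right 0)
    (locally (if negb (Nat.eqb 0 r) then g_coeff a gam alpha mu 0 else 0)).
Proof.
  intros Ha Hapos Hmu Hg Hr. destruct r as [|r]; simpl negb.
  - simpl in Hr. assert (Eg : gam = -1) by lra.
    assert (H := g_order_0 alpha gam mu a Ha Hapos Hmu Hg).
    assert (H' := filterlim_lin (at_right 0) 1 (-1) _ _ _ _ H (filterlim_const (L0 alpha gam mu a))).
    replace (1 * L0 alpha gam mu a + -1 * L0 alpha gam mu a) with 0 in H' by ring.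
    apply filterlim_ext with (2 := H'). intro x. rewrite T_log_0 by assumption. unfold T0, L0.
    destruct (Rlt_dec gam (-1)); [lra|]. destruct (Req_EM_T gam (-1)); [ring|contradiction].
  - assert (Hk : 0 < INR (S r)) by (apply lt_0_INR; lia). assert (Hg1 : gam < -1) by nra.
    rewrite g_coeff_0 by lra. apply filterlim_sub_0; [now apply g_lim_0|now apply T_log_lim_0].
Qed.

(** Both cases share one induction on the order: passing to [(gam + alpha, mu + 1)] keeps the power
    case, lowers [r + 1] to [r], and turns [r = 0] into the power case. *)
Lemma g_expands (a alpha : R) (N : nat) : 0 < a -> 0 < alpha -> forall gam mu,
  0 < mu -> gam + 1 < alpha * mu ->
  ((~ exists r : nat, - ((gam + 1) / alpha) = INR r) ->
   expands (fun x => g x a gam alpha mu) (T_power alpha gam mu) (fun _ => true) (g_coeff a gam alpha mu) N) /\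
  (forall r : nat, - ((gam + 1) / alpha) = INR r ->
   expands (fun x => g x a gam alpha mu) (T_log a alpha mu r) (fun k => negb (Nat.eqb k r)) (g_coeff a gam alpha mu) N).
Proof.
  intros Hapos Ha.
  assert (Hne : forall gam, (~ exists r : nat, - ((gam + 1) / alpha) = INR r) -> gam <> -1).
  { intros gam H E. apply H. exists 0%nat. rewrite E. simpl. field. lra. }
  assert (Heq : forall gam (r : nat), - ((gam + 1) / alpha) = INR r -> gam = - alpha * INR r - 1).
  { intros gam r E. rewrite <- E. field. lra. }
  induction N as [|N IH]; intros gam mu Hmu Hg.
  - split.
    + intro Hno. apply expands_0. apply (g_minus_T_power_lim alpha gam mu a); auto.
    + intros r Hr. apply expands_0. apply (g_minus_T_log_lim alpha gam mu a r); auto.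
  - assert (Hmu1 : 0 < mu + 1) by lra. assert (Hg1 : gam + alpha + 1 < alpha * (mu + 1)) by lra.
    destruct (IH (gam + alpha) (mu + 1) Hmu1 Hg1) as [IH1 IH2].
    assert (Eshift : - ((gam + alpha + 1) / alpha) = - ((gam + 1) / alpha) - 1) by (field; lra).
    split.
    + intro Hno. apply (expands_integrate mu _ (fun x => g x a (gam + alpha) alpha (mu + 1)) _
        (T_power alpha (gam + alpha) (mu + 1)) _ (fun _ => true) _ (g_coeff a (gam + alpha) alpha (mu + 1))); auto.
      * intros x Hx. now apply is_derive_g.
      * intros x Hx. apply is_derive_T_power; auto.
      * intro k. now apply g_coeff_succ.
      * now apply (g_minus_T_power_lim alpha gam mu a); auto.
      * apply IH1. intros [r Hr]. apply Hno. exists (S r). rewrite S_INR. lra.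
    + intros [|r] Hr.
      * assert (Eg : gam = -1) by (rewrite (Heq gam 0%nat Hr); simpl; ring).
        apply (expands_integrate mu _ (fun x => g x a (gam + alpha) alpha (mu + 1)) _
          (T_power alpha (gam + alpha) (mu + 1)) _ (fun _ => true) _ (g_coeff a (gam + alpha) alpha (mu + 1))); auto.
        -- intros x Hx. now apply is_derive_g.
        -- intros x Hx. rewrite Eg. now apply is_derive_T_log_0.
        -- intro k. now apply g_coeff_succ.
        -- apply (g_minus_T_log_lim alpha gam mu a 0); auto.
        (* At the shifted parameters the tested quantity is -1, which is no natural number. *)
        -- apply IH1. intros [s Hs]. assert (H := pos_INR s). simpl in Hr. lra.
      * apply (expands_integrate mu _ (fun x => g x a (gam + alpha) alpha (mu + 1)) _
          (T_log a alpha (mu + 1) r) _ (fun k => negb (Nat.eqb k r)) _ (g_coeff a (gam + alpha) alpha (mu + 1))); auto.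
        -- intros x Hx. now apply is_derive_g.
        -- intros x Hx. now apply is_derive_T_log_succ.
        -- intro k. now apply g_coeff_succ.
        -- apply (g_minus_T_log_lim alpha gam mu a (S r)); auto.
        -- apply IH2. rewrite S_INR in Hr. lra.
Qed.

Lemma expands_asymptotic (F T : R -> R) (adm : nat -> bool) (c : nat -> R) :
  (forall N, expands F T adm c N) -> asymptotic_expansion_at_0 F T adm c.
Proof.
  intros H N eps. generalize (filter_and _ _ at_right_0_pos (H N eps (cond_pos eps))).
  apply filter_imp. intros x [Hx HN].
  change (Rabs (F x - T x - poly_part adm c N x) <= eps * Rabs (x ^ N)).
  rewrite (Rabs_pos_eq (x ^ N)) by (apply pow_le; lra). exact HN.
Qed.

Theorem theorem1p3 :
  forall a gamma alpha mu : R,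
    0 < a -> 0 < alpha -> Rmax ((gamma + 1) / alpha) 0 < mu ->
    ((~ exists r : nat, - ((gamma + 1) / alpha) = INR r) ->
     asymptotic_expansion_at_0
       (fun x => g x a gamma alpha mu)
       (fun x =>
          Gamma ((gamma + 1) / alpha) * Gamma (mu - (gamma + 1) / alpha)
          / (alpha * Gamma mu)
          * Rpower x (- ((gamma + 1) / alpha)))
       (fun _ => true)
       (g_coeff a gamma alpha mu))
    /\
    (forall r : nat, - ((gamma + 1) / alpha) = INR r ->
     asymptotic_expansion_at_0
       (fun x => g x a gamma alpha mu)
       (fun x =>
          Gamma (mu + INR r) * (-1) ^ r * x ^ r
          / (Gamma mu * Gamma (INR r + 1))
          * (- (ln x / alpha)
             + Derive Gamma (INR r + 1) / (alpha * Gamma (INR r + 1))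
             - Derive Gamma a / Gamma a
             - Derive Gamma (mu + INR r) / (alpha * Gamma (mu + INR r))))
       (fun k => negb (Nat.eqb k r))
       (g_coeff a gamma alpha mu)).
Proof.
  intros a gamma alpha mu Ha Hal Hmax.
  assert (Hmu : 0 < mu) by (apply Rle_lt_trans with (2 := Hmax), Rmax_r).
  assert (Hg : gamma + 1 < alpha * mu).
  { assert (H := Rle_lt_trans _ _ _ (Rmax_l _ _) Hmax).
    apply Rmult_lt_compat_l with (r := alpha) in H; [|exact Hal].
    replace (alpha * ((gamma + 1) / alpha)) with (gamma + 1) in H by (field; lra). exact H. }
  split.
  - intro Hno. apply (expands_asymptotic _ (T_power alpha gamma mu)).
    intro N. now apply (g_expands a alpha N Ha Hal gamma mu Hmu Hg).
  - intros r Hr. apply (expands_asymptotic _ (T_log a alpha mu r)).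
    intro N. now apply (g_expands a alpha N Ha Hal gamma mu Hmu Hg).
Qed.
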